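(* Let $A:\mathbb R^d\to\mathbb R^d$, $V:\mathbb R^d\to\mathbb R$ be time-independent smooth potentials such that all partial derivatives of order $\ge2$ of $V+\frac12|A|^2$ are bounded and all partial derivatives of order $\ge1$ of $A$ are bounded. Suppose we are given a splitting scheme of order $\nu$ and an explicit $s$-stage Runge--Kutta method $(L,b)$ of order $\nu$ with weights $b_i\ne0$ for all $i=1,\dots,s$. Apply the partitioned Runge--Kutta method with Butcher tableaus $(L,b)$ (for $\mathbf q$) and $(\hat L,b)$ (for $\mathbf p$), $\hat L=\mathbf 1_sb^\top-\mathrm{diag}(b)^{-1}L^\top\mathrm{diag}(b)$, to the evolution of $\mathbf h_{\mathrm{mag}}$, and consider the resulting splitting integrator for $$\mathbf h=\mathbf h_{\mathrm{kin}}+\mathbf h_{\mathrm{pot}}+\mathbf h_{\mathrm{mag}},\quad \mathbf h_{\mathrm{kin}}=\tfrac12\mathbf p^\top\mathbf p,\quad \mathbf h_{\mathrm{pot}}=\mathbf V(\mathbf q),\quad \mathbf h_{\mathrm{mag}}=-\mathbf A(\mathbf q)^\top\mathbf p .$$ If the numerical trajectory stays in a compact set $K\subset\mathbb R^{2D}$, then there is a constant $\tau_0>0$ that depends only on $L$, $b$, $K$ and $A,V$ such that for step sizes $\tau\le\tau_0$ the integrator is well-defined, explicit, symplectic and of order $\nu$.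
   Context: Let $d\in\mathbb N$ and $D=d+2d^2$. Write $\mathbf q=(q,\mathrm{vec}(X_1),\mathrm{vec}(X_2))\in\mathbb R^D$ with $q\in\mathbb R^d$, $X_1,X_2\in\mathbb R^{d\times d}$ (in the paper $X_1=\sqrt{\varepsilon/2}\,\mathrm{Re}\,Q$, $X_2=\sqrt{\varepsilon/2}\,\mathrm{Im}\,Q$ for the width matrix factor $Q$ of a Gaussian wave packet and semiclassical parameter $\varepsilon>0$); $\mathrm{vec}$ stacks columns. For a function $f$ on $\mathbb R^d$ set $$\langle f\rangle(\mathbf q)=(2\pi)^{-d}\int_{\mathbb R^{2d}}f(q+X_1\zeta_1+X_2\zeta_2)\,e^{-\frac12(|\zeta_1|^2+|\zeta_2|^2)}\,d\zeta_1d\zeta_2 .$$ Averaged potentials: $\mathbf A(\mathbf q)=\big(\langle A\rangle,\mathrm{vec}(\langle J_A\rangle X_1),\mathrm{vec}(\langle J_A\rangle X_2)\big)\in\mathbb R^D$ with $J_A$ the Jacobi matrix of $A$, and $\mathbf V(\mathbf q)=\frac12\langle|A|^2\rangle+\langle V\rangle$. $J_{\mathbf A}$ is the Jacobi matrix of $\mathbf A$. Sub-steps: the kinetic equations $\dot{\mathbf q}=\mathbf p,\dot{\mathbf p}=0$ and the potential equations $\dot{\mathbf q}=0,\dot{\mathbf p}=-\nabla_{\mathbf q}\mathbf V(\mathbf q)$ are integrated exactly. The magnetic equations $\dot{\mathbf q}=-\mathbf A(\mathbf q)$, $\dot{\mathbf p}=J_{\mathbf A}(\mathbf q)^\top\mathbf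 p$ are discretized with a step $\tau$ by $$\mathbf q_{n+1}=\mathbf q_n+\tau\sum_{i}b_i\mathbf k^{(i)},\quad \mathbf p_{n+1}=\mathbf p_n+\tau\sum_{i}b_i\boldsymbol\ell^{(i)},$$ $$\mathbf k^{(i)}=-\mathbf A\Big(\mathbf q_n+\tau\sum_{j<i}l_{ij}\mathbf k^{(j)}\Big),\quad \boldsymbol\ell^{(i)}=M_n^{(i)}\Big(\mathbf p_n+\tau\sum_{j=1}^s\hat l_{ij}\boldsymbol\ell^{(j)}\Big),\quad M_n^{(i)}=J_{\mathbf A}\Big(\mathbf q_n+\tau\sum_{j<i}l_{ij}\mathbf k^{(j)}\Big)^\top,$$ with $L=(l_{ij})$ strictly lower triangular, $\hat L=(\hat l_{ij})$, $\mathbf 1_s$ the vector of ones. A splitting scheme of order $\nu$ is a fixed composition of sub-flows of $\mathbf h_{\mathrm{kin}},\mathbf h_{\mathrm{pot}},\mathbf h_{\mathrm{mag}}$ with step sizes that are fixed multiples of $\tau$, which with exact sub-flows approximates the flow of $\mathbf h$ with local error $O(\tau^{\nu+1})$; the splitting integrator replaces the exact flow of $\mathbf h_{\mathrm{mag}}$ by the partitioned Runge--Kutta map. ''Well-defined'' means that the (linear) systems for the momentum stages are uniquely solvable; ''explicit'' means that a step requires no solution of nonlinear equations (only evaluations of $\mathbf A,\mathbf V$ and derivatives, and linear algebra with $D\times D$ matrices); ''symplectic'' refers to the standard symplectic form on $\mathbb R^{2D}$.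
   Formalization: The step-size condition is read as τ ≤ τ0 and |cτ| ≤ τ0 for every multiple c of τ used in a magnetic sub-step of the splitting scheme; a τ0 independent of the scheme cannot otherwise exist when |c| may be arbitrarily large. *)

(* Defs.v *)
From HB Require Import structures.
From mathcomp Require Import all_boot all_order all_algebra.
From mathcomp Require Import all_classical all_reals all_analysis.

Set Implicit Arguments.
Unset Strict Implicit.
Unset Printing Implicit Defensive.

Import Order.TTheory GRing.Theory Num.Theory.
Import numFieldNormedType.Exports.

Local Open Scope classical_set_scope.
Local Open Scope ring_scope.

Section Calculus.
Context {R : realType}.

Definition partial n (j : 'I_n) (f : 'cV[R]_n -> R) (x : 'cV[R]_n) : R :=
  'D_(delta_mx j 0) f x.

Definition partials n (r : seq 'I_n) (f : 'cV[R]_n -> R) : 'cV[R]_n -> R :=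
  foldr (@partial n) f r.

(* C^oo: all iterated partial derivatives exist and are continuous. *)
Definition smooth n (f : 'cV[R]_n -> R) : Prop :=
  forall r : seq 'I_n,
    continuous (partials r f) /\
    forall j x, derivable (partials r f) x (delta_mx j 0).

Definition smooth_vec n m (f : 'cV[R]_n -> 'cV[R]_m) : Prop :=
  forall i, smooth (fun x => f x i 0).

Definition bounded_partials n (k : nat) (f : 'cV[R]_n -> R) : Prop :=
  forall r : seq 'I_n, (k <= size r)%N ->
    exists C : R, forall x, `|partials r f x| <= C.

Definition grad n (f : 'cV[R]_n -> R) (x : 'cV[R]_n) : 'cV[R]_n :=
  \col_j partial j f x.

Definition Jac n m (f : 'cV[R]_n -> 'cV[R]_m) (x : 'cV[R]_n) : 'M[R]_(m, n) :=
  \matrix_(i, j) partial j (fun y => f y i 0) x.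

(* [`|x|] on matrices is the sup norm, hence the explicit Euclidean product. *)
Definition dot n (x y : 'cV[R]_n) : R := \sum_i x i 0 * y i 0.
Definition sqnorm n (x : 'cV[R]_n) : R := dot x x.

Definition is_solution n (X : 'cV[R]_n -> 'cV[R]_n) (I : set R)
    (u : R -> 'cV[R]_n) : Prop :=
  forall t, I t -> is_derive t 1 u (X (u t)).

(* Value at time [t] of the global solution starting at [y]; the default value
   [y] is used only if there is no such solution. *)
Definition flow n (X : 'cV[R]_n -> 'cV[R]_n) (t : R) (y : 'cV[R]_n) :
    'cV[R]_n :=
  xget y [set z | exists u, [/\ is_solution X setT u, u 0 = y & u t = z]].

End Calculus.

Section LebesgueRn.
Context {R : realType}.

Definition consR n (z : n.-tuple (measurableTypeR R) * measurableTypeR R) :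
    n.+1.-tuple (measurableTypeR R) :=
  [the n.+1.-tuple _ of z.2 :: z.1].

Lemma measurable_consR n : measurable_fun setT (@consR n).
Proof. exact: measurable_cons. Qed.

Section lebesgueS.
Context n (mu : {measure set (n.-tuple (measurableTypeR R)) -> \bar R}).
Local Open Scope ereal_scope.

Definition lebesgueS : set (n.+1.-tuple (measurableTypeR R)) -> \bar R :=
  pushforward (mu \x lebesgue_measure) (@consR n).

Let mcons := @measurable_consR n.

Let lebesgueS0 : lebesgueS set0 = 0.
Proof. by rewrite /lebesgueS /pushforward preimage_set0 measure0. Qed.

Let lebesgueS_ge0 A : 0 <= lebesgueS A.
Proof. exact: measure_ge0. Qed.

Let lebesgueS_sigma_additive : semi_sigma_additive lebesgueS.
Proof. exact: (@measure_semi_sigma_additive _ _ _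
  (pushforward (mu \x lebesgue_measure) (@consR n))). Qed.

HB.instance Definition _ := isMeasure.Build _ _ _ lebesgueS
  lebesgueS0 lebesgueS_ge0 lebesgueS_sigma_additive.

End lebesgueS.

Fixpoint lebesgueRn n :
    {measure set (n.-tuple (measurableTypeR R)) -> \bar R} :=
  match n with
  | 0 => \d_([tuple] : 0.-tuple (measurableTypeR R))
  | n'.+1 => lebesgueS (lebesgueRn n')
  end.

End LebesgueRn.

Section Averages.
Context {R : realType} {d : nat}.

(* [mxvec] stacks rows, so stacking the columns of [X] is [mxvec X^T]. *)
Definition vec (X : 'M[R]_d) : 'cV[R]_(d * d) := (mxvec X^T)^T.
Definition unvec (v : 'cV[R]_(d * d)) : 'M[R]_d := (vec_mx v^T)^T.

(* d + 2 d^2, in a form suited to block decomposition *)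
Definition dimD (n : nat) : nat := (n + (n * n + n * n))%N.

Definition q0_of (q : 'cV[R]_(dimD d)) : 'cV[R]_d := usubmx q.
Definition X1_of (q : 'cV[R]_(dimD d)) : 'M[R]_d := unvec (usubmx (dsubmx q)).
Definition X2_of (q : 'cV[R]_(dimD d)) : 'M[R]_d := unvec (dsubmx (dsubmx q)).

Definition col_of_tuple n (z : n.-tuple (measurableTypeR R)) : 'cV[R]_n :=
  \col_i tnth z i.

Definition avg (f : 'cV[R]_d -> R) (q : 'cV[R]_(dimD d)) : R :=
  (2 * pi) ^- d *
  \int[lebesgueRn (d + d)]_z
    (let zeta1 := usubmx (col_of_tuple z) in
     let zeta2 := dsubmx (col_of_tuple z) in
     f (q0_of q + X1_of q *m zeta1 + X2_of q *m zeta2) *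
     expR (- (2^-1 * (sqnorm zeta1 + sqnorm zeta2)))).

Definition avg_mx m n (F : 'cV[R]_d -> 'M[R]_(m, n)) (q : 'cV[R]_(dimD d)) :
    'M[R]_(m, n) :=
  \matrix_(i, j) avg (fun x => F x i j) q.

Definition Abf (A : 'cV[R]_d -> 'cV[R]_d) (q : 'cV[R]_(dimD d)) :
    'cV[R]_(dimD d) :=
  col_mx (avg_mx A q)
    (col_mx (vec (avg_mx (Jac A) q *m X1_of q))
            (vec (avg_mx (Jac A) q *m X2_of q))).

Definition Vbf (A : 'cV[R]_d -> 'cV[R]_d) (V : 'cV[R]_d -> R)
    (q : 'cV[R]_(dimD d)) : R :=
  2^-1 * avg (fun x => sqnorm (A x)) q + avg V q.

End Averages.

(* Phase space coordinates are [col_mx q p]. *)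

Section Hamiltonian.
Context {R : realType} {m : nat}.

Definition Omega : 'M[R]_(m + m) := block_mx 0 1%:M (- 1%:M) 0.

Definition ham_field (h : 'cV[R]_(m + m) -> R) (z : 'cV[R]_(m + m)) :
    'cV[R]_(m + m) :=
  Omega *m grad h z.

Definition symplectic_at (Phi : 'cV[R]_(m + m) -> 'cV[R]_(m + m))
    (z : 'cV[R]_(m + m)) : Prop :=
  differentiable Phi z /\ (Jac Phi z)^T *m Omega *m Jac Phi z = Omega.

End Hamiltonian.

Section Hamiltonians.
Context {R : realType} {d : nat}.
Variables (A : 'cV[R]_d -> 'cV[R]_d) (V : 'cV[R]_d -> R).
Local Notation D := (dimD d).

Definition h_kin (z : 'cV[R]_(D + D)) : R := 2^-1 * sqnorm (dsubmx z).
Definition h_pot (z : 'cV[R]_(D + D)) : R := Vbf A V (usubmx z).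
Definition h_mag (z : 'cV[R]_(D + D)) : R :=
  - dot (Abf A (usubmx z)) (dsubmx z).
Definition h_tot (z : 'cV[R]_(D + D)) : R := h_kin z + h_pot z + h_mag z.

End Hamiltonians.

Section RungeKutta.
Context {R : realType} {s : nat}.
Variables (L : 'M[R]_s) (b : 'cV[R]_s).

Definition explicit_tableau : Prop :=
  forall i j : 'I_s, (i <= j)%N -> L i j = 0.

Definition rk_node n (tau : R) (y : 'cV[R]_n) (k : 'I_s -> 'cV[R]_n)
    (i : 'I_s) : 'cV[R]_n :=
  y + tau *: \sum_(j < s | (j < i)%N) L i j *: k j.

Definition rk_stages n (f : 'cV[R]_n -> 'cV[R]_n) (tau : R) (y : 'cV[R]_n)
    (k : 'I_s -> 'cV[R]_n) : Prop :=
  forall i, k i = f (rk_node tau y k i).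

Definition rk_update n (tau : R) (y : 'cV[R]_n) (k : 'I_s -> 'cV[R]_n) :
    'cV[R]_n :=
  y + tau *: \sum_i b i 0 *: k i.

(* Local error O(tau^(nu+1)) for every smooth autonomous problem in every
   dimension, locally uniformly in the initial value. *)
Definition rk_order (nu : nat) : Prop :=
  forall n (f : 'cV[R]_n -> 'cV[R]_n), smooth_vec f ->
  forall K : set 'cV[R]_n, compact K ->
  exists C tau1 : R, 0 < tau1 /\
  forall tau u k, 0 < tau <= tau1 ->
    is_solution f `[0, tau] u -> K (u 0) -> rk_stages f tau (u 0) k ->
    `|rk_update tau (u 0) k - u tau| <= C * tau ^+ nu.+1.

Definition Lhat : 'M[R]_s :=
  (const_mx 1 : 'cV[R]_s) *m b^T
  - invmx (diag_mx b^T) *m L^T *m diag_mx b^T.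

Definition momentum_stages n (M : 'I_s -> 'M[R]_n) (tau : R) (p : 'cV[R]_n)
    (l : 'I_s -> 'cV[R]_n) : Prop :=
  forall i, l i = M i *m (p + tau *: \sum_j Lhat i j *: l j).

End RungeKutta.

Variant part := Kin | Pot | Mag.

Definition is_mag (P : part) : bool := if P is Mag then true else false.

Section Splitting.
Context {R : realType} {d s : nat}.
Variables (A : 'cV[R]_d -> 'cV[R]_d) (V : 'cV[R]_d -> R).
Variables (L : 'M[R]_s) (b : 'cV[R]_s).
Local Notation D := (dimD d).
Local Notation phase := 'cV[R]_(D + D).

(* [:: (P1, c1); (P2, c2); ...]: first the sub-flow of [P1] with step [c1 tau],
   then that of [P2] with step [c2 tau], and so on. *)
Definition scheme : Type := seq (part * R).

Definition mag_coefs (sch : scheme) : seq R :=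
  [seq c.2 | c <- sch & is_mag c.1].

Definition h_part (P : part) : phase -> R :=
  match P with Kin => h_kin | Pot => h_pot A V | Mag => h_mag A end.

Definition exact_splitting (sch : scheme) (tau : R) (z : phase) : phase :=
  foldl (fun w c => flow (ham_field (h_part c.1)) (c.2 * tau) w) z sch.

Definition splitting_order (nu : nat) (sch : scheme) : Prop :=
  forall K : set phase, compact K ->
  exists C tau1 : R, 0 < tau1 /\
  forall tau z, 0 < tau <= tau1 -> K z ->
    `|exact_splitting sch tau z - flow (ham_field (h_tot A V)) tau z|
      <= C * tau ^+ nu.+1.

Definition mag_field (q : 'cV[R]_D) : 'cV[R]_D := - Abf A q.

Definition mag_matrix (tau : R) (q : 'cV[R]_D) (k : 'I_s -> 'cV[R]_D)
    (i : 'I_s) : 'M[R]_D :=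
  (Jac (Abf A) (rk_node L tau q k i))^T.

Definition mag_step (tau : R) (z z' : phase) : Prop :=
  exists k l,
    [/\ rk_stages L mag_field tau (usubmx z) k,
        momentum_stages L b (mag_matrix tau (usubmx z) k) tau (dsubmx z) l &
        z' = col_mx (rk_update b tau (usubmx z) k)
                    (rk_update b tau (dsubmx z) l)].

Definition mag_well_defined (tau : R) (z : phase) : Prop :=
  (exists! k, rk_stages L mag_field tau (usubmx z) k) /\
  forall k, rk_stages L mag_field tau (usubmx z) k ->
    exists! l,
      momentum_stages L b (mag_matrix tau (usubmx z) k) tau (dsubmx z) l.

Definition substep (P : part) (tau : R) (z z' : phase) : Prop :=
  match P with
  | Mag => mag_step tau z z'
  | _ => z' = flow (ham_field (h_part P)) tau z
  end.

Fixpoint step (sch : scheme) (tau : R) (z z' : phase) : Prop :=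
  match sch with
  | [::] => z' = z
  | c :: sch' => exists w, substep c.1 (c.2 * tau) z w /\ step sch' tau w z'
  end.

Fixpoint well_defined (sch : scheme) (tau : R) (z : phase) : Prop :=
  match sch with
  | [::] => True
  | c :: sch' =>
      (is_mag c.1 -> mag_well_defined (c.2 * tau) z) /\
      forall w, substep c.1 (c.2 * tau) z w -> well_defined sch' tau w
  end.

(* The one-step map; the default value is irrelevant where [well_defined]
   holds. *)
Definition integrator (sch : scheme) (tau : R) (z : phase) : phase :=
  xget z [set z' | step sch tau z z'].

(* Pairs of a step size from [T] and a point of a numerical trajectory with
   this step size that stays in [K]. *)
Definition visited (sch : scheme) (T : set R) (K : set phase) :
    set (R * phase) :=
  [set tz | T tz.1 /\ exists (N : nat) (y : nat -> phase),
    [/\ forall n, (n < N)%N -> step sch tz.1 (y n) (y n.+1),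
        forall n, (n <= N)%N -> K (y n) &
        exists2 n, (n <= N)%N & y n = tz.2]].

(* Vectors and matrices computed from the step size and the current point
   without solving nonlinear equations: only evaluations of the averaged
   potentials and their derivatives and D x D linear algebra, where every
   matrix that is inverted must be invertible for all inputs in [S]. *)
Inductive explicit_vec (S : set (R * phase)) :
    (R -> phase -> 'cV[R]_D) -> Prop :=
  | ev_q : explicit_vec S (fun _ z => usubmx z)
  | ev_p : explicit_vec S (fun _ z => dsubmx z)
  | ev_add f g : explicit_vec S f -> explicit_vec S g ->
      explicit_vec S (fun tau z => f tau z + g tau z)
  | ev_scale (c : R) f : explicit_vec S f ->
      explicit_vec S (fun tau z => c *: f tau z)
  | ev_tau f : explicit_vec S f ->
      explicit_vec S (fun tau z => tau *: f tau z)
  | ev_mul F f : explicit_mat S F -> explicit_vec S f ->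
      explicit_vec S (fun tau z => F tau z *m f tau z)
  | ev_A f : explicit_vec S f ->
      explicit_vec S (fun tau z => Abf A (f tau z))
  | ev_gradV f : explicit_vec S f ->
      explicit_vec S (fun tau z => grad (Vbf A V) (f tau z))
with explicit_mat (S : set (R * phase)) :
    (R -> phase -> 'M[R]_D) -> Prop :=
  | em_one : explicit_mat S (fun _ _ => 1%:M)
  | em_add F G : explicit_mat S F -> explicit_mat S G ->
      explicit_mat S (fun tau z => F tau z + G tau z)
  | em_scale (c : R) F : explicit_mat S F ->
      explicit_mat S (fun tau z => c *: F tau z)
  | em_tau F : explicit_mat S F ->
      explicit_mat S (fun tau z => tau *: F tau z)
  | em_mul F G : explicit_mat S F -> explicit_mat S G ->
      explicit_mat S (fun tau z => F tau z *m G tau z)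
  | em_tr F : explicit_mat S F ->
      explicit_mat S (fun tau z => (F tau z)^T)
  | em_inv F : explicit_mat S F ->
      (forall tau z, S (tau, z) -> F tau z \in unitmx) ->
      explicit_mat S (fun tau z => invmx (F tau z))
  | em_JA f : explicit_vec S f ->
      explicit_mat S (fun tau z => Jac (Abf A) (f tau z)).

Definition explicit_on (S : set (R * phase)) (Phi : R -> phase -> phase) :
    Prop :=
  exists f g, [/\ explicit_vec S f, explicit_vec S g &
    forall tau z, S (tau, z) -> Phi tau z = col_mx (f tau z) (g tau z)].

Definition order_on (S : set (R * phase)) (nu : nat)
    (Phi : R -> phase -> phase) : Prop :=
  exists C : R, forall tau z, S (tau, z) ->
    `|Phi tau z - flow (ham_field (h_tot A V)) tau z| <= C * tau ^+ nu.+1.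

End Splitting.

(* Main.v *)
Require Import Defs.
From HB Require Import structures.
From mathcomp Require Import all_boot all_order all_algebra.
From mathcomp Require Import all_classical all_reals all_analysis.
From mathcomp Require Import measurable_realfun ring lra.

Set Implicit Arguments.
Unset Strict Implicit.
Unset Printing Implicit Defensive.

Import Order.TTheory GRing.Theory Num.Theory.
Import numFieldNormedType.Exports.

Local Open Scope classical_set_scope.
Local Open Scope ring_scope.

(** The step size is restricted by a single quantity, a global bound on the
   Jacobian matrix of the averaged vector potential. The components built from
   [<J_A> X_1] and [<J_A> X_2] contain unbounded factors, but Gaussian
   integration by parts ([gexp_stein]) turns them into averages of [A] against
   coordinates of the Gaussian variable ([avg_Jac_mul]). Every component is
   then an average of a component of [A] times a polynomial, and
   differentiation under the integral sign ([is_derive_pavg]) leaves bounded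
   derivatives of [A]. In the same way the averaged scalar potential inherits a
   bounded Hessian from [V + |A|^2/2]. Hence all Hamiltonian fields grow at most
   linearly, which bounds their solutions ([solutions_bounded]), and the
   derivative [D] of the Runge-Kutta position map [psi] is uniformly close to
   the identity for steps below some [tau0] that depends on [L], [b] and
   the bound on the Jacobian ([rk_jac_near_id]).

   The algebraic core is the tableau [Lhat]. Expressed by the new momentum [P]
   instead of the old momentum [p], the momentum stages form a strictly upper
   triangular system ([momentum_stagesP]), and a summation by parts gives
   [D^T P = p] ([back_stages_adjoint]). The partitioned step is therefore
   [(q, p) |-> (psi q, D^-T p)] ([mag_stepE]). Where [D] is invertible, this
   shows that the momentum stages exist and are unique and that the step needs
   linear algebra only; the step is symplectic because it is the cotangent lift
   of [psi] ([symplectic_cotangent_lift]). The other two sub-steps are shears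
   with symmetric derivatives.

   For the order, extend the position equation by its first variation [w]. A
   Runge-Kutta method applied to the extended system computes [psi] together
   with [D w], so that [D] approximates the derivative of the exact position
   flow with the same order as [psi] approximates the flow. The exact momentum
   is transported by the inverse transpose of that derivative, that is, its
   pairing with [w] is conserved ([mag_solution]); comparing with [D^T P = p]
   bounds the error of the momentum ([mag_local_error]). The errors of the
   sub-steps accumulate through the locally Lipschitz exact flows
   ([run_error]), and steps bounded away from zero only affect the constant
   ([order_run]). *)

(** * Norms, partial derivatives and differentiability *)

Section MatrixNorm.
Context {R : realType}.

Lemma mxnorm_entry m n (M : 'M[R]_(m, n)) i j : `|M i j| <= `|M|.
Proof.
rewrite [leRHS]/Num.Def.normr/= mx_normrE.
exact: (le_bigmax _ (fun ij : 'I_m * 'I_n => `|M ij.1 ij.2|) (i, j)).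
Qed.

Lemma mxnorm_le m n (M : 'M[R]_(m, n)) c : 0 <= c ->
  (forall i j, `|M i j| <= c) -> `|M| <= c.
Proof.
move=> c0 Mc; rewrite [leLHS]/Num.Def.normr/= mx_normrE.
by apply: bigmax_le => // ij _; exact: Mc.
Qed.

Lemma cvnorm_le n (x : 'cV[R]_n) c : 0 <= c ->
  (forall i, `|x i 0| <= c) -> `|x| <= c.
Proof. by move=> c0 xc; apply: mxnorm_le => // i j; rewrite ord1. Qed.

Lemma mxnormM m n p (M : 'M[R]_(m, n)) (N : 'M[R]_(n, p)) :
  `|M *m N| <= n%:R * (`|M| * `|N|).
Proof.
apply: mxnorm_le => [|i j]; first by rewrite !mulr_ge0.
rewrite mxE (le_trans (ler_norm_sum _ _ _))// -[X in X%:R](card_ord n).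
rewrite mulr_natl -sumr_const; apply: ler_sum => k _.
by rewrite normrM ler_pM// mxnorm_entry.
Qed.

Lemma mxnorm_tr m n (M : 'M[R]_(m, n)) : `|M^T| = `|M|.
Proof.
apply/eqP; rewrite eq_le; apply/andP; split; apply: mxnorm_le => // i j.
  by rewrite mxE mxnorm_entry.
by have := mxnorm_entry M^T j i; rewrite mxE.
Qed.

Lemma mxnorm1 n : `|1%:M : 'M[R]_n| <= 1.
Proof.
apply: mxnorm_le => // i j; rewrite mxE.
by case: (i == j); rewrite ?normr1 ?normr0.
Qed.

Lemma cv_split n (x : 'cV[R]_n) : x = \sum_k x k 0 *: delta_mx k 0.
Proof.
rewrite {1}[x]matrix_sum_delta; apply: eq_bigr => i _.
by rewrite big_ord1.
Qed.

Lemma continuous_cv (T : topologicalType) n (f : T -> 'cV[R]_n) :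
  (forall i, continuous (fun t => f t i 0)) -> continuous f.
Proof.
move=> cf t; apply/cvgrPdist_le => e e0.
near=> s.
apply: cvnorm_le => [|i]; first exact: ltW.
rewrite !mxE; move: i; near: s; apply: filter_forall => i.
by have /cvgrPdist_le := cf i t; apply.
Unshelve. all: by end_near. Qed.

Lemma continuous_coord (T : topologicalType) n (f : T -> 'cV[R]_n) i :
  continuous f -> continuous (fun t => f t i 0).
Proof.
move=> cf t; apply: (@continuous_comp _ _ _ f (fun M : 'cV[R]_n => M i 0)).
  exact: cf.
exact: coord_continuous.
Qed.

Lemma delta_norm n (k : 'I_n) : `|delta_mx k 0 : 'cV[R]_n| <= 1.
Proof.
apply: cvnorm_le => // l; rewrite mxE.
by case: (_ && _); rewrite ?normr1 ?normr0.
Qed.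

Lemma usubmx_lshift m p (j : 'I_m) :
  usubmx (delta_mx (lshift p j) 0 : 'cV[R]_(m + p)) = delta_mx j 0.
Proof. by apply/matrixP => k l; rewrite !mxE (inj_eq (@lshift_inj _ _)). Qed.

Lemma usubmx_rshift m p (j : 'I_p) :
  usubmx (delta_mx (rshift m j) 0 : 'cV[R]_(m + p)) = 0.
Proof. by apply/matrixP => k l; rewrite !mxE eq_lrshift. Qed.

Lemma dsubmx_lshift m p (j : 'I_m) :
  dsubmx (delta_mx (lshift p j) 0 : 'cV[R]_(m + p)) = 0.
Proof. by apply/matrixP => k l; rewrite !mxE eq_rlshift. Qed.

Lemma dsubmx_rshift m p (j : 'I_p) :
  dsubmx (delta_mx (rshift m j) 0 : 'cV[R]_(m + p)) = delta_mx j 0.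
Proof. by apply/matrixP => k l; rewrite !mxE (inj_eq (@rshift_inj _ _)). Qed.

Lemma usubmx_norm m p (z : 'cV[R]_(m + p)) : `|usubmx z| <= `|z|.
Proof. by apply: cvnorm_le => // i; rewrite mxE; exact: mxnorm_entry. Qed.

Lemma dsubmx_norm m p (z : 'cV[R]_(m + p)) : `|dsubmx z| <= `|z|.
Proof. by apply: cvnorm_le => // i; rewrite mxE; exact: mxnorm_entry. Qed.

Lemma col_mx_norm m p (x : 'cV[R]_m) (y : 'cV[R]_p) :
  `|col_mx x y| <= Num.max `|x| `|y|.
Proof.
apply: cvnorm_le => [|i]; first by rewrite le_max normr_ge0.
by case: (split_ordP i) => k ->; rewrite ?col_mxEu ?col_mxEd le_max mxnorm_entry ?orbT.
Qed.

End MatrixNorm.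

Section PartialDerivatives.
Context {R : realType}.

Lemma normed_continuous (V W : normedModType R) (f : V -> W) :
  (forall x e, 0 < e -> exists2 r, 0 < r &
     forall y, `|y - x| <= r -> `|f y - f x| <= e) -> continuous f.
Proof.
move=> H x; apply/cvgrPdist_le => e e0.
have [r r0 rP] := H x e e0; apply/nbhs_normP; exists r => // y.
by rewrite /ball_/= distrC => /ltW /rP; rewrite distrC.
Qed.

Lemma continuous_normed (V W : normedModType R) (f : V -> W) x e :
  {for x, continuous f} -> 0 < e -> exists2 r, 0 < r &
     forall y, `|y - x| <= r -> `|f y - f x| <= e.
Proof.
move=> /cvgrPdist_le cf /cf /nbhs_normP[r /= r0 rP].
exists (r / 2) => [|y yx]; first by rewrite divr_gt0.
rewrite distrC; apply: rP; rewrite /ball_/= distrC (le_lt_trans yx)//.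
by rewrite ltr_pdivrMr// ltr_pMr// ltr1n.
Qed.

Lemma fin_lower_bound (I : finType) (r : I -> R) :
  (forall i, 0 < r i) -> exists2 m, 0 < m & forall i, m <= r i.
Proof.
move=> r0; exists (\big[Num.min/1]_i r i) => [|i]; last exact: bigmin_le.
exact: lt_bigmin.
Qed.

Lemma fin_upper_bound (I : finType) (r : I -> R) :
  exists2 M, 0 <= M & forall i, r i <= M.
Proof.
exists (\big[Num.max/0]_i r i) => [|i]; last exact: le_bigmax.
exact: bigmax_ge_id.
Qed.

Definition partially_derivable n (f : 'cV[R]_n -> R) : Prop :=
  forall j x, derivable f x (delta_mx j 0).

Lemma is_derive_lineP (V W : normedModType R) (f : V -> W) (x v : V) (t : R) d :
  is_derive (x + t *: v) v f d <-> is_derive t 1 (fun t => f (x + t *: v)) d.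
Proof.
have E : (fun h => h^-1 *: (f (x + (h *: 1 + t) *: v) - f (x + t *: v))) =
         (fun h => h^-1 *: (f (h *: v + (x + t *: v)) - f (x + t *: v))).
  apply/funext => h; congr (_ *: (f _ - _)).
  by rewrite [h *: 1]mulr1 scalerDl addrCA.
by split=> -[df dfE]; split; move: df dfE; rewrite /derivable /derive /= E.
Qed.

Lemma is_derive_line (V W : normedModType R) (f : V -> W) (x v : V) (t : R) d :
  is_derive (x + t *: v) v f d -> is_derive t 1 (fun t => f (x + t *: v)) d.
Proof. by move/is_derive_lineP. Qed.

Lemma is_derive_partial n (f : 'cV[R]_n -> R) j x :
  derivable f x (delta_mx j 0) -> is_derive x (delta_mx j 0) f (partial j f x).
Proof. by move=> df; split. Qed.

Lemma is_derive1_continuous (W : normedModType R) (f : R -> W) (t : R) d :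
  is_derive t 1 f d -> {for t, continuous f}.
Proof.
by move=> [df _]; apply: differentiable_continuous; apply/derivable1_diffP.
Qed.

Lemma MVT_fraction (f df : R -> R) (s : R) :
  (forall t : R, is_derive t 1 f (df t)) ->
  exists2 th, 0 <= th <= 1 & f s - f 0 = s * df (th * s).
Proof.
move=> fdf.
have cf : continuous f by move=> t; exact: is_derive1_continuous (fdf t).
have [s0|s0|<-] := ltgtP 0 s.
- have [c cs E] := MVT s0 (fun x _ => fdf x) (continuous_subspaceT cf).
  move: cs; rewrite in_itv/= => /andP[c0 cs].
  exists (c / s); last by rewrite divfK ?gt_eqF// E subr0 mulrC.
  by rewrite ler_pdivrMr// mul1r (ltW cs) divr_ge0// ltW.
- have [c cs E] := MVT s0 (fun x _ => fdf x) (continuous_subspaceT cf).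
  move: cs; rewrite in_itv/= => /andP[c0 cs].
  exists (c / s); last first.
    by rewrite divfK ?lt_eqF// -opprB E sub0r mulrN opprK mulrC.
  by rewrite ler_ndivrMr// mul1r (ltW c0) mulr_le0// ?ltW// invr_lt0.
- by exists 0; rewrite ?lexx ?ler01// subrr mul0r.
Qed.

(** Moving from [x] to [y] one coordinate at a time turns the increment into
   one-dimensional increments; every intermediate point stays in the box
   spanned by [x] and [y]. *)
Lemma MVT_partials n (f : 'cV[R]_n -> R) (x y : 'cV[R]_n) :
  partially_derivable f ->
  exists xi : 'I_n -> 'cV[R]_n,
    (forall k i, exists2 th, 0 <= th <= 1 &
        xi k i 0 = x i 0 + th * (y i 0 - x i 0)) /\
    f y - f x = \sum_k (y k 0 - x k 0) * partial k f (xi k).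
Proof.
move=> df.
pose hyb m : 'cV[R]_n := \col_i (if (i < m)%N then y i 0 else x i 0).
have hybS (k : 'I_n) : hyb k.+1 = hyb k + (y k 0 - x k 0) *: delta_mx k 0.
  apply/matrixP => i j; rewrite !ord1 !mxE eqxx andbT ltnS leq_eqVlt.
  have [->|ik] := eqVneq i k; first by rewrite eqxx ltnn/= mulr1 subrKC.
  rewrite -[(_ : nat) == _]/(i == k) (negbTE ik)/= mulr0 addr0.
  by [].
have step (k : 'I_n) : {th | 0 <= th <= 1 &
    f (hyb k.+1) - f (hyb k) = (y k 0 - x k 0) *
      partial k f (hyb k + (th * (y k 0 - x k 0)) *: delta_mx k 0)}.
  pose g t := f (hyb k + t *: delta_mx k 0).
  have dg (t : R) : is_derive t 1 g (partial k f (hyb k + t *: delta_mx k 0)).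
    by apply: is_derive_line; exact: is_derive_partial.
  apply: cid2; have [th th01 E] := MVT_fraction (y k 0 - x k 0) dg.
  by exists th => //; rewrite -E /g hybS scale0r addr0.
exists (fun k : 'I_n => hyb k + (s2val (step k) * (y k 0 - x k 0)) *: delta_mx k 0).
split=> [k i|].
  have := s2valP (step k); set th := s2val _ => th01.
  rewrite !mxE eqxx andbT; have [->|ik] := eqVneq i k.
    by exists th => //; rewrite ltnn/= mulr1.
  rewrite mulr0 addr0; case: ifP => _.
    by exists 1; rewrite ?lexx ?ler01// mul1r subrKC.
  by exists 0; rewrite ?lexx ?ler01// mul0r addr0.
under eq_bigr do rewrite -(s2valP' (step _)).
have <- : hyb n = y by apply/matrixP => i j; rewrite ord1 mxE ltn_ord.
have <- : hyb 0 = x by apply/matrixP => i j; rewrite ord1 mxE.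
by rewrite -(big_mkord predT (fun k => f (hyb k.+1) - f (hyb k))) telescope_sumr.
Qed.

Lemma lipschitz_box n (f : 'cV[R]_n -> R) (rho M : R) (x y : 'cV[R]_n) :
  partially_derivable f ->
  (forall k z, `|z| <= rho -> `|partial k f z| <= M) ->
  `|x| <= rho -> `|y| <= rho -> `|f y - f x| <= n%:R * M * `|y - x|.
Proof.
move=> df fM xr yr; have [xi [xiE ->]] := MVT_partials x y df.
have r0 : 0 <= rho by rewrite (le_trans _ xr).
rewrite (le_trans (ler_norm_sum _ _ _))//.
rewrite -[X in X%:R](card_ord n) -mulrA mulr_natl -sumr_const.
apply: ler_sum => k _; rewrite normrM mulrC ler_pM//.
  apply/fM/cvnorm_le => // i; have [th /andP[th0 th1] ->] := xiE k i.
  have xi_r := le_trans (mxnorm_entry x i 0) xr.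
  have yi_r := le_trans (mxnorm_entry y i 0) yr.
  move: xi_r yi_r; rewrite !ler_norml; nra.
by have := mxnorm_entry (y - x) k 0; rewrite !mxE.
Qed.

Lemma partially_derivable_continuous n (f : 'cV[R]_n -> R) :
  partially_derivable f ->
  (forall rho : R, exists M : R, forall k z, `|z| <= rho -> `|partial k f z| <= M) ->
  continuous f.
Proof.
move=> df fM; apply: (@normed_continuous 'cV[R]_n) => x e e0.
have [M HM] := fM (`|x| + 1).
pose M' := n%:R * Num.max M 0 + 1.
have M0 : 0 < M' by rewrite ltr_wpDl// mulr_ge0// le_max lexx orbT.
have HM' k z : `|z| <= `|x| + 1 -> `|partial k f z| <= Num.max M 0.
  by move=> /(HM k) h; rewrite le_max h.
exists (Num.min 1 (e / M')); first by rewrite lt_min ltr01 divr_gt0.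
move=> y; rewrite le_min => /andP[yx yM].
have yr : `|y| <= `|x| + 1.
  have := ler_normD (y - x) x; rewrite subrK => /le_trans; apply.
  by rewrite addrC lerD2l.
have xr : `|x| <= `|x| + 1 by rewrite lerDl.
rewrite (le_trans (lipschitz_box df HM' xr yr))//.
rewrite (@le_trans _ _ (M' * `|y - x|))//; first by rewrite ler_wpM2r// /M' lerDl.
by rewrite mulrC -ler_pdivlMr.
Qed.

Definition C1 n (f : 'cV[R]_n -> R) : Prop :=
  partially_derivable f /\ forall j, continuous (partial j f).

Section linear_form.
Context n (a : 'I_n -> R).
Definition lform (h : 'cV[R]_n) : R := \sum_k h k 0 * a k.
Lemma lform_is_linear : linear lform.
Proof.
move=> c u v; rewrite /lform -[RHS]/(c * _ + _) mulr_sumr -big_split /=.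
by apply: eq_bigr => k _; rewrite !mxE mulrDl mulrA.
Qed.
HB.instance Definition _ := GRing.isLinear.Build _ _ _ _ lform lform_is_linear.
Lemma lform_continuous : continuous lform.
Proof.
apply/linear_bounded_continuous/linear_boundedP; exists (\sum_k `|a k|); split; first exact: num_real.
move=> r lr x; rewrite (le_trans (ler_norm_sum _ _ _))//.
apply: le_trans (_ : (\sum_k `|a k|) * `|x| <= _); last first.
  by rewrite ler_wpM2r// ltW.
rewrite mulr_suml; apply: ler_sum => k _.
by rewrite normrM mulrC ler_wpM2l// mxnorm_entry.
Qed.
End linear_form.

Lemma differentiable_littleo (V W : normedModType R) (f : V -> W) x
    (df : {linear V -> W}) :
  continuous df ->
  (forall e, 0 < e ->
     exists2 r, 0 < r &
     forall h, `|h| <= r -> `|f (h + x) - f x - df h| <= e * `|h|) ->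
  differentiable f x.
Proof.
move=> cdf H.
have E : f \o shift x = cst (f x) + df +o_ 0 id.
  apply/eqaddoP => e e0; have [r r0 rP] := H e e0.
  apply/nbhs_normP; exists r => // h; rewrite /ball_/= sub0r normrN => /ltW hr.
  rewrite [X in `|X|](_ : _ = f (h + x) - f x - df h); first exact: rP.
  by rewrite /= !fctE opprD addrA.
have dE := diff_unique cdf E.
by apply/diff_locallyP; rewrite dE.
Qed.

(** The increment given by [MVT_partials] uses partial derivatives at points of
   the box spanned by [x] and [x + h], where they are close to those at [x]. *)
Lemma C1_differentiable n (f : 'cV[R]_n -> R) x : C1 f -> differentiable f x.
Proof.
move=> [df cf].
apply: (@differentiable_littleo _ _ _ _ (lform (fun k => partial k f x))).
  exact: lform_continuous.
move=> e e0; pose e' := e / n.+1%:R.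
have e'0 : 0 < e' by rewrite divr_gt0.
have near_pf k : exists2 r, 0 < r & forall z, `|z - x| <= r ->
    `|partial k f z - partial k f x| <= e'.
  by apply: (@continuous_normed 'cV[R]_n R) => //; exact: cf.
have rk k : {r | 0 < r & forall z, `|z - x| <= r ->
    `|partial k f z - partial k f x| <= e'} by exact: cid2.
have [r r0 rle] := fin_lower_bound (fun k => s2valP (rk k)).
exists r => // h hr.
have [xi [xiE ->]] := MVT_partials x (h + x) df.
rewrite /= /lform -sumrB (le_trans (ler_norm_sum _ _ _))//.
apply: (@le_trans _ _ (\sum_(k < n) e' * `|h|)).
  apply: ler_sum => k _; rewrite mxE addrK -mulrBr normrM mulrC ler_pM//.
    apply: (s2valP' (rk k)); apply: le_trans (rle k); apply: le_trans hr.
    apply: cvnorm_le => // i; have [th /andP[th0 th1]] := xiE k i.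
    rewrite !mxE addrK => ->; rewrite addrAC subrr add0r normrM.
    rewrite (le_trans _ (mxnorm_entry h i 0))// ler_piMl// ger0_norm//.
  exact: mxnorm_entry.
rewrite sumr_const card_ord -[X in X <= _]mulr_natl mulrA ler_wpM2r// /e'.
by rewrite mulrCA ler_piMr// ?ltW// ltr_pdivrMr// mul1r ltr_nat.
Qed.

Lemma diff_partials n (f : 'cV[R]_n -> R) x v : differentiable f x ->
  'd f x v = \sum_k v k 0 * partial k f x.
Proof.
move=> df; rewrite {1}[v]cv_split linear_sum; apply: eq_bigr => k _.
by rewrite linearZ /= /partial deriveE.
Qed.

Lemma is_derive_cv (V : normedModType R) n (g : V -> 'cV[R]_n) x v
    (d : 'cV[R]_n) :
  (forall i, is_derive x v (fun y => g y i 0) (d i 0)) -> is_derive x v g d.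
Proof.
move=> gd; have dg : derivable g x v.
  by apply/derivable_mxP => i j; rewrite ord1; case: (gd i).
split=> //; rewrite derive_mx//; apply/matrixP => i j; rewrite ord1 mxE.
by have [_ ->] := gd i.
Qed.

Lemma is_derive_coord (V : normedModType R) n (g : V -> 'cV[R]_n) x v d i :
  is_derive x v g d -> is_derive x v (fun y => g y i 0) (d i 0).
Proof.
move=> [dg <-]; split; first by move/derivable_mxP : dg.
by rewrite derive_mx// mxE.
Qed.

Lemma is_derive_diff_comp (V W X : normedModType R) (g : V -> W) (f : W -> X)
    x v d :
  is_derive x v g d -> differentiable f (g x) ->
  is_derive x v (f \o g) ('d f (g x) d).
Proof.
move=> [dg <-] df.
have g0 : g x = (fun h : R => g (h *: v + x)) 0 by rewrite scale0r add0r.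
have dg1 : differentiable (fun h : R => g (h *: v + x)) 0.
  by move/derivable1P/derivable1_diffP : dg.
have dfg1 : differentiable (f \o (fun h : R => g (h *: v + x))) 0.
  by apply: differentiable_comp => //; rewrite -g0.
have line (Y : normedModType R) (k : V -> Y) :
    'D_v k x = 'D_1 (fun h : R => k (h *: v + x)) 0.
  rewrite /derive; set g1 := fun h => h^-1 *: _; set g2 := fun h => h^-1 *: _.
  suff -> : g1 = g2 by [].
  rewrite funeqE /g1 /g2 => h /=.
  by rewrite addr0 scale0r add0r [_ *: 1]mulr1.
split; first by apply/derivable1P; apply/derivable1_diffP.
rewrite (line _ (f \o g)) (line _ g) deriveE// [RHS]/= deriveE//.
by rewrite (diff_comp dg1) -?g0.
Qed.

Lemma is_derive_C1_comp (V : normedModType R) n (g : V -> 'cV[R]_n)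
    (f : 'cV[R]_n -> R) x v d :
  is_derive x v g d -> C1 f ->
  is_derive x v (fun y => f (g y)) (\sum_k d k 0 * partial k f (g x)).
Proof.
move=> dg /(@C1_differentiable _ _ (g x)) df; rewrite -diff_partials//.
exact: (is_derive_diff_comp dg df).
Qed.

End PartialDerivatives.

(** * Smooth functions *)

Section Smoothness.
Context {R : realType}.

Lemma continuous_add (T : topologicalType) (f g : T -> R) :
  continuous f -> continuous g -> continuous (fun x => f x + g x).
Proof. by move=> cf cg x; apply: cvgD; [exact: cf|exact: cg]. Qed.

Lemma continuous_mul (T : topologicalType) (f g : T -> R) :
  continuous f -> continuous g -> continuous (fun x => f x * g x).
Proof. by move=> cf cg x; apply: cvgM; [exact: cf|exact: cg]. Qed.

Lemma continuous_inv (T : topologicalType) (f : T -> R) :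
  continuous f -> (forall x, f x != 0) -> continuous (fun x => (f x)^-1).
Proof. by move=> cf f0 x; apply: cvgV => //; exact: cf. Qed.

Lemma continuous_sum (T : topologicalType) (I : Type) (s : seq I) (F : I -> T -> R) :
  (forall i, continuous (F i)) -> continuous (fun x => \sum_(i <- s) F i x).
Proof.
move=> cF; elim: s => [|i s IH].
  by under eq_fun do rewrite big_nil; exact: cst_continuous.
by under eq_fun do rewrite big_cons; exact: continuous_add.
Qed.

Lemma smooth_continuous n (f : 'cV[R]_n -> R) : smooth f -> continuous f.
Proof. by move=> /(_ [::])[]. Qed.

Lemma smooth_partially_derivable n (f : 'cV[R]_n -> R) :
  smooth f -> partially_derivable f.
Proof. by move=> /(_ [::])[_]. Qed.

Lemma smooth_partial n j (f : 'cV[R]_n -> R) : smooth f -> smooth (partial j f).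
Proof. by move=> sf r; have := sf (rcons r j); rewrite /partials foldr_rcons. Qed.

Lemma smooth_C1 n (f : 'cV[R]_n -> R) : smooth f -> C1 f.
Proof.
move=> sf; split; first exact: smooth_partially_derivable.
by move=> j; apply: smooth_continuous; exact: smooth_partial.
Qed.

Lemma is_derive_smooth n (f : 'cV[R]_n -> R) j x : smooth f ->
  is_derive x (delta_mx j 0) f (partial j f x).
Proof. by move=> sf; apply: is_derive_partial; exact: smooth_partially_derivable. Qed.

(** Smoothness is the largest property of continuous, partially differentiable
   functions that is stable under partial derivatives. *)
Lemma smooth_coind n (P : ('cV[R]_n -> R) -> Prop) :
  (forall f, P f -> continuous f /\
     forall j, exists df, P df /\ forall x, is_derive x (delta_mx j 0) f (df x)) ->
  forall f, P f -> smooth f.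
Proof.
move=> HP f Pf r.
have : P (partials r f).
  elim: r => //= j {}r /HP[_ /(_ j)[df [Pdf dfE]]].
  suff -> : partial j (partials r f) = df by [].
  by apply/funext => x; have [_] := dfE x.
move=> /HP[cf df]; split=> // j x.
by have [df' [_ /(_ x)[]]] := df j.
Qed.

(** The derivative of an expression built by these rules is again one, so that
   such expressions are smooth by coinduction. *)
Inductive smooth_expr n : ('cV[R]_n -> R) -> Prop :=
  | SmoothBase f : smooth f -> smooth_expr f
  | SmoothCst c : smooth_expr (fun=> c)
  | SmoothCoord i : smooth_expr (fun x => x i 0)
  | SmoothAdd f g : smooth_expr f -> smooth_expr g ->
      smooth_expr (fun x => f x + g x)
  | SmoothMul f g : smooth_expr f -> smooth_expr g ->
      smooth_expr (fun x => f x * g x)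
  | SmoothInv f : smooth_expr f -> (forall x, f x != 0) ->
      smooth_expr (fun x => (f x)^-1)
  | SmoothComp m (f : 'cV[R]_m -> R) (g : 'cV[R]_n -> 'cV[R]_m) :
      smooth f -> (forall i, smooth_expr (fun x => g x i 0)) ->
      smooth_expr (fun x => f (g x)).

Lemma smooth_expr_sum n (I : Type) (s : seq I) (F : I -> 'cV[R]_n -> R) :
  (forall i, smooth_expr (F i)) -> smooth_expr (fun x => \sum_(i <- s) F i x).
Proof.
move=> sF; elim: s => [|i s IH].
  by under eq_fun do rewrite big_nil; exact: SmoothCst.
by under eq_fun do rewrite big_cons; exact: SmoothAdd.
Qed.

Lemma smooth_expr_derive n (f : 'cV[R]_n -> R) : smooth_expr f ->
  continuous f /\
  forall j, exists df, smooth_expr df /\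
    forall x, is_derive x (delta_mx j 0) f (df x).
Proof.
elim=> {f} [f sf|c|i|f g sf [cf IHf] sg [cg IHg]|f g sf [cf IHf] sg [cg IHg]|
    f sf [cf IHf] f0|m f g sf sg IHg].
- split=> [|j]; first exact: smooth_continuous.
  exists (partial j f); split; first exact/SmoothBase/smooth_partial.
  by move=> x; apply: is_derive_partial; exact: smooth_partially_derivable.
- split=> [|j]; first exact: cst_continuous.
  by exists (fun=> 0); split=> [|x]; [exact: SmoothCst|exact: is_derive_cst].
- split=> [|j]; first exact: coord_continuous.
  exists (fun=> (i == j)%:R); split=> [|x]; first exact: SmoothCst.
  have -> : (i == j)%:R = (delta_mx j 0 : 'cV[R]_n) i 0 :> R.
    by rewrite mxE eqxx andbT.
  by apply: is_derive_coord; exact: is_derive_id.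
- split=> [|j]; first exact: (@continuous_add 'cV[R]_n).
  have [df [sdf dfE]] := IHf j; have [dg [sdg dgE]] := IHg j.
  exists (fun x => df x + dg x); split=> [|x]; first exact: SmoothAdd.
  exact: is_deriveD.
- split=> [|j]; first exact: (@continuous_mul 'cV[R]_n).
  have [df [sdf dfE]] := IHf j; have [dg [sdg dgE]] := IHg j.
  exists (fun x => f x * dg x + g x * df x); split=> [|x].
    by apply: SmoothAdd; exact: SmoothMul.
  exact: is_deriveM.
- split=> [|j]; first exact: (@continuous_inv 'cV[R]_n).
  have [df [sdf dfE]] := IHf j.
  exists (fun x => (-1) * ((f x)^-1 * (f x)^-1 * df x)); split=> [|x].
    apply: SmoothMul; first exact: SmoothCst.
    by apply: SmoothMul => //; apply: SmoothMul; exact: SmoothInv.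
  have [dfx <-] := dfE x; split; first exact: derivableV.
  by rewrite deriveV// -expr2 exprVn mulN1r scaleNr.
- split=> [|j].
    have cg : continuous g by apply: continuous_cv => i; case: (IHg i).
    by move=> x; apply: continuous_comp; [exact: cg|exact: smooth_continuous].
  have dg i : {dg | smooth_expr dg &
      forall x, is_derive x (delta_mx j 0) (fun x => g x i 0) (dg x)}.
    by apply: cid2; have [_ /(_ j)[dg [? ?]]] := IHg i; exists dg.
  exists (fun x => \sum_k s2val (dg k) x * partial k f (g x)); split=> [|x].
    apply: smooth_expr_sum => k; apply: SmoothMul; first exact: s2valP (dg k).
    by apply: SmoothComp => //; exact: smooth_partial.
  have gd : is_derive x (delta_mx j 0) g (\col_k s2val (dg k) x).
    by apply: is_derive_cv => k; rewrite mxE; exact: (s2valP' (dg k) x).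
  have := is_derive_C1_comp gd (smooth_C1 sf).
  by under eq_bigr do rewrite mxE.
Qed.

Lemma smooth_of_expr n (f : 'cV[R]_n -> R) : smooth_expr f -> smooth f.
Proof. exact: (smooth_coind (@smooth_expr_derive n)). Qed.

Lemma smooth_cst n c : smooth (fun _ : 'cV[R]_n => c).
Proof. exact/smooth_of_expr/SmoothCst. Qed.

Lemma smooth_coord n (i : 'I_n) : smooth (fun x : 'cV[R]_n => x i 0).
Proof. exact/smooth_of_expr/SmoothCoord. Qed.

Lemma smoothD n (f g : 'cV[R]_n -> R) :
  smooth f -> smooth g -> smooth (fun x => f x + g x).
Proof. by move=> *; apply/smooth_of_expr/SmoothAdd; exact: SmoothBase. Qed.

Lemma smoothM n (f g : 'cV[R]_n -> R) :
  smooth f -> smooth g -> smooth (fun x => f x * g x).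
Proof. by move=> *; apply/smooth_of_expr/SmoothMul; exact: SmoothBase. Qed.

Lemma smoothV n (f : 'cV[R]_n -> R) :
  smooth f -> (forall x, f x != 0) -> smooth (fun x => (f x)^-1).
Proof. by move=> *; apply/smooth_of_expr/SmoothInv => //; exact: SmoothBase. Qed.

Lemma smoothN n (f : 'cV[R]_n -> R) : smooth f -> smooth (fun x => - f x).
Proof.
move=> sf; under eq_fun do rewrite -mulN1r.
by apply: smoothM => //; exact: smooth_cst.
Qed.

Lemma smooth_sum n (I : Type) (s : seq I) (P : pred I) (F : I -> 'cV[R]_n -> R) :
  (forall i, smooth (F i)) -> smooth (fun x => \sum_(i <- s | P i) F i x).
Proof.
move=> sF; under eq_fun do rewrite big_mkcond/=.
apply/smooth_of_expr/smooth_expr_sum => i.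
by case: (P i); [exact: SmoothBase|exact: SmoothCst].
Qed.

Lemma smooth_prod n (I : Type) (s : seq I) (F : I -> 'cV[R]_n -> R) :
  (forall i, smooth (F i)) -> smooth (fun x => \prod_(i <- s) F i x).
Proof.
move=> sF; elim: s => [|i s IH].
  by under eq_fun do rewrite big_nil; exact: smooth_cst.
by under eq_fun do rewrite big_cons; exact: smoothM.
Qed.

Lemma smooth_comp n m (f : 'cV[R]_m -> R) (g : 'cV[R]_n -> 'cV[R]_m) :
  smooth f -> smooth_vec g -> smooth (fun x => f (g x)).
Proof.
by move=> sf sg; apply/smooth_of_expr/SmoothComp => // i; exact: SmoothBase.
Qed.

Lemma smooth_vec_comp n m p (f : 'cV[R]_m -> 'cV[R]_p)
    (g : 'cV[R]_n -> 'cV[R]_m) :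
  smooth_vec f -> smooth_vec g -> smooth_vec (fun x => f (g x)).
Proof. by move=> sf sg i; exact: (smooth_comp (sf i) sg). Qed.

Lemma smooth_vec_id n : smooth_vec (fun x : 'cV[R]_n => x).
Proof. by move=> i; exact: smooth_coord. Qed.

Lemma smooth_vecD n m (f g : 'cV[R]_n -> 'cV[R]_m) :
  smooth_vec f -> smooth_vec g -> smooth_vec (fun x => f x + g x).
Proof.
by move=> sf sg i; under eq_fun do rewrite mxE; exact: smoothD (sf i) (sg i).
Qed.

Lemma smooth_vecZ n m (c : R) (f : 'cV[R]_n -> 'cV[R]_m) :
  smooth_vec f -> smooth_vec (fun x => c *: f x).
Proof.
move=> sf i; under eq_fun do rewrite mxE.
exact: smoothM (smooth_cst _) (sf i).
Qed.

Lemma smooth_vecN n m (f : 'cV[R]_n -> 'cV[R]_m) :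
  smooth_vec f -> smooth_vec (fun x => - f x).
Proof.
by move=> sf i; under eq_fun do rewrite mxE; exact: smoothN (sf i).
Qed.

Lemma smooth_vec_sum n m (I : Type) (s : seq I) (P : pred I)
    (F : I -> 'cV[R]_n -> 'cV[R]_m) :
  (forall i, smooth_vec (F i)) ->
  smooth_vec (fun x => \sum_(i <- s | P i) F i x).
Proof.
move=> sF k; under eq_fun do rewrite summxE.
by apply: smooth_sum => i; exact: sF.
Qed.

Lemma smooth_usubmx n m p (f : 'cV[R]_n -> 'cV[R]_(m + p)) :
  smooth_vec f -> smooth_vec (fun x => usubmx (f x)).
Proof. by move=> sf i; under eq_fun do rewrite mxE; exact: sf. Qed.

Lemma smooth_dsubmx n m p (f : 'cV[R]_n -> 'cV[R]_(m + p)) :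
  smooth_vec f -> smooth_vec (fun x => dsubmx (f x)).
Proof. by move=> sf i; under eq_fun do rewrite mxE; exact: sf. Qed.

Lemma smooth_col_mx n m p (f : 'cV[R]_n -> 'cV[R]_m)
    (g : 'cV[R]_n -> 'cV[R]_p) :
  smooth_vec f -> smooth_vec g -> smooth_vec (fun x => col_mx (f x) (g x)).
Proof.
move=> sf sg i; under eq_fun do rewrite mxE.
by case: (fintype.split i) => k; [exact: sf|exact: sg].
Qed.

Definition smooth_mx n m p (F : 'cV[R]_n -> 'M[R]_(m, p)) : Prop :=
  forall i j, smooth (fun x => F x i j).

Lemma smooth_mulmx n m p q (F : 'cV[R]_n -> 'M[R]_(m, p))
    (G : 'cV[R]_n -> 'M[R]_(p, q)) :
  smooth_mx F -> smooth_mx G -> smooth_mx (fun x => F x *m G x).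
Proof.
move=> sF sG i j; under eq_fun do rewrite mxE.
by apply: smooth_sum => k; exact: smoothM (sF i k) (sG k j).
Qed.

Lemma smooth_trmx n m p (F : 'cV[R]_n -> 'M[R]_(m, p)) :
  smooth_mx F -> smooth_mx (fun x => (F x)^T).
Proof. by move=> sF i j; under eq_fun do rewrite mxE; exact: sF. Qed.

Lemma smooth_mx_vec n m (f : 'cV[R]_n -> 'cV[R]_m) :
  smooth_mx f -> smooth_vec f.
Proof. by move=> sf i; exact: sf. Qed.

Lemma smooth_vec_mx n m (f : 'cV[R]_n -> 'cV[R]_m) :
  smooth_vec f -> smooth_mx f.
Proof. by move=> sf i j; rewrite ord1; exact: sf. Qed.

Lemma smooth_Jac n m (f : 'cV[R]_n -> 'cV[R]_m) :
  smooth_vec f -> smooth_mx (Jac f).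
Proof.
move=> sf i j; under eq_fun do rewrite mxE.
by apply: smooth_partial; exact: sf.
Qed.

Lemma smooth_mx_comp n m p q (F : 'cV[R]_m -> 'M[R]_(p, q))
    (g : 'cV[R]_n -> 'cV[R]_m) :
  smooth_mx F -> smooth_vec g -> smooth_mx (fun x => F (g x)).
Proof. by move=> sF sg i j; exact: (smooth_comp (sF i j) sg). Qed.

Lemma smooth_det n m (F : 'cV[R]_n -> 'M[R]_m) :
  smooth_mx F -> smooth (fun x => \det (F x)).
Proof.
move=> sF; apply: smooth_sum => s; apply: smoothM; first exact: smooth_cst.
by apply: smooth_prod => i; exact: sF.
Qed.

Lemma smooth_invmx n m (F : 'cV[R]_n -> 'M[R]_m) :
  smooth_mx F -> (forall x, F x \in unitmx) -> smooth_mx (fun x => invmx (F x)).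
Proof.
move=> sF uF i j; rewrite /invmx; under eq_fun do rewrite uF mxE.
apply: smoothM.
  by apply: smoothV => [|x]; [exact: smooth_det|have := uF x; rewrite unitmxE unitfE].
under eq_fun do rewrite mxE.
apply: smoothM; first exact: smooth_cst.
by apply: smooth_det => k l; under eq_fun do rewrite !mxE; exact: sF.
Qed.

(** The Heine-Borel theorem for row vectors, carried over by transposition,
   which is an isometry. *)
Lemma compact_cv_ball n (rho : R) : compact [set x : 'cV[R]_n | `|x| <= rho].
Proof.
have tr_cts : continuous (fun v : 'rV[R]_n => v^T).
  apply: (@normed_continuous R 'rV[R]_n 'cV[R]_n) => v e e0; exists e => // w wv.
  by rewrite -linearB/= mxnorm_tr.
rewrite (_ : [set x | _] = (fun v : 'rV[R]_n => v^T) @` [set v | `|v| <= rho]); last first.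
  apply/seteqP; split=> x /= xr.
    by exists x^T; rewrite ?trmxK//= mxnorm_tr.
  by have [v vr <-] := xr; rewrite mxnorm_tr.
apply: continuous_compact; first exact: continuous_subspaceT.
apply: bounded_closed_compact.
  by exists rho; split; [exact: num_real|move=> r rr v /= /le_trans; apply; exact: ltW].
apply: (@closed_comp _ _ (fun v : 'rV[R]_n => `|v|) [set r | r <= rho]).
  by move=> v _; exact: norm_continuous.
exact: closed_le.
Qed.

Lemma smooth_bounded n (f : 'cV[R]_n -> R) (rho : R) : smooth f ->
  exists M, forall x, `|x| <= rho -> `|f x| <= M.
Proof.
move=> /smooth_continuous cf.
have := compact_bounded (continuous_compact (continuous_subspaceT cf) (@compact_cv_ball n rho)).
move=> [M [_ HM]]; exists (M + 1) => x xr.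
by apply: (HM (M + 1)); [rewrite ltrDl|exists x].
Qed.

Lemma smooth_lipschitz n (f : 'cV[R]_n -> R) (rho : R) : smooth f ->
  exists2 C, 0 <= C & forall x y, `|x| <= rho -> `|y| <= rho ->
    `|f y - f x| <= C * `|y - x|.
Proof.
move=> sf.
have /all_sig[M MP] : forall k : 'I_n, {M | forall x, `|x| <= rho -> `|partial k f x| <= M}.
  by move=> k; apply: cid; apply: smooth_bounded; exact: smooth_partial.
have [M' M'0 MM'] := fin_upper_bound M.
exists (n%:R * M') => [|x y xr yr]; first exact: mulr_ge0.
apply: lipschitz_box xr yr; first exact: smooth_partially_derivable.
by move=> k z /(MP k) /le_trans; apply.
Qed.

Lemma smooth_vec_bounded n m (f : 'cV[R]_n -> 'cV[R]_m) (rho : R) :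
  smooth_vec f ->
  exists2 M, 0 <= M & forall x, `|x| <= rho -> `|f x| <= M.
Proof.
move=> sf.
have /all_sig[M MP] : forall k : 'I_m, {M | forall x, `|x| <= rho -> `|f x k 0| <= M}.
  by move=> k; apply: cid; exact: smooth_bounded (sf k).
have [M' M'0 MM'] := fin_upper_bound M; exists M' => // x xr.
by apply: cvnorm_le => // i; exact: le_trans (MP i x xr) (MM' i).
Qed.

Lemma smooth_vec_lipschitz n m (f : 'cV[R]_n -> 'cV[R]_m) (rho : R) :
  smooth_vec f ->
  exists2 C, 0 <= C & forall x y, `|x| <= rho -> `|y| <= rho ->
    `|f y - f x| <= C * `|y - x|.
Proof.
move=> sf.
have /all_sig[M MP] : forall k : 'I_m, {M | forall x y, `|x| <= rho ->
    `|y| <= rho -> `|f y k 0 - f x k 0| <= M * `|y - x|}.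
  by move=> k; apply: cid; have [C _ HC] := smooth_lipschitz rho (sf k); exists C.
have [M' M'0 MM'] := fin_upper_bound M; exists M' => // x y xr yr.
apply: cvnorm_le => [|i]; first by rewrite mulr_ge0.
by rewrite !mxE (le_trans (MP i x y xr yr))// ler_wpM2r.
Qed.

Lemma smooth_vec_differentiable n m (f : 'cV[R]_n -> 'cV[R]_m) x :
  smooth_vec f -> differentiable f x.
Proof.
move=> sf.
apply: (@differentiable_littleo R 'cV[R]_n 'cV[R]_m f x (mulmx (Jac f x))).
  apply: (@continuous_cv R 'cV[R]_n) => i.
  have E : (fun h : 'cV[R]_n => (Jac f x *m h) i 0) = lform (fun k => partial k (fun y => f y i 0) x).
    apply/funext => h; rewrite mxE; apply: eq_bigr => k _.
    by rewrite mxE mulrC.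
  rewrite E; exact: lform_continuous.
move=> e e0.
have /all_sig2[r r0 rP] : forall i, {r | 0 < r & forall h : 'cV[R]_n, `|h| <= r ->
   `|f (h + x) i 0 - f x i 0 - \sum_k h k 0 * partial k (fun y => f y i 0) x| <= e * `|h|}.
  move=> i; apply: cid2.
  have df := C1_differentiable x (smooth_C1 (sf i)).
  have /diff_locally/eqaddoP/(_ _ e0)/nbhs_normP[r /= r0 rP] := df.
  exists (r / 2) => [|h hr]; first by rewrite divr_gt0.
  have := rP h; rewrite /ball_/= sub0r normrN.
  have hr' : `|h| < r.
    by rewrite (le_lt_trans hr)// ltr_pdivrMr// ltr_pMr// ltr1n.
  by move=> /(_ hr'); rewrite !fctE/= diff_partials// opprD addrA.
have [m0 m00 mr] := fin_lower_bound r0.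
exists m0 => // h hm; apply: cvnorm_le => [|i]; first by rewrite mulr_ge0// ltW.
rewrite !mxE (eq_bigr (fun k => h k 0 * partial k (fun y => f y i 0) x)).
  exact/rP/(le_trans hm).
by move=> k _; rewrite mxE mulrC.
Qed.

Lemma Jac_comp n m p (f : 'cV[R]_m -> 'cV[R]_p) (g : 'cV[R]_n -> 'cV[R]_m) x :
  smooth_vec f -> smooth_vec g ->
  Jac (fun y => f (g y)) x = Jac f (g x) *m Jac g x.
Proof.
move=> sf sg; apply/matrixP => i j; rewrite !mxE.
have dg : is_derive x (delta_mx j 0) g (\col_k partial j (fun y => g y k 0) x).
  apply: is_derive_cv => k; rewrite mxE; apply: is_derive_partial.
  exact: smooth_partially_derivable (sg k) _ _.
have [_ H] := is_derive_C1_comp dg (smooth_C1 (sf i)).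
rewrite /partial H; apply: eq_bigr => k _.
by rewrite !mxE mulrC.
Qed.

(** Equality of mixed partial derivatives: both are values, at points close
   to [x], of the same second difference quotient. *)
Lemma partial_comm n (f : 'cV[R]_n -> R) i j x : smooth f ->
  partial i (partial j f) x = partial j (partial i f) x.
Proof.
move=> sf.
have quotient i' j' (h : R) : exists2 z, `|z - x| <= 2 * `|h| &
    f (x + h *: delta_mx i' 0 + h *: delta_mx j' 0)
    - f (x + h *: delta_mx i' 0) - (f (x + h *: delta_mx j' 0) - f x)
    = h * (h * partial j' (partial i' f) z).
  pose g s := f (x + h *: delta_mx j' 0 + s *: delta_mx i' 0)
              - f (x + s *: delta_mx i' 0).
  have dg (s : R) : is_derive s 1 g
      (partial i' f (x + h *: delta_mx j' 0 + s *: delta_mx i' 0)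
       - partial i' f (x + s *: delta_mx i' 0)).
    by apply: is_deriveB; apply: is_derive_line; apply: is_derive_partial;
      exact: smooth_partially_derivable.
  have [th /andP[th0 th1] E] := MVT_fraction h dg.
  pose y := x + (th * h) *: delta_mx i' 0.
  have dk (t : R) : is_derive t 1 (fun t => partial i' f (y + t *: delta_mx j' 0))
      (partial j' (partial i' f) (y + t *: delta_mx j' 0)).
    apply: is_derive_line; apply: is_derive_partial.
    exact/smooth_partially_derivable/smooth_partial.
  have [th' /andP[th'0 th'1] E'] := MVT_fraction h dk.
  exists (y + (th' * h) *: delta_mx j' 0).
    rewrite /y addrAC [x + _]addrC addrK (le_trans (ler_normD _ _))//.
    rewrite !normrZ mulr2n mulrDl !mul1r lerD//.
      by rewrite -[leRHS]mulr1 ler_pM ?mulr_ge0 ?delta_norm// ler_piMl// ger0_norm.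
    by rewrite -[leRHS]mulr1 ler_pM ?mulr_ge0 ?delta_norm// ler_piMl// ger0_norm.
  move: E; rewrite /g scale0r !addr0 => E.
  rewrite [x + _ + _]addrAC E; congr (_ * _).
  by rewrite -E' scale0r addr0 /y addrAC.
apply/eqP; rewrite -subr_eq0 -normr_le0; apply/ler_addgt0Pr => e e0; rewrite add0r.
have e2 : 0 < e / 2 by rewrite divr_gt0.
have [r r0 rP] := @continuous_normed R 'cV[R]_n R _ x _
  (smooth_continuous (smooth_partial i (smooth_partial j sf)) (x := x)) e2.
have [r' r'0 r'P] := @continuous_normed R 'cV[R]_n R _ x _
  (smooth_continuous (smooth_partial j (smooth_partial i sf)) (x := x)) e2.
pose h := Num.min r r' / 2.
have h0 : 0 < h by rewrite divr_gt0// lt_min r0 r'0.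
have h2 : 2 * `|h| = Num.min r r' by rewrite gtr0_norm// mulrC divfK.
have [z zx E] := quotient i j h; have [z' z'x E'] := quotient j i h.
have EE : partial j (partial i f) z = partial i (partial j f) z'.
  apply: (mulfI (lt0r_neq0 h0)); apply: (mulfI (lt0r_neq0 h0)).
  have exch (a b c k : R) : a - b - (c - k) = a - c - (b - k) by ring.
  apply: etrans (esym E) _; apply: etrans _ E'.
  by rewrite (addrAC x) exch.
move: zx z'x; rewrite h2 !le_min => /andP[_ /r'P az] /andP[/rP bz _].
move: az bz EE {E E' rP r'P}.
move: (partial j (partial i f) z) (partial j (partial i f) x).
move: (partial i (partial j f) z') (partial i (partial j f) x).
move=> a b c k ck ab ca; move: ck ab; rewrite ca !ler_norml.
by move=> /andP[? ?] /andP[? ?]; lra.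
Qed.

End Smoothness.

(** * Ordinary differential equations *)

Section ScalarComparison.
Context {R : realType}.
Implicit Types f df phi : R -> R.

Lemma derive_ge0_le f df (t : R) : 0 <= t ->
  (forall s : R, is_derive s 1 f (df s)) ->
  (forall s, 0 <= s <= t -> 0 <= df s) -> f 0 <= f t.
Proof.
move=> t0 fdf df0; have [th /andP[th0 th1] E] := MVT_fraction t fdf.
by rewrite -subr_ge0 E mulr_ge0// df0// mulr_ge0//= ler_piMl.
Qed.

Lemma is_derive_expZ (a c : R) (s : R) :
  is_derive s 1 (fun s => c * expR (a * s)) (c * (a * expR (a * s))).
Proof.
have da : is_derive s 1 ( *%R a) a.
  have := @is_deriveZ _ _ _ (@id R) a s 1 1 (is_derive_id s 1).
  by rewrite [a *: 1]mulr1.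
have de : is_derive s 1 (fun s => expR (a * s)) (expR (a * s) * a).
  exact: (@is_derive1_comp _ expR ( *%R a) s).
have := @is_deriveZ _ _ _ (fun s => expR (a * s)) c s 1 _ de.
by rewrite [_ *: _](_ : _ = c * (a * expR (a * s)))// [X in c * X]mulrC.
Qed.

Lemma is_derive_opp_arg (W : normedModType R) (f : R -> W) (s : R) d :
  is_derive (- s) 1 f d -> is_derive s 1 (fun s => f (- s)) (- d).
Proof.
move=> fd; have [df dfE] := fd.
have dN : is_derive s 1 (-%R : R -> R) (-1) by exact: is_deriveN.
have := @is_derive_diff_comp R _ _ _ -%R f s 1 _ dN.
move=> /(_ (iffLR (derivable1_diffP _ _) df)).
by rewrite linearN/= -deriveE ?dfE//; exact/derivable1_diffP.
Qed.

(** [M / a * expR (a * t)] is a primitive of the bound on the derivative. *)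
Lemma expR_comparison f df (M a : R) : 0 < a -> f 0 = 0 ->
  (forall s : R, is_derive s 1 f (df s)) ->
  (forall s, `|df s| <= M * expR (a * `|s|)) ->
  forall t, `|f t| <= M / a * expR (a * `|t|).
Proof.
move=> a0.
suff half (g dg : R -> R) : g 0 = 0 -> (forall s : R, is_derive s 1 g (dg s)) ->
    (forall s, `|dg s| <= M * expR (a * `|s|)) ->
    forall t, 0 <= t -> g t <= M / a * expR (a * t).
  have two_sided (g dg : R -> R) : g 0 = 0 -> (forall s : R, is_derive s 1 g (dg s)) ->
      (forall s, `|dg s| <= M * expR (a * `|s|)) ->
      forall t, 0 <= t -> `|g t| <= M / a * expR (a * t).
    move=> g0 gd gM t t0; rewrite ler_norml lerNl (half _ _ g0 gd gM)// andbT.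
    apply: (half (fun s => - g s) (fun s => - dg s)) => // [|s].
    - by rewrite g0 oppr0.
    - by rewrite normrN.
  move=> f0 fd fM t; have [t0|t0] := leP 0 t.
    by rewrite (ger0_norm t0) (two_sided f df).
  rewrite (ltr0_norm t0) -[t in `|f t|]opprK.
  apply: (two_sided (fun s => f (- s)) (fun s => - df (- s))) => [|s|s|].
  - by rewrite oppr0.
  - exact: is_derive_opp_arg.
  - by rewrite normrN (le_trans (fM _))// normrN.
  - by rewrite oppr_ge0 ltW.
move=> g0 gd gM t t0.
have M0 : 0 <= M.
  by have := le_trans (normr_ge0 _) (gM 0); rewrite normr0 mulr0 expR0 mulr1.
pose h s := M / a * expR (a * s) - g s.
have hd (s : R) : is_derive s 1 h (M / a * (a * expR (a * s)) - dg s).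
  by apply: is_deriveB; exact: is_derive_expZ.
have := derive_ge0_le t0 hd; rewrite /h mulr0 expR0 mulr1 g0 subr0.
move=> H; rewrite -subr_ge0; apply: le_trans (H _); first by rewrite divr_ge0// ltW.
move=> s /andP[s0 _]; rewrite mulrA divfK ?gt_eqF// subr_ge0.
by have := gM s; rewrite (ger0_norm s0) ler_norml => /andP[_].
Qed.

(** The product of [phi] with [expR (- a * s)] is nonincreasing for positive [s];
   negative times are reduced to positive ones by reflection. *)
Lemma gronwall phi dphi (a : R) (t : R) :
  (forall s : R, is_derive s 1 phi (dphi s)) ->
  (forall s, `|s| <= `|t| -> `|dphi s| <= a * phi s) ->
  phi t <= phi 0 * expR (a * `|t|).
Proof.
suff half (p dp : R -> R) (u : R) : 0 <= u -> (forall s : R, is_derive s 1 p (dp s)) ->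
    (forall s, `|s| <= u -> `|dp s| <= a * p s) ->
    p u <= p 0 * expR (a * u).
  move=> pd pa; have [t0|t0] := leP 0 t.
    rewrite (ger0_norm t0); apply: half pd _ => // s.
    by rewrite -{1}(ger0_norm t0); exact: pa.
  rewrite (ltr0_norm t0).
  have := half (fun s => phi (- s)) (fun s => - dphi (- s)) (- t).
  rewrite opprK oppr0; apply => [|s|s su].
  - by rewrite oppr_ge0 ltW.
  - exact: is_derive_opp_arg.
  - by rewrite normrN pa// normrN (ltr0_norm t0).
move=> u0 pd pa.
pose h s := - (p s * expR (- a * s)).
have hd (s : R) : is_derive s 1 h (- (p s * (1 * (- a * expR (- a * s)))
    + expR (- a * s) * dp s)).
  apply: is_deriveN; apply: (@is_deriveM _ _ p) => //.
  by have := is_derive_expZ (- a) 1 s; under eq_fun do rewrite mul1r.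
have := derive_ge0_le u0 hd; rewrite /h mulr0 expR0 mulr1 lerN2 => H.
have e1 : expR (- a * u) * expR (a * u) = 1 by rewrite -expRD mulNr addNr expR0.
rewrite -[leLHS]mulr1 -e1 mulrA ler_wpM2r ?expR_ge0//.
apply: H => s /andP[s0 su]; rewrite oppr_ge0 mul1r.
rewrite [X in X + _](_ : _ = - (expR (- a * s) * (a * p s))); last by ring.
rewrite addrC subr_le0 ler_wpM2l ?expR_ge0//.
by apply: le_trans (pa s _); rewrite ?ler_norm ?ger0_norm.
Qed.

Lemma derive_eq_on f g df (M : R) : f 0 = g 0 ->
  (forall s : R, `|s| < M -> is_derive s 1 f (df s)) ->
  (forall s : R, `|s| < M -> is_derive s 1 g (df s)) ->
  forall t, `|t| < M -> f t = g t.
Proof.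
move=> fg fd gd t tM; apply/eqP; rewrite -subr_eq0; apply/eqP.
pose h s := f s - g s.
have hd (s : R) : `|s| < M -> is_derive s 1 h 0.
  move=> sM; rewrite -(subrr (df s)).
  by apply: is_deriveB; [exact: fd|exact: gd].
have ch (a b : R) : `|a| < M -> `|b| < M -> {within `[a, b], continuous h}.
  move=> aM bM; apply: continuous_in_subspaceT => s; rewrite inE/= in_itv/=.
  move=> /andP[sa sb]; apply: is_derive1_continuous (hd s _).
  by move: aM bM; rewrite !ltr_norml => /andP[? ?] /andP[? ?]; apply/andP; split; lra.
have h0 : h 0 = 0 by rewrite /h fg subrr.
have M0 : `|0 : R| < M by rewrite normr0 (le_lt_trans _ tM).
rewrite -/(h t) -h0.
have [t0|t0|<-//] := ltgtP 0 t.
- have [|c _] := @MVT R h (fun=> 0) 0 t t0 _ (ch _ _ M0 tM); last first.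
    by rewrite mul0r => /eqP; rewrite subr_eq0 => /eqP ->; rewrite h0.
  move=> s; rewrite in_itv/= => /andP[s0 st]; apply: hd.
  by rewrite gtr0_norm// (lt_trans st)// (le_lt_trans (ler_norm _)).
- have [|c _] := @MVT R h (fun=> 0) t 0 t0 _ (ch _ _ tM M0); last first.
    by rewrite mul0r => /eqP; rewrite subr_eq0 => /eqP <-.
  move=> s; rewrite in_itv/= => /andP[st s0]; apply: hd.
  by rewrite ltr0_norm// (lt_trans _ tM)// ltr0_norm ?(lt_trans st)// ltrN2.
Qed.

(** Integrals over intervals [[- M, t]] provide primitives on [|t| < M], and
   those normalized at [0] agree where they are both defined. *)
Lemma primitive f : continuous f ->
  exists G, G 0 = 0 /\ forall t : R, is_derive t 1 G (f t).
Proof.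
move=> cf.
pose F (M t : R) := (\int[lebesgue_measure]_(s in `[- M, t]) f s)
                  - \int[lebesgue_measure]_(s in `[- M, 0]) f s.
have F0 M : F M 0 = 0 by rewrite /F subrr.
have Fd (M t : R) : `|t| < M -> is_derive t 1 (F M) (f t).
  move=> tM; rewrite -[f t]subr0; apply: is_deriveB.
  have [tl tr] : - M < t /\ t < M by move: tM; rewrite ltr_norml => /andP[].
  have intf : lebesgue_measure.-integrable `[- M, M] (EFin \o f).
    apply: continuous_compact_integrable; first exact: segment_compact.
    exact: continuous_subspaceT.
  have [dF dFE] := continuous_FTC1_closed tr intf tl (cf t).
  apply: DeriveDef; first exact: dF.
  rewrite -derive1E; exact: dFE.
exists (fun t => F (`|t| + 1) t); split=> [|t]; first exact: F0.
have E (M s : R) : `|s| < M -> F (`|s| + 1) s = F M s.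
  move=> sM; pose m := Num.min (`|s| + 1) M.
  apply: (@derive_eq_on (F (`|s| + 1)) (F M) f m) => [|u|u|].
  - by rewrite !F0.
  - by rewrite lt_min => /andP[? _]; exact: Fd.
  - by rewrite lt_min => /andP[_ ?]; exact: Fd.
  - by rewrite lt_min ltrDl ltr01.
apply: (@near_eq_is_derive _ _ _ (F (`|t| + 2))); last first.
  by apply: Fd; rewrite ltrDl.
near=> s; apply/esym/E.
have st : `|s - t| < 1 by rewrite distrC; near: s; exact: nbhsx_ballx.
have := ler_normD (s - t) t; rewrite subrK => /le_lt_trans; apply.
by rewrite addrC ltrD2l (lt_trans st)// ltr1n.
Unshelve. all: by end_near. Qed.

Lemma geometric_limit (x : nat -> R) (M : R) :
  (forall k, `|x k.+1 - x k| <= M * 2^-1 ^+ k) ->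
  exists l, forall k, `|l - x k| <= 2 * M * 2^-1 ^+ k.
Proof.
move=> xM.
have q0 k : 0 < 2^-1 ^+ k :> R by rewrite exprn_gt0.
have dist k j : `|x (k + j)%N - x k| <= 2 * M * 2^-1 ^+ k * (1 - 2^-1 ^+ j).
  elim: j => [|j IH]; first by rewrite addn0 !subrr normr0 mulr0.
  rewrite addnS -(subrKA (x (k + j)%N)) (le_trans (ler_normD _ _))//.
  apply: (le_trans (lerD (xM _) IH)).
  by rewrite exprD exprS le_eqVlt; apply/orP; left; apply/eqP; field.
have M0 : 0 <= M by have := le_trans (normr_ge0 _) (xM 0); rewrite expr0 mulr1.
have dist' k j : `|x (k + j)%N - x k| <= 2 * M * 2^-1 ^+ k.
  apply: le_trans (dist k j) _; apply: ler_piMr.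
    by rewrite !mulr_ge0// ltW.
  by rewrite lerBlDr lerDl ltW.
pose E := [set x k - 2 * M * 2^-1 ^+ k | k in setT].
have ubE k : ubound E (x k + 2 * M * 2^-1 ^+ k).
  move=> _ [j _ <-]; have [kj|jk] := leqP k j.
    have := dist' k (j - k)%N; rewrite subnKC// ler_norml => /andP[_ H].
    have : 0 <= 2 * M * 2^-1 ^+ j by rewrite !mulr_ge0// ltW.
    lra.
  have := dist' j (k - j)%N; rewrite (subnKC (ltnW jk)) ler_norml => /andP[H _].
  have : 0 <= 2 * M * 2^-1 ^+ k by rewrite !mulr_ge0// ltW.
  lra.
have supE : has_sup E.
  by split; [exists (x 0%N - 2 * M * 2^-1 ^+ 0), 0%N|exists (x 0%N + 2 * M * 2^-1 ^+ 0)].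
exists (sup E) => k; rewrite ler_distl; apply/andP; split.
  by apply: ub_le_sup; [exact: supE.2|exists k].
by apply: ge_sup; [exact: supE.1|exact: ubE].
Qed.

End ScalarComparison.

Section PicardLindelof.
Context {R : realType} {n : nat}.
Variables (F : R -> 'cV[R]_n -> 'cV[R]_n) (C B : R) (y : 'cV[R]_n).
Hypothesis C_gt0 : 0 < C.
Hypothesis F_lipschitz : forall t x x', `|F t x - F t x'| <= C * `|x - x'|.
Hypothesis F_bounded : forall t, `|F t y| <= B.
Hypothesis F_continuous : forall u : R -> 'cV[R]_n,
  continuous u -> continuous (fun t => F t (u t)).

Lemma primitive_vec (f : R -> 'cV[R]_n) : continuous f ->
  exists G, G 0 = y /\ forall t : R, is_derive t 1 G (f t).
Proof.
move=> cf.
have /all_sig2[G G0 Gd] : forall i, {G : R -> R | G 0 = 0 &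
    forall t : R, is_derive t 1 G (f t i 0)}.
  move=> i; apply: cid2; have [|G [? ?]] := @primitive R (fun t => f t i 0).
    exact: continuous_coord.
  by exists G.
exists (fun t => y + \col_i G i t); split=> [|t].
  by apply/matrixP => i j; rewrite !mxE G0 addr0 ord1.
apply: is_derive_cv => i.
have -> : (fun t => (y + \col_j G j t) i 0) = (fun t => y i 0 + G i t).
  by apply/funext => s; rewrite !mxE.
by rewrite -[f t i 0]add0r; apply: is_deriveD => //; exact: Gd.
Qed.

Lemma picard_step (u : R -> 'cV[R]_n) : continuous u ->
  exists v, [/\ continuous v, v 0 = y &
    forall t : R, is_derive t 1 v (F t (u t))].
Proof.
move=> cu; have [G [G0 Gd]] := primitive_vec (F_continuous cu).
by exists G; split=> // t; exact: is_derive1_continuous (Gd t).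
Qed.

(** In the norm with weight [e^(-2C|t|)] a Picard step is a contraction of ratio
   [1/2] on the whole line: integrating a difference of fields bounded by
   [M e^(2C|t|)] gains a factor [1/(2C)]. *)
Lemma driven_distance (u v du dv : R -> 'cV[R]_n) M : 0 <= M -> u 0 = v 0 ->
  (forall t : R, is_derive t 1 u (du t)) ->
  (forall t : R, is_derive t 1 v (dv t)) ->
  (forall t, `|du t - dv t| <= M * expR (2 * C * `|t|)) ->
  forall t, `|u t - v t| <= M / (2 * C) * expR (2 * C * `|t|).
Proof.
move=> M0 uv ud vd duv t; apply: cvnorm_le => [|i].
  by rewrite mulr_ge0 ?expR_ge0// divr_ge0// mulr_ge0// ltW.
rewrite !mxE; apply: (@expR_comparison R (fun t => u t i 0 - v t i 0)
  (fun t => du t i 0 - dv t i 0)).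
- by rewrite mulr_gt0.
- by rewrite uv subrr.
- by move=> s; apply: is_deriveB; exact: is_derive_coord.
- move=> s; apply: le_trans (duv s).
  by have := mxnorm_entry (du s - dv s) i 0; rewrite !mxE.
Qed.

(** The Picard iterates converge geometrically at each time, locally uniformly,
   so that their limit is continuous; a further Picard step leaves the limit
   unchanged, hence it solves the equation. *)
Theorem picard_lindelof : exists u : R -> 'cV[R]_n,
  u 0 = y /\ forall t : R, is_derive t 1 u (F t (u t)).
Proof.
pose S : Type := {u : R -> 'cV[R]_n | continuous u}.
have step (u : S) : {v : S | sval v 0 = y /\
    forall t : R, is_derive t 1 (sval v) (F t (sval u t))}.
  by apply: cid; have [v [cv v0 vd]] := picard_step (svalP u); exists (exist _ v cv).
have c0 : continuous (fun _ : R => y) by exact: cst_continuous.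
pose it k := iter k (fun u => sval (step u)) (exist _ (fun=> y) c0 : S).
pose u k := sval (it k).
have uc k : continuous (u k) by exact: svalP (it k).
have uS k : u k.+1 0 = y /\ forall t : R, is_derive t 1 (u k.+1) (F t (u k t)).
  by rewrite /u /it iterS; exact: svalP (step _).
have u0 k : u k 0 = y by case: k => // k; have [] := uS k.
have B0 : 0 <= B by exact: le_trans (normr_ge0 _) (F_bounded 0).
have C2 : 0 < 2 * C by rewrite mulr_gt0.
have C_ge0 := ltW C_gt0.
pose M := B / (2 * C).
have M0 : 0 <= M by rewrite divr_ge0// ltW.
have q0 k : 0 <= 2^-1 ^+ k :> R by rewrite exprn_ge0.
have contraction k t :
    `|u k.+1 t - u k t| <= M * expR (2 * C * `|t|) * 2^-1 ^+ k.
  elim: k t => [|k IH] t.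
    rewrite expr0 mulr1; apply: (@driven_distance (u 1%N) (u 0%N) (fun t => F t y) (fun=> 0)).
    - by [].
    - by rewrite !u0.
    - exact: (uS 0%N).2.
    - move=> s; rewrite subr0 (le_trans (F_bounded s))// ler_peMr//.
      rewrite -[X in X <= _](@expR0 R) ler_expR.
      by rewrite mulr_ge0// ltW.
  have -> : M * expR (2 * C * `|t|) * 2^-1 ^+ k.+1 =
      C * M * 2^-1 ^+ k / (2 * C) * expR (2 * C * `|t|).
    by rewrite exprS; field; rewrite gt_eqF.
  apply: (@driven_distance _ _ (fun t => F t (u k.+1 t)) (fun t => F t (u k t))).
  - by apply: mulr_ge0 (q0 k); exact: mulr_ge0.
  - by rewrite !u0.
  - exact: (uS k.+1).2.
  - exact: (uS k).2.
  - move=> s; rewrite (le_trans (F_lipschitz _ _ _))//.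
    rewrite -2!mulrA -mulrA ler_wpM2l// (le_trans (IH s))//.
    by rewrite -[2 * C * `|s|]mulrA [leLHS]mulrAC.
have lim t : {l : 'cV[R]_n | forall k,
    `|l - u k t| <= 2 * (M * expR (2 * C * `|t|)) * 2^-1 ^+ k}.
  have /all_sig[l lP] : forall i, {l | forall k,
      `|l - u k t i 0| <= 2 * (M * expR (2 * C * `|t|)) * 2^-1 ^+ k}.
    move=> i; apply: cid; apply: geometric_limit => k.
    apply: le_trans (contraction k t).
    by have := mxnorm_entry (u k.+1 t - u k t) i 0; rewrite !mxE.
  exists (\col_i l i) => k; apply: cvnorm_le => [|i].
    apply: mulr_ge0 (q0 k); apply: mulr_ge0 => //.
    by apply: mulr_ge0 => //; exact: expR_ge0.
  by rewrite !mxE.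
pose v t := sval (lim t).
have vP t k : `|v t - u k t| <= 2 * M * 2^-1 ^+ k * expR (2 * C * `|t|).
  by rewrite (le_trans (svalP (lim t) k))// mulrA mulrAC.
have small (c : R) (e : R) : 0 < e -> exists k, c * 2^-1 ^+ k <= e.
  move=> e0; have [c0'|c0'] := leP c 0.
    by exists 0%N; rewrite expr0 mulr1 (le_trans c0')// ltW.
  have /cvgrPdist_le/(_ _ (divr_gt0 e0 c0'))[k _ kP] :=
    @cvg_expr R 2^-1 (ltac:(by rewrite ger0_norm// invf_lt1// ltr1n)).
  exists k; have := kP k (leqnn k); rewrite sub0r normrN ger0_norm//.
  by rewrite ler_pdivlMr// mulrC.
have vc : continuous v.
  move=> t; apply/cvgrPdist_le => e e0.
  have [k kP] := small (2 * M * expR (2 * C * (`|t| + 1))) _ (divr_gt0 e0 (ltr0n R 3)).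
  have vk s : `|s| <= `|t| + 1 -> `|v s - u k s| <= e / 3.
    move=> st; apply: le_trans kP; rewrite (le_trans (vP s k))// mulrAC.
    apply: ler_wpM2r => //; apply: ler_wpM2l; first exact: mulr_ge0.
    by rewrite ler_expR; apply: ler_wpM2l => //; exact: ltW.
  near=> s.
  have st : `|s| <= `|t| + 1.
    have := ler_normD (s - t) t; rewrite subrK => /le_trans; apply.
    rewrite addrC lerD2l distrC; near: s; apply: cvgr_dist_le => //; exact: cvg_id.
  have us : `|u k t - u k s| <= e / 3.
    by near: s; apply: cvgr_dist_le; [exact: uc|rewrite divr_gt0].
  have -> : v t - v s = (v t - u k t) + (u k t - u k s) - (v s - u k s).
    by rewrite opprB !subrKA.
  have -> : e = e / 3 + e / 3 + e / 3 by field.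
  rewrite (le_trans (ler_normB _ _))// lerD ?vk//.
  by rewrite (le_trans (ler_normD _ _))// lerD ?vk// lerDl.
have [w [wc w0 wd]] := picard_step vc.
have wu k t : `|w t - u k.+1 t| <= M * 2^-1 ^+ k * expR (2 * C * `|t|).
  have -> : M * 2^-1 ^+ k = C * (2 * M * 2^-1 ^+ k) / (2 * C).
    by field; rewrite gt_eqF.
  apply: (@driven_distance _ _ (fun t => F t (v t)) (fun t => F t (u k t))).
  - by apply: mulr_ge0 => //; apply: mulr_ge0 (q0 k); exact: mulr_ge0.
  - by rewrite w0 u0.
  - exact: (uS k).2.
  - move=> s; apply: le_trans (F_lipschitz _ _ _) _; rewrite -[leRHS]mulrA.
    by apply: ler_wpM2l => //; exact: vP.
suff vw : v = w by exists w; split=> // t; rewrite -{2}vw.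
apply/funext => t; apply/eqP; rewrite -subr_eq0 -normr_le0.
apply/ler_addgt0Pr => e e0; rewrite add0r.
have [k kP] := small (2 * M * expR (2 * C * `|t|)) e e0.
have -> : v t - w t = (v t - u k.+1 t) - (w t - u k.+1 t).
  by rewrite opprB subrKA.
rewrite (le_trans (ler_normB _ _))// (le_trans (lerD (vP t k.+1) (wu k t)))//.
by apply: le_trans kP; rewrite exprS le_eqVlt; apply/orP; left; apply/eqP; field.
Unshelve. all: by end_near. Qed.

End PicardLindelof.

Section GlobalSolutions.
Context {R : realType} {n : nat}.
Implicit Types (X : 'cV[R]_n -> 'cV[R]_n) (u v : R -> 'cV[R]_n).

Lemma normsq_le_sqnorm (x : 'cV[R]_n) : `|x| ^+ 2 <= sqnorm x.
Proof.
have x2 : 0 <= sqnorm x by apply: sumr_ge0 => i _; rewrite -expr2 sqr_ge0.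
rewrite -[leRHS]sqr_sqrtr// ler_sqr ?nnegrE ?sqrtr_ge0//.
apply: cvnorm_le => [|i]; first exact: sqrtr_ge0.
rewrite -sqrtr_sqr ler_wsqrtr// /sqnorm /dot (bigD1 i)//= -expr2 lerDl.
by apply: sumr_ge0 => j _; rewrite -expr2 sqr_ge0.
Qed.

Lemma dot_le (x y : 'cV[R]_n) : `|dot x y| <= n%:R * (`|x| * `|y|).
Proof.
rewrite (le_trans (ler_norm_sum _ _ _))// -[X in X%:R](card_ord n).
rewrite mulr_natl -sumr_const; apply: ler_sum => k _.
by rewrite normrM ler_pM// mxnorm_entry.
Qed.

Lemma dotE (x y : 'cV[R]_n) : dot x y = (x^T *m y) 0 0.
Proof. by rewrite mxE; apply: eq_bigr => i _; rewrite mxE. Qed.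

Lemma sqnorm_le (x : 'cV[R]_n) : sqnorm x <= n%:R * `|x| ^+ 2.
Proof. by rewrite expr2 (le_trans (ler_norm _))// dot_le. Qed.

Lemma is_derive_sqnorm (V : normedModType R) (u : V -> 'cV[R]_n) (t v : V) d :
  is_derive t v u d -> is_derive t v (fun t => sqnorm (u t)) (2 * dot (u t) d).
Proof.
move=> du; have di i : is_derive t v (fun t => u t i 0) (d i 0).
  exact: is_derive_coord.
have -> : (fun t => sqnorm (u t)) = \sum_i (fun t => u t i 0 * u t i 0).
  by apply/funext => s; rewrite fct_sumE.
rewrite /dot mulr_sumr; apply: is_derive_sum => i.
have := @is_deriveM _ _ (fun t => u t i 0) (fun t => u t i 0) t v _ _ (di i) (di i).
by rewrite [_ *: _](_ : _ = u t i 0 * d i 0)// mulr2n mulrDl mul1r.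
Qed.

Definition linear_growth m (X : 'cV[R]_n -> 'cV[R]_m) : Prop :=
  exists C, forall x, `|X x| <= C * (1 + `|x|).

(** Along a solution the derivative of [1 + |u|^2] is at most a multiple of
   itself. *)
Lemma solutions_bounded X (rho T : R) : linear_growth X ->
  exists B, forall u, is_solution X setT u -> `|u 0| <= rho ->
    forall t, `|t| <= T -> `|u t| <= B.
Proof.
move=> [C XC].
have C0 : 0 <= C.
  by have := le_trans (normr_ge0 _) (XC 0); rewrite normr0 addr0 mulr1.
pose a := 4 * n%:R * C.
have a0 : 0 <= a by rewrite !mulr_ge0.
exists (1 + (1 + n%:R * rho ^+ 2) * expR (a * T)) => u su u0 t tT.
have r0 : 0 <= rho by exact: le_trans u0.
have phid (s : R) : is_derive s 1 (fun s => 1 + sqnorm (u s))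
    (2 * dot (u s) (X (u s))).
  rewrite -[2 * _]add0r; apply: is_deriveD; apply: is_derive_sqnorm; exact: su.
have /(_ _)/= G := @gronwall R _ _ a t phid.
have ut : `|u t| ^+ 2 <= (1 + n%:R * rho ^+ 2) * expR (a * T).
  rewrite (le_trans (normsq_le_sqnorm _))// (@le_trans _ _ (1 + sqnorm (u t)))//.
    by rewrite lerDr.
  apply: le_trans (G _) _.
    move=> s _; rewrite normrM ger0_norm//.
    apply: (@le_trans _ _ (2 * (n%:R * (`|u s| * (C * (1 + `|u s|)))))).
      rewrite ler_wpM2l// (le_trans (dot_le _ _))// ler_wpM2l// ler_wpM2l//.
    have := normsq_le_sqnorm (u s); have := normr_ge0 (u s).
    move: `|u s| (sqnorm (u s)) => x p x0 xp.
    rewrite /a -!mulrA [X in _ <= X](_ : _ = 2 * (n%:R * (C * (2 * (1 + p))))); last by ring.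
    rewrite ler_wpM2l// ler_wpM2l// mulrCA ler_wpM2l//; nra.
  have u0' : sqnorm (u 0) <= n%:R * rho ^+ 2.
    by rewrite (le_trans (sqnorm_le _))// ler_wpM2l// lerXn2r ?nnegrE.
  rewrite ler_pM ?expR_ge0 ?lerD2l//.
    by rewrite addr_ge0// (le_trans _ (normsq_le_sqnorm _)) ?sqr_ge0.
  by rewrite ler_expR ler_wpM2l.
apply: le_trans (_ : 1 + `|u t| ^+ 2 <= _); last by rewrite lerD2l.
have := normr_ge0 (u t); nra.
Qed.

(** Up to time [T] both solutions stay in a ball where [X] is Lipschitz, and
   Gronwall's inequality applies to [|u - v|^2]. *)
Lemma solutions_lipschitz X (rho T : R) : smooth_vec X -> linear_growth X ->
  exists2 K, 0 <= K & forall u v, is_solution X setT u -> is_solution X setT v ->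
    `|u 0| <= rho -> `|v 0| <= rho ->
    forall t, `|t| <= T -> `|u t - v t| <= K * `|u 0 - v 0|.
Proof.
move=> sX gX; have [B BP] := solutions_bounded rho T gX.
have [C C0 CP] := smooth_vec_lipschitz B sX.
pose a := 2 * n%:R * C.
have a0 : 0 <= a by rewrite !mulr_ge0.
pose E := n%:R * expR (a * T).
have E0 : 0 <= E by rewrite mulr_ge0// expR_ge0.
exists (1 + E) => [|u v su sv u0 v0 t tT]; first by rewrite addr_ge0.
pose w s := u s - v s.
have wd (s : R) : is_derive s 1 w (X (u s) - X (v s)).
  by apply: is_deriveB; [exact: su|exact: sv].
have /(_ _)/= G := @gronwall R _ _ a t (fun s => is_derive_sqnorm (wd s)).
have wt : `|w t| ^+ 2 <= `|w 0| ^+ 2 * E.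
  rewrite (le_trans (normsq_le_sqnorm _))// (le_trans (G _))//.
    move=> s st; rewrite normrM ger0_norm// /a -!mulrA ler_wpM2l//.
    rewrite (le_trans (dot_le _ _))// ler_wpM2l//.
    apply: le_trans (_ : C * `|w s| ^+ 2 <= _); last first.
      by rewrite ler_wpM2l// normsq_le_sqnorm.
    rewrite expr2 [C * _]mulrCA ler_wpM2l//.
    apply: CP; apply: BP => //; exact: le_trans tT.
  rewrite /E mulrA [_ * n%:R]mulrC ler_pM ?expR_ge0 ?sqnorm_le//.
    by rewrite (le_trans _ (normsq_le_sqnorm _)) ?sqr_ge0.
  by rewrite ler_expR ler_wpM2l.
rewrite -ler_sqr ?nnegrE ?mulr_ge0 ?addr_ge0//.
by apply: le_trans wt _; rewrite exprMn mulrC ler_wpM2r ?sqr_ge0//; nra.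
Qed.

End GlobalSolutions.

(** * Lebesgue measure in several dimensions *)

Section LebesgueRnTheory.
Context {R : realType}.
Local Notation mR := (measurableTypeR R).
Local Notation leb := (@lebesgue_measure R).

(** A continuous function on [R^n] is the pointwise limit of its values on
   finer and finer grids, and each of these approximations takes countably
   many values on boxes. *)
Lemma measurable_col_of_tuple n (f : 'cV[R]_n -> R) : continuous f ->
  measurable_fun setT (fun z : n.-tuple mR => f (col_of_tuple z)).
Proof.
move=> cf.
pose fl (m : nat) (x : R) : int := Num.floor (m.+1%:R * x).
pose grid (m : nat) (k : {ffun 'I_n -> int}) : 'cV[R]_n :=
  \col_i ((k i)%:~R / m.+1%:R).
pose cell (m : nat) (z : n.-tuple mR) : {ffun 'I_n -> int} :=
  [ffun i => fl m (tnth z i)].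
have mcell m k : measurable [set z | cell m z = k].
  rewrite (_ : [set z | _] = \bigcap_(i in [set: 'I_n])
      ((fun z : n.-tuple mR => tnth z i) @^-1`
         `[(k i)%:~R / m.+1%:R, (k i + 1)%:~R / m.+1%:R[)); last first.
    apply/seteqP; split=> z /=.
      move=> <- i _ /=; rewrite ffunE in_itv/= ler_pdivrMr// ltr_pdivlMr//.
      by rewrite [_ * m.+1%:R]mulrC; exact: floor_itv.
    move=> H; apply/ffunP => i; rewrite ffunE; apply/eqP.
    have := H i I; rewrite /= in_itv/= ler_pdivrMr// ltr_pdivlMr//.
    by rewrite [_ * m.+1%:R]mulrC -floor_eq.
  apply: fin_bigcap_measurable => // i _; rewrite -[X in measurable X]setTI.
  exact: (measurable_tnth i measurableT (measurable_itv _)).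
apply: (@measurable_fun_cvg _ _ _ _ (fun m z => f (grid m (cell m z)))).
  move=> m _ Y mY; rewrite setTI.
  rewrite (_ : _ @^-1` _ = \bigcup_k
      (if f (grid m k) \in Y then [set z | cell m z = k] else set0)).
    apply: countable_bigcupT_measurable; first exact: countableP.
    by move=> k; case: ifP.
  apply/seteqP; split=> z /=.
    by move=> Yz; exists (cell m z) => //; rewrite mem_set.
  by move=> [k _]; case: ifPn => // /set_mem ? /= ->.
move=> z _; apply/cvgrPdist_le => e e0.
have [r r0 rP] := @continuous_normed R 'cV[R]_n R _ (col_of_tuple z) _
  (cf (col_of_tuple z)) e0.
near=> m.
rewrite distrC; apply: rP; apply: cvnorm_le => [|i]; first exact: ltW.
rewrite !mxE ffunE /fl; have := floor_itv (m.+1%:R * tnth z i : R).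
move: (Num.floor _) => k /andP[ka kb].
apply: (@le_trans _ _ m.+1%:R^-1); last first.
  rewrite -[leLHS]mul1r ler_pdivrMr// mulrC -ler_pdivrMr// mul1r.
  near: m; exists (Num.truncn r^-1) => // m /= rm.
  by rewrite ltW// (lt_le_trans (truncnS_gt _))// ler_nat ltnS.
rewrite ler_norml; apply/andP; split.
  rewrite lerBrDr ler_pdivlMr// mulrDl mulNr mulVf// mulrC.
  by move: kb; rewrite intrD; lra.
rewrite lerBlDr ler_pdivrMr// mulrDl mulVf// [tnth z i * _]mulrC.
by rewrite (le_trans ka)// lerDr.
Unshelve. all: by end_near. Qed.

Definition cons_cv n (x : R) (v : 'cV[R]_n) : 'cV[R]_n.+1 :=
  \col_i (if unlift ord0 i is Some j then v j 0 else x).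

Lemma cons_cv0 n x (v : 'cV[R]_n) : cons_cv x v ord0 0 = x.
Proof. by rewrite mxE unlift_none. Qed.

Lemma cons_cvS n x (v : 'cV[R]_n) j : cons_cv x v (lift ord0 j) 0 = v j 0.
Proof. by rewrite mxE liftK. Qed.

Lemma col_of_consR n (z : n.-tuple mR) (x : mR) :
  col_of_tuple (consR (z, x)) = cons_cv x (col_of_tuple z).
Proof.
apply/matrixP => i j; rewrite ord1 !mxE; case: unliftP => [k ->|->].
  by rewrite mxE tnthS.
by rewrite tnth0.
Qed.

Lemma cons_cv_continuous n x : continuous (@cons_cv n x).
Proof.
apply: (@continuous_cv R 'cV[R]_n) => i; rewrite /cons_cv.
under eq_fun do rewrite mxE.
by case: (unlift _ _) => [j|]; [exact: coord_continuous|exact: cst_continuous].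
Qed.

Lemma cons_cv_continuousl n (v : 'cV[R]_n) : continuous (fun x => cons_cv x v).
Proof.
apply: continuous_cv => i; rewrite /cons_cv; under eq_fun do rewrite mxE.
by case: (unlift _ _) => [j|]; [exact: cst_continuous|move=> x; exact: cvg_id].
Qed.

Lemma lebesgueRnS_box n (A : set (n.-tuple mR)) (B : set mR) :
  measurable A -> measurable B ->
  lebesgueRn n.+1 [set z : n.+1.-tuple mR | A [tuple of behead z] /\ B (thead z)]
  = (lebesgueRn n A * leb B)%E.
Proof.
move=> mA mB; rewrite -product_measure1E//=.
rewrite /lebesgueS/= /pushforward; congr (product_measure1 _ _ _).
apply/seteqP; split=> [[z x]|[z x]] /=.
  move=> [Az Bx]; split=> //=.
  by move: Az; congr A; apply: val_inj.
move=> [Az Bx]; split=> //.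
by move: Az; congr A; apply: val_inj.
Qed.

Lemma sigma_finite_lebesgueRn n : sigma_finite setT (@lebesgueRn R n).
Proof.
pose box n (k : nat) := [set z : n.-tuple mR | forall i, `|tnth z i| <= k%:R].
have boxE m k : box m.+1 k = [set z : m.+1.-tuple mR | box m k [tuple of behead z] /\
    [set x | `|x| <= k%:R] (thead z)].
  have beheadE x (z : m.-tuple mR) : [tuple of behead [tuple of x :: z]] = z.
    exact: val_inj.
  apply/seteqP; split=> z; case/tupleP: z => x z /=; rewrite beheadE theadE.
    move=> H; split=> [i|]; last by have := H ord0; rewrite tnth0.
    by have := H (lift ord0 i); rewrite tnthS.
  move=> [H H0] i; case: (unliftP ord0 i) => [j ->|->]; last by rewrite tnth0.
  by rewrite tnthS.
have normE (k : nat) : [set x : R | `|x| <= k%:R] = `[- k%:R, k%:R]%classic.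
  by apply/seteqP; split=> x; rewrite /= in_itv/= ler_norml.
have mbox m k : measurable (box m k).
  rewrite (_ : box m k = \bigcap_(i in [set: 'I_m])
      ((fun z : m.-tuple mR => tnth z i) @^-1` `[- k%:R, k%:R])).
    apply: fin_bigcap_measurable => // i _; rewrite -[X in measurable X]setTI.
    exact: (measurable_tnth i measurableT (measurable_itv _)).
  apply/seteqP; split=> z /=.
    by move=> H i _ /=; rewrite in_itv/= -ler_norml.
  by move=> H i; have := H i I; rewrite /= in_itv/= -ler_norml.
exists (box n) => [|k].
  apply/seteqP; split=> // z _.
  have [M M0 MP] := fin_upper_bound (fun i : 'I_n => `|tnth z i : R|).
  exists (Num.truncn M).+1 => // i; apply: (le_trans (MP i)).
  by rewrite ltW// truncnS_gt.
split; first exact: mbox.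
elim: n => [|n IH].
  by rewrite /= diracE; case: (_ \in _); rewrite ltry.
rewrite boxE lebesgueRnS_box//; last by rewrite normE; exact: measurable_itv.
apply: lte_mul_pinfty => //.
  by rewrite ge0_fin_numE//; exact: IH.
by rewrite normE lebesgue_measure_itv/=; case: ifP => _; rewrite ?ltry// -EFinB ltry.
Qed.

Section successor.
Context (n : nat) (mu : {sigma_finite_measure set (n.-tuple mR) -> \bar R}).
Local Open Scope ereal_scope.

Lemma measurable_comp_consR (f : n.+1.-tuple mR -> \bar R) :
  measurable_fun setT f -> measurable_fun setT (f \o (@consR R n)).
Proof. by move=> mf; apply: measurableT_comp mf _; exact: measurable_consR. Qed.

Lemma ge0_integral_lebesgueS_prod (f : n.+1.-tuple mR -> \bar R) :
  measurable_fun setT f -> (forall z, 0 <= f z) ->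
  \int[lebesgueS mu]_z f z = \int[mu \x leb]_zx (f \o (@consR R n)) zx.
Proof.
move=> mf f0.
exact: (@ge0_integral_pushforward _ _ _ _ _ _ (@measurable_consR R n) (mu \x leb)
  setT f measurableT mf (fun z _ => f0 z)).
Qed.

Lemma ge0_integral_lebesgueS (f : n.+1.-tuple mR -> \bar R) :
  measurable_fun setT f -> (forall z, 0 <= f z) ->
  \int[lebesgueS mu]_z f z = \int[mu]_z \int[leb]_x f (consR (z, x)).
Proof.
move=> mf f0; rewrite ge0_integral_lebesgueS_prod//.
rewrite (@fubini_tonelli1 _ _ _ _ _ mu leb (f \o (@consR R n)))//.
  exact: measurable_comp_consR.
by move=> zx; exact: f0.
Qed.

Lemma integrable_comp_consR (f : n.+1.-tuple mR -> \bar R) :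
  (lebesgueS mu).-integrable setT f ->
  (mu \x leb).-integrable setT (f \o (@consR R n)).
Proof.
move=> /integrableP[mf fi]; apply/integrableP; split.
  exact: measurable_comp_consR.
apply: le_lt_trans fi.
rewrite (ge0_integral_lebesgueS_prod (f := fun z => `|f z|))//.
exact: measurableT_comp.
Qed.

Lemma integral_lebesgueS (f : n.+1.-tuple mR -> \bar R) :
  (lebesgueS mu).-integrable setT f ->
  \int[lebesgueS mu]_z f z = \int[mu]_z \int[leb]_x f (consR (z, x)).
Proof.
move=> fi; have fi' := integrable_comp_consR fi.
have mf : measurable_fun setT f by move/integrableP : fi => [].
rewrite [RHS](@integral12_prod_meas1 _ _ _ _ _ mu leb _ fi').
exact: (@integral_pushforward _ _ _ _ _ _ (@measurable_consR R n) (mu \x leb)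
  setT f mf fi' measurableT).
Qed.

Lemma integral_lebesgueS_swap (f : n.+1.-tuple mR -> \bar R) :
  (lebesgueS mu).-integrable setT f ->
  \int[lebesgueS mu]_z f z = \int[leb]_x \int[mu]_z f (consR (z, x)).
Proof.
move=> fi; rewrite integral_lebesgueS//.
exact: (@Fubini _ _ _ _ _ mu leb _ (integrable_comp_consR fi)).
Qed.

End successor.

(** Lebesgue measure on [R^n], packaged with its sigma-finiteness so that
   Tonelli and Fubini apply. *)
Definition sf_lebesgueRn (n : nat) : set (n.-tuple mR) -> \bar R := lebesgueRn n.
Arguments sf_lebesgueRn n : clear implicits.

HB.instance Definition _ n := Measure.copy (sf_lebesgueRn n) (lebesgueRn n).
HB.instance Definition _ n := Measure_isSigmaFinite.Build _ _ _
  (sf_lebesgueRn n) (sigma_finite_lebesgueRn n).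

Lemma ge0_integral_lebesgueRnS n (f : n.+1.-tuple mR -> \bar R) :
  measurable_fun setT f -> (forall z, (0 <= f z)%E) ->
  (\int[lebesgueRn n.+1]_z f z =
   \int[lebesgueRn n]_z \int[leb]_x f (consR (z, x)))%E.
Proof. exact: (@ge0_integral_lebesgueS n (sf_lebesgueRn n)). Qed.

Lemma integral_lebesgueRnS n (f : n.+1.-tuple mR -> \bar R) :
  (lebesgueRn n.+1).-integrable setT f ->
  (\int[lebesgueRn n.+1]_z f z =
   \int[lebesgueRn n]_z \int[leb]_x f (consR (z, x)))%E.
Proof. exact: (@integral_lebesgueS n (sf_lebesgueRn n)). Qed.

Lemma integral_lebesgueRnS_swap n (f : n.+1.-tuple mR -> \bar R) :
  (lebesgueRn n.+1).-integrable setT f ->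
  (\int[lebesgueRn n.+1]_z f z =
   \int[leb]_x \int[lebesgueRn n]_z f (consR (z, x)))%E.
Proof. exact: (@integral_lebesgueS_swap n (sf_lebesgueRn n)). Qed.

End LebesgueRnTheory.

(** * Integrability against Gaussian weights *)

Section GaussianWeights.
Context {R : realType}.
Local Notation mR := (measurableTypeR R).
Local Notation leb := (@lebesgue_measure R).

(** Dominating functions for polynomials times the Gaussian weight; their
   products [pw] over the coordinates dominate in several dimensions. *)
Definition gw (k : nat) (x : R) : R := (1 + `|x|) ^+ k * expR (- (2^-1 * (x * x))).

Lemma gw_ge0 k x : 0 <= gw k x.
Proof. by rewrite mulr_ge0 ?expR_ge0// exprn_ge0// addr_ge0. Qed.

Lemma gw_continuous k : continuous (gw k).
Proof.
apply: continuous_mul => x.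
  apply: (@continuous_comp _ _ _ (fun x : R => 1 + `|x|) (fun x : R => x ^+ k)).
    apply: cvgD; [exact: cvg_cst|exact: norm_continuous].
  exact: exprn_continuous.
apply: (@continuous_comp _ _ _ (fun x : R => - (2^-1 * (x * x))) expR).
  by apply: cvgN; apply: cvgM; [exact: cvg_cst|apply: cvgM; exact: cvg_id].
exact: continuous_expR.
Qed.

(** Completing the square in [k |x| - 3 x^2 / 8] leaves a multiple of a normal
   density of standard deviation 2. *)
Lemma gw_le k x :
  gw k x <= expR (2 * k%:R ^+ 2 / 3) * expR (- (x * x) / 8).
Proof.
have p1 : (1 + `|x|) ^+ k <= expR (k%:R * `|x|).
  rewrite expRM_natl lerXn2r ?nnegrE ?expR_ge0 ?addr_ge0//.
  exact: expR_ge1Dx.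
rewrite /gw; apply: le_trans (ler_wpM2r (expR_ge0 _) p1) _.
rewrite -!expRD ler_expR.
have : x * x = `|x| ^+ 2 by rewrite -expr2 real_normK ?num_real.
have := sqr_ge0 (3 * `|x| - 4 * k%:R); move: `|x| => y; move: (k%:R : R) => r.
by move=> H ->; move: H; rewrite !expr2; lra.
Qed.

Lemma integrable_gw k : leb.-integrable setT (EFin \o gw k).
Proof.
have mgw : measurable_fun setT (gw k : mR -> R).
  by apply: continuous_measurable_fun; exact: gw_continuous.
pose c := expR (2 * k%:R ^+ 2 / 3) / normal_peak (2 : R).
have pk : 0 < normal_peak (2 : R) by apply: normal_peak_gt0.
have := integrableZl measurableT c (integrable_normal_pdf (0 : R) 2).
apply: le_integrable => //.
  exact/measurable_EFinP.
move=> x _ /=; rewrite lee_fin (ger0_norm (gw_ge0 _ _)).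
rewrite /normal_pdf pnatr_eq0/= /normal_fun subr0 mulrA divfK ?gt_eqF//.
rewrite ger0_norm ?mulr_ge0 ?expR_ge0//.
apply: (le_trans (gw_le k x)); rewrite ler_wpM2l ?expR_ge0// ler_expR expr2.
rewrite le_eqVlt; apply/orP; left; apply/eqP; by field.
Qed.

Lemma gw_decay k x : gw k x <= expR (2 * k.+1%:R ^+ 2 / 3) / (1 + `|x|).
Proof.
rewrite ler_pdivlMr ?ltr_pwDl// [leLHS](_ : _ = gw k.+1 x); last first.
  by rewrite /gw exprS mulrC mulrA.
apply: (le_trans (gw_le k.+1 x)); rewrite ler_piMr ?expR_ge0//.
by rewrite -expR0 ler_expR mulNr oppr_le0 mulr_ge0// -expr2 sqr_ge0.
Qed.

Definition pw n k (x : 'cV[R]_n) : R := \prod_i gw k (x i 0).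

Lemma pw_ge0 n k (x : 'cV[R]_n) : 0 <= pw k x.
Proof. by apply: prodr_ge0 => i _; exact: gw_ge0. Qed.

Lemma pw_continuous n k : continuous (@pw n k).
Proof.
suff H (s : seq 'I_n) : continuous (fun x : 'cV[R]_n => \prod_(i <- s) gw k (x i 0)).
  exact: H.
elim: s => [|i s IH].
  by under eq_fun do rewrite big_nil; exact: cst_continuous.
under eq_fun do rewrite big_cons; apply: (@continuous_mul R 'cV[R]_n) => //.
move=> x; apply: (@continuous_comp _ _ _ (fun x : 'cV[R]_n => x i 0) (gw k)).
  exact: coord_continuous.
exact: gw_continuous.
Qed.

Lemma pw_cons n k x (v : 'cV[R]_n) : pw k (cons_cv x v) = gw k x * pw k v.
Proof.
rewrite /pw big_ord_recl cons_cv0; congr (_ * _).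
by apply: eq_bigr => i _; rewrite cons_cvS.
Qed.

Lemma integrable_pw n k :
  (lebesgueRn n).-integrable setT (fun z => (pw k (col_of_tuple z))%:E).
Proof.
elim: n => [|n IH].
  apply/integrableP; split.
    by apply/measurable_EFinP; exact: measurable_col_of_tuple (@pw_continuous _ k).
  rewrite integral_dirac//; last first.
    apply: measurableT_comp => //.
    by apply/measurable_EFinP; exact: measurable_col_of_tuple (@pw_continuous _ k).
  by rewrite diracE in_setT mul1e/= ltry.
apply/integrableP; split.
  by apply/measurable_EFinP; exact: measurable_col_of_tuple (@pw_continuous _ k).
rewrite ge0_integral_lebesgueRnS//; last first.
  apply: measurableT_comp => //.
  by apply/measurable_EFinP; exact: measurable_col_of_tuple (@pw_continuous _ k).
have /integrableP[mgw gwoo] := integrable_gw k.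
under eq_integral => z _.
  under eq_integral => x _.
    rewrite col_of_consR pw_cons/= ger0_norm ?mulr_ge0 ?gw_ge0 ?pw_ge0//.
    rewrite mulrC EFinM.
  over.
  rewrite ge0_integralZl//; first over.
  - by move=> x _; rewrite lee_fin gw_ge0.
  - by rewrite lee_fin pw_ge0.
rewrite /=.
have gwE : (\int[leb]_x (gw k x)%:E)%E \is a fin_num.
  exact: integrable_fin_num (integrable_gw k).
rewrite -(fineK gwE) ge0_integralZr//.
- apply: lte_mul_pinfty => //.
  + by apply: integral_ge0 => z _; rewrite lee_fin pw_ge0.
  + exact: integrable_fin_num IH.
  + exact: ltry.
- by apply/measurable_EFinP; exact: measurable_col_of_tuple (@pw_continuous _ k).
- by move=> z _; rewrite lee_fin pw_ge0.
- by rewrite lee_fin fine_ge0// integral_ge0// => x _; rewrite lee_fin gw_ge0.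
Qed.

Lemma integrable_le_pw n k c (h : 'cV[R]_n -> R) : continuous h ->
  (forall x, `|h x| <= c * pw k x) ->
  (lebesgueRn n).-integrable setT (fun z => (h (col_of_tuple z))%:E).
Proof.
move=> ch hk.
have := integrableZl measurableT c (integrable_pw n k).
apply: le_integrable => //.
  by apply/measurable_EFinP; exact: measurable_col_of_tuple.
move=> z _ /=; rewrite lee_fin.
by rewrite (le_trans (hk _))// ler_norm.
Qed.

(** Integrate over [[- m, m]] and let [m] tend to infinity: the boundary terms
   vanish and the integrals converge by domination. *)
Lemma integral_derivative0 (f df : R -> R) k c :
  (forall x : R, is_derive x 1 f (df x)) -> continuous df ->
  (forall x, `|f x| <= c * gw k x) -> (forall x, `|df x| <= c * gw k x) ->
  (\int[leb]_x (df x)%:E = 0)%E.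
Proof.
move=> fd cdf fk dfk.
have cf : continuous f by move=> x; exact: is_derive1_continuous (fd x).
have c0 : 0 <= c.
  have := le_trans (normr_ge0 _) (fk 0).
  by rewrite /gw normr0 addr0 expr1n !mulr0 oppr0 expR0 !mulr1.
pose I_ (m : nat) : set R := `[- m.+1%:R, m.+1%:R]%classic.
pose g m x : \bar R := ((df \_ (I_ m)) x)%:E.
have mdf : measurable_fun setT (df : mR -> R).
  exact: continuous_measurable_fun.
have mI m : measurable (I_ m : set mR) by exact: measurable_itv.
have gE m : (\int[leb]_x g m x = (f m.+1%:R - f (- m.+1%:R))%:E)%E.
  transitivity (\int[leb]_(x in I_ m) (df x)%:E)%E.
    rewrite [RHS]integral_mkcond; apply: eq_integral => x _.
    by rewrite /g !patchE; case: ifP.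
  rewrite EFinB; apply: continuous_FTC2.
  - by rewrite -subr_gt0 opprK addr_gt0.
  - exact: continuous_subspaceT.
  - split.
    + by move=> x _; case: (fd x).
    + by apply: cvg_at_right_filter; exact: cf.
    + by apply: cvg_at_left_filter; exact: cf.
  - by move=> x _; rewrite derive1E; case: (fd x).
have dom : (\int[leb]_x g m x)%E @[m --> \oo] --> (\int[leb]_x (df x)%:E)%E.
  apply: (@dominated_cvg _ _ _ leb setT measurableT g _
      (fun x => (c * gw k x)%:E)).
  - by move=> m; apply/measurable_EFinP/measurable_restrict => //; rewrite setTI; exact: measurable_funTS.
  - move=> x _; apply: cvg_near_cst; near=> m.
    suff xI : I_ m x by rewrite /g patchE mem_set.
    rewrite /I_/= in_itv/= -ler_norml.
    near: m; exists (Num.truncn `|x|) => // m /= xm.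
    by rewrite ltW// (lt_le_trans (truncnS_gt _))// ler_nat ltnS.
  - by [].
  - by under eq_fun do rewrite EFinM; apply: integrableZl => //; exact: integrable_gw.
  - move=> m x _; rewrite /g lee_fin patchE; case: ifP => _ //.
    by rewrite normr0 mulr_ge0// gw_ge0.
have lim0 : (\int[leb]_x g m x)%E @[m --> \oo] --> (0 : \bar R).
  under eq_fun do rewrite gE; apply: cvg_EFin; first exact: nearW.
  apply/cvgrPdist_le => e e0; near=> m => /=; rewrite sub0r normrN.
  pose B := c * expR (2 * k.+1%:R ^+ 2 / 3).
  have B0 : 0 <= B by rewrite mulr_ge0// expR_ge0.
  have fm (x : R) : `|x| = m.+1%:R -> `|f x| <= B / m.+1%:R.
    move=> xm; rewrite (le_trans (fk x))// /B -mulrA ler_wpM2l//.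
    rewrite (le_trans (gw_decay k x))// ler_wpM2l ?expR_ge0// xm.
    by rewrite lef_pV2 ?posrE ?ltr_pwDl// lerDr.
  rewrite (le_trans (ler_normB _ _))//.
  apply: (@le_trans _ _ (B / m.+1%:R + B / m.+1%:R)).
    by apply: lerD; apply: fm; rewrite ?normrN ger0_norm.
  rewrite -mulrDl ler_pdivrMr// mulrC -ler_pdivrMr//.
  near: m; exists (Num.truncn ((B + B) / e)) => // m /= Bm.
  by rewrite ltW// (lt_le_trans (truncnS_gt _))// ler_nat ltnS.
exact: (cvg_unique _ dom lim0).
Unshelve. all: by end_near. Qed.

End GaussianWeights.

(** * Gaussian expectations and integration by parts *)

Section PolynomialGrowth.
Context {R : realType}.

Definition pgrowth n (f : 'cV[R]_n -> R) : Prop :=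
  exists C k, forall x, `|f x| <= C * (1 + `|x|) ^+ k.

Lemma pgrowthW n (f : 'cV[R]_n -> R) : pgrowth f ->
  exists C k, 0 <= C /\ forall k', (k <= k')%N ->
    forall x, `|f x| <= C * (1 + `|x|) ^+ k'.
Proof.
move=> [C [k fk]]; exists C, k; split.
  by have := le_trans (normr_ge0 _) (fk 0); rewrite normr0 addr0 expr1n mulr1.
move=> k' kk' x.
have C0 : 0 <= C.
  by have := le_trans (normr_ge0 _) (fk 0); rewrite normr0 addr0 expr1n mulr1.
apply: (le_trans (fk x)); rewrite ler_wpM2l// -(subnK kk') exprD ler_peMl//.
by rewrite exprn_ege1// lerDl.
Qed.

Lemma pgrowth_cst n c : pgrowth (fun _ : 'cV[R]_n => c).
Proof. by exists `|c|, 0%N => x; rewrite expr0 mulr1. Qed.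

Lemma pgrowthM n (f g : 'cV[R]_n -> R) :
  pgrowth f -> pgrowth g -> pgrowth (fun x => f x * g x).
Proof.
move=> [C [k fk]] [C' [k' gk]]; exists (C * C'), (k + k')%N => x.
by rewrite exprD mulrACA normrM ler_pM.
Qed.

Lemma pgrowthD n (f g : 'cV[R]_n -> R) :
  pgrowth f -> pgrowth g -> pgrowth (fun x => f x + g x).
Proof.
move=> /pgrowthW[C [k [C0 fk]]] /pgrowthW[C' [k' [C'0 gk]]].
exists (C + C'), (maxn k k') => x; rewrite mulrDl (le_trans (ler_normD _ _))//.
by rewrite lerD ?fk ?gk// ?leq_maxl ?leq_maxr.
Qed.

Lemma pgrowth_sum n (I : Type) (s : seq I) (F : I -> 'cV[R]_n -> R) :
  (forall i, pgrowth (F i)) -> pgrowth (fun x => \sum_(i <- s) F i x).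
Proof.
move=> sF; elim: s => [|i s IH].
  by under eq_fun do rewrite big_nil; exact: pgrowth_cst.
by under eq_fun do rewrite big_cons; exact: pgrowthD.
Qed.

Lemma pgrowth_le n (f g : 'cV[R]_n -> R) :
  (forall x, `|f x| <= `|g x|) -> pgrowth g -> pgrowth f.
Proof. by move=> fg [C [k gk]]; exists C, k => x; exact: le_trans (fg x) (gk x). Qed.

Lemma pgrowth_coord n (i : 'I_n) : pgrowth (fun x : 'cV[R]_n => x i 0).
Proof.
exists 1, 1%N => x; rewrite mul1r expr1 (le_trans (mxnorm_entry x i 0))//.
by rewrite lerDr.
Qed.

Lemma pgrowth_comp n m (g : 'cV[R]_m -> R) (c : R) : 0 <= c -> pgrowth g ->
  exists C k, 0 <= C /\ forall (x : 'cV[R]_m) (z : 'cV[R]_n),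
    `|x| <= c * (1 + `|z|) -> `|g x| <= C * (1 + `|z|) ^+ k.
Proof.
move=> c0 /pgrowthW[C [k [C0 gk]]].
exists (C * (1 + c) ^+ k), k; split; first by rewrite mulr_ge0// exprn_ge0// addr_ge0.
move=> x z xz; apply: (le_trans (gk k (leqnn k) x)).
rewrite -mulrA -exprMn ler_wpM2l// lerXn2r ?nnegrE ?mulr_ge0 ?addr_ge0//.
by rewrite mulrDl mul1r lerD// lerDl.
Qed.

(** Integrating once raises the growth exponent by one. *)
Lemma pgrowth_of_partials n (f : 'cV[R]_n -> R) : partially_derivable f ->
  (forall j, pgrowth (partial j f)) -> pgrowth f.
Proof.
move=> df /= pf.
have /all_sig[C CP] : forall j : 'I_n, {Ck : R * nat | 0 <= Ck.1 /\
    forall k', (Ck.2 <= k')%N -> forall x, `|partial j f x| <= Ck.1 * (1 + `|x|) ^+ k'}.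
  by move=> j; apply: cid; have [C [k H]] := pgrowthW (pf j); exists (C, k).
pose K := (\max_j (C j).2)%N; have [M M0 MP] := fin_upper_bound (fun j => (C j).1).
have bound rho k z : `|z| <= rho -> `|partial k f z| <= M * (1 + rho) ^+ K.
  move=> zr; have [C0 H] := CP k.
  apply: (le_trans (H K (leq_bigmax k) z)).
  rewrite ler_pM ?exprn_ge0 ?addr_ge0//.
  by rewrite lerXn2r ?nnegrE ?addr_ge0 ?lerD2l// (le_trans _ zr).
exists (`|f 0| + n%:R * M), K.+1 => x.
have H := @lipschitz_box _ _ f `|x| _ 0 x df (bound `|x|).
have x0 : `|0 : 'cV[R]_n| <= `|x| by rewrite normr0.
have {H} := H x0 (lexx _); rewrite subr0 => H.
have p1 : 1 <= (1 + `|x|) ^+ K.+1 by rewrite exprn_ege1// lerDl.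
rewrite -[f x](subrK (f 0)) (le_trans (ler_normD _ _))// addrC mulrDl lerD//.
  by rewrite ler_peMr.
apply: (le_trans H); rewrite mulrA -mulrA ler_wpM2l ?mulr_ge0//.
by rewrite exprSr ler_wpM2l ?exprn_ge0 ?addr_ge0// lerDr.
Qed.

Definition tempered n (f : 'cV[R]_n -> R) : Prop :=
  smooth f /\ forall r, pgrowth (partials r f).

Lemma tempered_partial n j (f : 'cV[R]_n -> R) : tempered f -> tempered (partial j f).
Proof.
move=> [sf tf]; split; first exact: smooth_partial.
by move=> r; have := tf (rcons r j); rewrite /partials foldr_rcons.
Qed.

Lemma tempered_growth n (f : 'cV[R]_n -> R) : tempered f -> pgrowth f.
Proof. by move=> [_ /(_ [::])]. Qed.

Lemma bounded_partials_tempered n k (f : 'cV[R]_n -> R) : smooth f ->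
  bounded_partials k f -> tempered f.
Proof.
move=> sf bf; split=> // r.
have [m Hm] := ubnP (k - size r); elim: m r Hm => // m IH r Hm.
have [kr|rk] := leqP k (size r).
  by have [C HC] := bf r kr; exists C, 0%N => x; rewrite expr0 mulr1.
apply: pgrowth_of_partials; first by have [] := sf r.
move=> j; apply: (IH (j :: r)) => /=.
by rewrite subnS -ltnS prednK ?subn_gt0.
Qed.

End PolynomialGrowth.

Section GaussianExpectation.
Context {R : realType}.
Local Notation mR := (measurableTypeR R).

Definition gweight n (x : 'cV[R]_n) : R := expR (- (2^-1 * sqnorm x)).

Lemma gweight_ge0 n (x : 'cV[R]_n) : 0 <= gweight x.
Proof. exact: expR_ge0. Qed.

Lemma gweight_pw n k (x : 'cV[R]_n) : (1 + `|x|) ^+ k * gweight x <= pw k x.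
Proof.
have -> : gweight x = \prod_i expR (- (2^-1 * (x i 0 * x i 0))).
  rewrite /gweight /sqnorm /dot mulr_sumr -sumrN.
  by rewrite (big_morph expR (@expRD R) (@expR0 R)).
rewrite /pw /gw big_split/= ler_wpM2r//.
  by apply: prodr_ge0 => i _; exact: expR_ge0.
rewrite prodrXl lerXn2r ?nnegrE ?addr_ge0//.
  by apply: prodr_ge0 => i _; rewrite addr_ge0.
have p1 (P : pred 'I_n) : 1 <= \prod_(i | P i) (1 + `|x i 0|).
  elim/big_rec: _ => // i p _ p1.
  by rewrite (le_trans p1)// ler_peMl ?(le_trans ler01)// lerDl.
rewrite addrC -lerBrDr; apply: cvnorm_le => [|i]; first by rewrite subr_ge0.
rewrite lerBrDr addrC (bigD1 i)//= ler_peMr ?p1//.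
Qed.

Lemma is_derive_gweight n (i : 'I_n) (x : 'cV[R]_n) :
  is_derive x (delta_mx i 0) (@gweight n) (- (x i 0 * gweight x)).
Proof.
have ds : is_derive x (delta_mx i 0) (fun y : 'cV[R]_n => sqnorm y) (2 * x i 0).
  have := is_derive_sqnorm (is_derive_id x (delta_mx i 0)).
  rewrite /dot (bigD1 i)//= mxE !eqxx mulr1 big1 ?addr0// => j /negbTE ji.
  by rewrite mxE ji mulr0.
have dq : is_derive x (delta_mx i 0) (fun y : 'cV[R]_n => - (2^-1 * sqnorm y)) (- x i 0).
  apply: is_deriveN.
  have := @is_deriveZ R _ _ (fun y : 'cV[R]_n => sqnorm y) 2^-1 x (delta_mx i 0) _ ds.
  by rewrite [_ *: _](_ : _ = x i 0)// [LHS]mulrA mulVf// mul1r.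
have de : differentiable (@expR R) (- (2^-1 * sqnorm x)).
  exact/derivable1_diffP/derivable_expR.
have := is_derive_diff_comp dq de.
by rewrite diff1E//= derive1E derive_val -[_ *: _]/(_ * _) mulNr.
Qed.

Lemma gweight_continuous n : continuous (@gweight n).
Proof.
have cs : continuous (fun x : 'cV[R]_n => - (2^-1 * sqnorm x)).
  apply: smooth_continuous; apply: smoothN; apply: smoothM; first exact: smooth_cst.
  by apply: smooth_sum => i; apply: smoothM; exact: smooth_coord.
move=> x; apply: (@continuous_comp _ _ _ (fun x : 'cV[R]_n => - (2^-1 * sqnorm x)) expR).
  exact: cs.
exact: continuous_expR.
Qed.

(** Gaussian expectation without the normalizing factor. *)
Definition gexp n (F : 'cV[R]_n -> R) : R :=
  \int[lebesgueRn n]_z (F (col_of_tuple z) * gweight (col_of_tuple z)).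

Definition admissible n (F : 'cV[R]_n -> R) : Prop := continuous F /\ pgrowth F.

Lemma admissibleM n (F G : 'cV[R]_n -> R) :
  admissible F -> admissible G -> admissible (fun x => F x * G x).
Proof.
move=> [cF pF] [cG pG]; split; last exact: pgrowthM.
exact: (@continuous_mul R 'cV[R]_n).
Qed.

Lemma admissibleD n (F G : 'cV[R]_n -> R) :
  admissible F -> admissible G -> admissible (fun x => F x + G x).
Proof.
move=> [cF pF] [cG pG]; split; last exact: pgrowthD.
exact: (@continuous_add R 'cV[R]_n).
Qed.

Lemma admissible_cst n c : admissible (fun _ : 'cV[R]_n => c).
Proof. by split; [exact: cst_continuous|exact: pgrowth_cst]. Qed.

Lemma admissible_coord n i : admissible (fun x : 'cV[R]_n => x i 0).
Proof. by split; [exact: coord_continuous|exact: pgrowth_coord]. Qed.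

Lemma admissible_sum n (I : Type) (s : seq I) (F : I -> 'cV[R]_n -> R) :
  (forall i, admissible (F i)) -> admissible (fun x => \sum_(i <- s) F i x).
Proof.
move=> sF; elim: s => [|i s IH].
  by under eq_fun do rewrite big_nil; exact: admissible_cst.
by under eq_fun do rewrite big_cons; exact: admissibleD.
Qed.

Lemma admissible_norm n (F : 'cV[R]_n -> R) :
  admissible F -> admissible (fun x => `|F x|).
Proof.
move=> [cF pF]; split; last by apply: pgrowth_le pF => x; rewrite normr_id.
move=> x; apply: (@continuous_comp _ _ _ F (fun y : R => `|y|)); first exact: cF.
exact: norm_continuous.
Qed.

Lemma gexp_integrable n (F : 'cV[R]_n -> R) : admissible F ->
  (lebesgueRn n).-integrable setT
    (EFin \o (fun z => F (col_of_tuple z) * gweight (col_of_tuple z))).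
Proof.
move=> [cF /pgrowthW[C [k [C0 Fk]]]].
apply: (@integrable_le_pw R n k C (fun x => F x * gweight x)).
  by apply: (@continuous_mul R 'cV[R]_n) => //; exact: gweight_continuous.
move=> x; rewrite normrM (ger0_norm (gweight_ge0 x)).
apply: (@le_trans _ _ (C * (1 + `|x|) ^+ k * gweight x)).
  by rewrite ler_wpM2r ?gweight_ge0// Fk.
by rewrite -mulrA ler_wpM2l// gweight_pw.
Qed.

Lemma gexpD n (F G : 'cV[R]_n -> R) : admissible F -> admissible G ->
  gexp (fun x => F x + G x) = gexp F + gexp G.
Proof.
move=> aF aG; rewrite /gexp -RintegralD//; [|exact: gexp_integrable..].
by apply: eq_Rintegral => z _; rewrite mulrDl.
Qed.

Lemma gexpZ n c (F : 'cV[R]_n -> R) : admissible F ->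
  gexp (fun x => c * F x) = c * gexp F.
Proof.
move=> aF; rewrite /gexp -RintegralZl//; last exact: gexp_integrable.
by apply: eq_Rintegral => z _; rewrite mulrA.
Qed.

Lemma gexp_sum n (I : Type) (s : seq I) (F : I -> 'cV[R]_n -> R) :
  (forall i, admissible (F i)) ->
  gexp (fun x => \sum_(i <- s) F i x) = \sum_(i <- s) gexp (F i).
Proof.
move=> aF; elim: s => [|i s IH].
  rewrite big_nil /gexp /Rintegral integral0_eq// => z _.
  by rewrite big_nil mul0r.
rewrite big_cons -IH -gexpD//; last exact: admissible_sum.
by apply: eq_Rintegral => z _; rewrite big_cons.
Qed.

Lemma gexp_le n (F G : 'cV[R]_n -> R) : admissible F -> admissible G ->
  (forall x, `|F x| <= G x) -> `|gexp F| <= gexp G.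
Proof.
move=> aF aG FG; rewrite /gexp.
apply: (le_trans (le_normr_Rintegral measurableT (gexp_integrable aF))).
apply: le_Rintegral => //; last 1 first.
- by move=> z _; rewrite normrM (ger0_norm (gweight_ge0 _)) ler_wpM2r ?gweight_ge0.
- have := gexp_integrable (admissible_norm aF).
  apply: eq_integrable => // z _ /=.
  by rewrite normrM (ger0_norm (gweight_ge0 _)).
- exact: gexp_integrable.
Qed.

(** By Fubini's theorem one may integrate first in the differentiated
   coordinate, which reduces the claim to [integral_derivative0]. *)
Lemma integral_partial0 n (i : 'I_n) (h : 'cV[R]_n -> R) k c :
  continuous h -> continuous (partial i h) ->
  (forall x, derivable h x (delta_mx i 0)) ->
  (forall x, `|h x| <= c * pw k x) -> (forall x, `|partial i h x| <= c * pw k x) ->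
  (\int[lebesgueRn n]_z (partial i h (col_of_tuple z))%:E = 0)%E.
Proof.
elim: n i h c => [[]//|n IH] i h c ch cdh dh hk dhk.
have int := integrable_le_pw cdh dhk.
have [j ij|i0] := unliftP ord0 i.
  rewrite integral_lebesgueRnS_swap// (eq_integral (fun=> 0%E)) ?integral0// => x _.
  pose hx v := h (cons_cv x v).
  have cons_line (v : 'cV[R]_n) (t : R) :
      cons_cv x (v + t *: delta_mx j 0) = cons_cv x v + t *: delta_mx i 0.
    apply/matrixP => l m; rewrite !mxE ord1 eqxx andbT ij.
    have [l' ->|->] := unliftP ord0 l; last by rewrite -[_ == _]/false mulr0 addr0.
    by rewrite !mxE eqxx andbT (inj_eq (@lift_inj _ ord0)).
  have dhx (v : 'cV[R]_n) :
      is_derive v (delta_mx j 0) hx (partial i h (cons_cv x v)).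
    rewrite -[v]addr0 -(scale0r (delta_mx j 0)); apply/is_derive_lineP.
    rewrite /hx; under eq_fun do rewrite cons_line.
    rewrite cons_line.
    apply: (@is_derive_line R _ _ h (cons_cv x v) (delta_mx i 0) 0).
    by apply: is_derive_partial; exact: dh.
  have phx : partial j hx = fun v => partial i h (cons_cv x v).
    by apply/funext => v; case: (dhx v).
  have := IH j hx (c * gw k x); rewrite phx => H.
  rewrite -[RHS]H.
  - by apply: eq_integral => z _; rewrite col_of_consR.
  - move=> v; apply: (@continuous_comp _ _ _ (@cons_cv R n x) h); last exact: ch.
    exact: cons_cv_continuous.
  - move=> v; apply: (@continuous_comp _ _ _ (@cons_cv R n x) (partial i h)); last exact: cdh.
    exact: cons_cv_continuous.
  - by move=> v; case: (dhx v).
  - by move=> v; rewrite -mulrA -pw_cons; exact: hk.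
  - by move=> v; rewrite -mulrA -pw_cons; exact: dhk.
rewrite integral_lebesgueRnS// (eq_integral (fun=> 0%E)) ?integral0// => z _.
under eq_integral do rewrite col_of_consR.
pose v := col_of_tuple z.
apply: (@integral_derivative0 R (fun x => h (cons_cv x v))
  (fun x => partial i h (cons_cv x v)) k (c * pw k v)).
- have cons_line (x : R) : cons_cv x v = cons_cv 0 v + x *: delta_mx i 0.
    apply/matrixP => l m; rewrite !mxE ord1 eqxx andbT i0.
    have [l' ->|->] := unliftP ord0 l; last by rewrite eqxx mulr1 add0r.
    by rewrite -[_ == _]/false mulr0 addr0.
  move=> x; rewrite [cons_cv x v]cons_line.
  rewrite [X in is_derive _ _ X](_ : _ = fun x => h (cons_cv 0 v + x *: delta_mx i 0)); last first.
    by apply/funext => y; rewrite cons_line.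
  apply: (@is_derive_line R _ _ h (cons_cv 0 v) (delta_mx i 0) x).
  by apply: is_derive_partial; exact: dh.
- move=> x; apply: (@continuous_comp _ _ _ (fun x => cons_cv x v) (partial i h)).
    exact: cons_cv_continuousl.
  exact: cdh.
- by move=> x; rewrite -mulrA [pw k v * _]mulrC -pw_cons; exact: hk.
- by move=> x; rewrite -mulrA [pw k v * _]mulrC -pw_cons; exact: dhk.
Qed.

(** Stein's identity: the derivative of [F] times the Gaussian weight has
   integral zero, and differentiating the weight produces the factor
   [- x i 0]. *)
Lemma gexp_stein n (i : 'I_n) (F : 'cV[R]_n -> R) : admissible F ->
  (forall x, derivable F x (delta_mx i 0)) -> admissible (partial i F) ->
  gexp (partial i F) = gexp (fun x => F x * x i 0).
Proof.
move=> aF dF adF.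
pose h x := F x * gweight x.
have dh (x : 'cV[R]_n) : is_derive x (delta_mx i 0) h
    ((partial i F x + - 1 * (F x * x i 0)) * gweight x).
  have := @is_deriveM _ _ F (@gweight n) x (delta_mx i 0) _ _
    (is_derive_partial (dF x)) (is_derive_gweight i x).
  rewrite [X in is_derive _ _ _ X](_ : _ =
    (partial i F x + - 1 * (F x * x i 0)) * gweight x)//.
  rewrite -![_ *: _]/(_ * _); ring.
have ph : partial i h = fun x => (partial i F x + - 1 * (F x * x i 0)) * gweight x.
  by apply/funext => x; case: (dh x).
have aFx : admissible (fun x => F x * x i 0).
  by apply: admissibleM => //; exact: admissible_coord.
have aNFx : admissible (fun x => - 1 * (F x * x i 0)).
  by apply: admissibleM => //; exact: admissible_cst.
have asum : admissible (fun x => partial i F x + - 1 * (F x * x i 0)).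
  exact: admissibleD.
have bound (G : 'cV[R]_n -> R) : admissible G -> exists C k, 0 <= C /\
    forall k', (k <= k')%N -> forall x, `|G x * gweight x| <= C * pw k' x.
  move=> [_ /pgrowthW[C [k [C0 Gk]]]]; exists C, k; split=> // k' kk' x.
  rewrite normrM (ger0_norm (gweight_ge0 x)).
  apply: (@le_trans _ _ (C * (1 + `|x|) ^+ k' * gweight x)).
    by rewrite ler_wpM2r ?gweight_ge0// Gk.
  by rewrite -mulrA ler_wpM2l// gweight_pw.
have [C1 [k1 [C10 b1]]] := bound _ aF.
have [C2 [k2 [C20 b2]]] := bound _ asum.
have cw := @gweight_continuous n.
suff : gexp (fun x => partial i F x + - 1 * (F x * x i 0)) = 0.
  by rewrite gexpD// gexpZ// mulN1r => /eqP; rewrite subr_eq0 => /eqP.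
suff /(congr1 fine) : (\int[lebesgueRn n]_z (partial i h (col_of_tuple z))%:E = 0)%E.
  by rewrite ph.
apply: (@integral_partial0 n i h (maxn k1 k2) (C1 + C2)); rewrite ?ph.
- by apply: (@continuous_mul R 'cV[R]_n) => //; case: aF.
- by apply: (@continuous_mul R 'cV[R]_n) => //; case: asum.
- by move=> x; case: (dh x).
- move=> x; apply: (le_trans (b1 (maxn k1 k2) (leq_maxl _ _) x)).
  by rewrite ler_wpM2r ?pw_ge0// lerDl.
- move=> x; apply: (le_trans (b2 (maxn k1 k2) (leq_maxr _ _) x)).
  by rewrite ler_wpM2r ?pw_ge0// lerDr.
Qed.

End GaussianExpectation.

(** * Differentiation of Gaussian averages *)

Section ParameterIntegrals.
Context {R : realType} (N n d : nat).
Variables (a : 'I_N -> 'cV[R]_n -> 'cV[R]_d) (Ca : R).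
Hypothesis a_admissible : forall m l, admissible (fun z => a m z l 0).
Hypothesis Ca_ge0 : 0 <= Ca.
Hypothesis a_bound : forall m z, `|a m z| <= Ca * (1 + `|z|).
Local Notation mR := (measurableTypeR R).

(** The point [q + X_1 zeta_1 + X_2 zeta_2] at which a potential is averaged is
   linear in the parameter [(q, X_1, X_2)]; its coefficients [a m] depend on
   the Gaussian variable [(zeta_1, zeta_2)]. *)
Definition aff (y : 'cV[R]_N) (z : 'cV[R]_n) : 'cV[R]_d :=
  \sum_m y m 0 *: a m z.

Lemma aff_line y m t z : aff (y + t *: delta_mx m 0) z = aff y z + t *: a m z.
Proof.
rewrite /aff (bigD1 m)//= [in RHS](bigD1 m)//= !mxE !eqxx mulr1 scalerDl.
rewrite addrAC; congr (_ + _ + _); apply: eq_bigr => k /negbTE km.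
by rewrite !mxE km mulr0 addr0.
Qed.

Lemma aff_bound y z : `|aff y z| <= N%:R * Ca * `|y| * (1 + `|z|).
Proof.
rewrite (le_trans (ler_norm_sum _ _ _))// -[X in X%:R](card_ord N).
rewrite -!mulrA mulr_natl -sumr_const; apply: ler_sum => m _.
rewrite normrZ mulrCA ler_pM//; exact: mxnorm_entry.
Qed.

Lemma aff_continuous y : continuous (aff y).
Proof.
apply: (@continuous_cv R 'cV[R]_n) => l.
rewrite (_ : (fun z => _) = fun z => \sum_m y m 0 * a m z l 0).
  have [] // : admissible (fun z => \sum_m y m 0 * a m z l 0).
  apply: admissible_sum => m; apply: admissibleM; first exact: admissible_cst.
  exact: a_admissible.
by apply/funext => z; rewrite summxE; apply: eq_bigr => m _; rewrite mxE.
Qed.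

Definition pavg (g : 'cV[R]_d -> R) (P : 'cV[R]_n -> R) (y : 'cV[R]_N) : R :=
  gexp (fun z => g (aff y z) * P z).

Lemma admissible_pow k : admissible (fun z : 'cV[R]_n => (1 + `|z|) ^+ k).
Proof.
elim: k => [|k IH].
  by under eq_fun do rewrite expr0; exact: admissible_cst.
under eq_fun do rewrite exprS; apply: admissibleM => //.
apply: admissibleD; first exact: admissible_cst.
split; first exact: (@norm_continuous R 'cV[R]_n).
by exists 1, 1%N => x; rewrite normr_id mul1r expr1 lerDr.
Qed.

Lemma comp_aff_admissible g y : continuous g -> pgrowth g ->
  admissible (fun z => g (aff y z)).
Proof.
move=> cg pg; split.
  move=> z; apply: (@continuous_comp _ _ _ (aff y) g); [exact: aff_continuous|exact: cg].
have c0 : 0 <= N%:R * Ca * `|y| by rewrite !mulr_ge0.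
have [C [k [_ H]]] := @pgrowth_comp R n d g _ c0 pg.
by exists C, k => z; apply: H; exact: aff_bound.
Qed.

Lemma pavg_locally_bounded g P rho : continuous g -> pgrowth g -> admissible P ->
  exists M, forall y, `|y| <= rho -> `|pavg g P y| <= M.
Proof.
move=> cg pg aP; have [r0|r0] := leP 0 rho; last first.
  by exists 0 => y yr; have := lt_le_trans r0 (le_trans (normr_ge0 y) yr); rewrite ltxx.
have c0 : 0 <= N%:R * Ca * rho by rewrite !mulr_ge0.
have [C [k [C0 H]]] := @pgrowth_comp R n d g _ c0 pg.
exists (gexp (fun z => C * (1 + `|z|) ^+ k * `|P z|)) => y yr.
apply: gexp_le.
- by apply: admissibleM => //; exact: comp_aff_admissible.
- apply: admissibleM; last exact: admissible_norm.
  by apply: admissibleM; [exact: admissible_cst|exact: admissible_pow].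
- move=> z; rewrite normrM ler_wpM2r// H// (le_trans (aff_bound y z))//.
  by rewrite ler_wpM2r ?addr_ge0// ler_wpM2l// mulr_ge0.
Qed.

Lemma pavg_bounded g P B : continuous g -> admissible P ->
  (forall x, `|g x| <= B) -> forall y, `|pavg g P y| <= B * gexp (fun z => `|P z|).
Proof.
move=> cg aP gB y; rewrite -gexpZ; last exact: admissible_norm.
apply: gexp_le.
- apply: admissibleM => //; apply: comp_aff_admissible => //.
  by exists B, 0%N => x; rewrite expr0 mulr1.
- by apply: admissibleM; [exact: admissible_cst|exact: admissible_norm].
- by move=> z; rewrite normrM ler_wpM2r.
Qed.

(** Differentiation under the integral sign in the direction of a coordinate:
   polynomial growth of the derivative against the Gaussian weight provides
   the integrable bound, uniformly for parameters in a unit segment. *)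
Lemma is_derive_pavg g P m y : tempered g -> admissible P ->
  is_derive y (delta_mx m 0) (pavg g P)
    (\sum_l pavg (partial l g) (fun z => P z * a m z l 0) y).
Proof.
move=> tg aP; have [sg _] := tg.
pose F t := pavg g P (y + t *: delta_mx m 0).
pose f (t : R) (w : n.-tuple mR) :=
  g (aff y (col_of_tuple w) + t *: a m (col_of_tuple w)) * P (col_of_tuple w)
  * gweight (col_of_tuple w).
pose df (t : R) z := (\sum_l partial l g (aff y z + t *: a m z) * (P z * a m z l 0)).
have FE : F = fun t => \int[lebesgueRn n]_w f t w.
  by apply/funext => t; apply: eq_Rintegral => w _; rewrite aff_line.
have fd (t : R) w : is_derive t 1 (f ^~ w) (df t (col_of_tuple w) * gweight (col_of_tuple w)).
  set z := col_of_tuple w.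
  have dl : is_derive t 1 (fun t => aff y z + t *: a m z) (a m z).
    apply: (@is_derive_line R _ _ id (aff y z) (a m z) t); exact: is_derive_id.
  have dg := is_derive_C1_comp dl (smooth_C1 sg).
  have := is_deriveZ (P z * gweight z) dg.
  rewrite (_ : _ \*: _ = f ^~ w); last first.
    by apply/funext => u; rewrite /f /= -/z -[_ *: _]/(_ * _) mulrC mulrA.
  rewrite [X in is_derive _ _ _ X](_ : _ = df t z * gweight z)//.
  rewrite -[LHS]/(_ * _) [LHS]mulrC mulrCA mulrA; congr (_ * _).
  rewrite /df mulrC mulr_suml; apply: eq_bigr => l _.
  by rewrite [a m z l 0 * _]mulrC -mulrA [_ * P z]mulrC.
have rho_bound (t : R) z : `|t| <= 1 ->
    `|aff y z + t *: a m z| <= (N%:R * Ca * `|y| + Ca) * (1 + `|z|).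
  move=> t1; rewrite (le_trans (ler_normD _ _))// mulrDl lerD ?aff_bound//.
  by rewrite normrZ (le_trans _ (a_bound m z))// ler_piMl.
have c0 : 0 <= N%:R * Ca * `|y| + Ca by rewrite addr_ge0// !mulr_ge0.
have /all_sig[Ck CkP] : forall l : 'I_d, {Ck : R * nat | 0 <= Ck.1 /\
    forall (x : 'cV[R]_d) (z : 'cV[R]_n),
    `|x| <= (N%:R * Ca * `|y| + Ca) * (1 + `|z|) ->
    `|partial l g x| <= Ck.1 * (1 + `|z|) ^+ Ck.2}.
  move=> l; apply: cid.
  have [C [k H]] := @pgrowth_comp R n d (partial l g) _ c0
    (tempered_growth (tempered_partial l tg)).
  by exists (C, k).
pose Gz z := \sum_l (Ck l).1 * (1 + `|z|) ^+ (Ck l).2 * `|P z * a m z l 0|.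
have aG : admissible Gz.
  apply: admissible_sum => l; apply: admissibleM.
    by apply: admissibleM; [exact: admissible_cst|exact: admissible_pow].
  by apply: admissible_norm; apply: admissibleM.
have G0 z : 0 <= Gz z.
  apply: sumr_ge0 => l _; rewrite !mulr_ge0 ?exprn_ge0 ?addr_ge0//.
  by have [] := CkP l.
have dfG (t : R) z : `|t| <= 1 -> `|df t z| <= Gz z.
  move=> t1; rewrite (le_trans (ler_norm_sum _ _ _))//; apply: ler_sum => l _.
  rewrite normrM ler_wpM2r//; have [_ H] := CkP l; apply: H.
  exact: rho_bound.
have int_f (t : R) : `]-1, 1[%classic t -> (lebesgueRn n).-integrable setT (EFin \o f t).
  move=> _; have := @gexp_integrable R n (fun z => g (aff (y + t *: delta_mx m 0) z) * P z).
  rewrite (_ : (fun w => _) = f t); last by apply/funext => w; rewrite aff_line.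
  apply; apply: admissibleM => //; apply: comp_aff_admissible.
    exact: smooth_continuous.
  exact: tempered_growth.
have der_f (t : R) w : `]-1, 1[%classic t -> setT w -> derivable (f ^~ w) t 1.
  by move=> _ _; case: (fd t w).
have ub_f (t : R) w : `]-1, 1[%classic t -> setT w ->
    `|partial1of2 f t w| <= Gz (col_of_tuple w) * gweight (col_of_tuple w).
  move=> /=; rewrite in_itv/= => /andP[t0 t1] _.
  rewrite partial1of2E; have [_ ->] := fd t w.
  rewrite normrM (ger0_norm (gweight_ge0 _)) ler_wpM2r ?gweight_ge0// dfG//.
  by rewrite ler_norml !ltW.
have I0 : `]-1, 1[%classic (0 : R) by rewrite /= in_itv/= oppr_lt0 ltr01.
have G0' (w : n.-tuple mR) : 0 <= Gz (col_of_tuple w) * gweight (col_of_tuple w).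
  by rewrite mulr_ge0// gweight_ge0.
have D1 := @derivable_under_integral R _ _ (lebesgueRn n) f setT measurableT
  0 (-1) 1 I0 int_f der_f _ G0' (gexp_integrable aG) ub_f.
have D2 := @differentiation_under_integral R _ _ (lebesgueRn n) f setT measurableT
  0 (-1) 1 I0 int_f der_f _ G0' (gexp_integrable aG) ub_f.
rewrite -[y]addr0 -(scale0r (delta_mx m 0)); apply/is_derive_lineP.
rewrite -/F FE; split; first exact: D1.
rewrite -derive1E D2 scale0r addr0.
rewrite -gexp_sum; last first.
  move=> l; apply: admissibleM; last exact: admissibleM.
  apply: comp_aff_admissible; last exact: tempered_growth (tempered_partial l tg).
  exact: smooth_continuous (smooth_partial l sg).
apply: eq_Rintegral => w _; rewrite partial1of2E; have [_ ->] := fd 0 w.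
by rewrite /df scale0r addr0.
Qed.

(** Finite sums of such averages are closed under partial derivatives, and being
   locally bounded together with their derivatives they are continuous. *)
Lemma smooth_pavg g P : tempered g -> admissible P -> smooth (pavg g P).
Proof.
move=> tg aP.
pose Q (F : 'cV[R]_N -> R) := exists (I : finType) (G : I -> 'cV[R]_d -> R)
  (S : I -> 'cV[R]_n -> R), (forall i, tempered (G i) /\ admissible (S i)) /\
  F = fun y => \sum_i pavg (G i) (S i) y.
have Qd F j : Q F -> exists dF, Q dF /\ forall x, is_derive x (delta_mx j 0) F (dF x).
  move=> [I [G [S [GS ->]]]].
  exists (fun y => \sum_(il : I * 'I_d)
    pavg (partial il.2 (G il.1)) (fun z => S il.1 z * a j z il.2 0) y); split.
    exists (I * 'I_d)%type, (fun il => partial il.2 (G il.1)),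
      (fun il z => S il.1 z * a j z il.2 0); split=> // -[i l]/=.
    have [tG aS] := GS i; split; first exact: tempered_partial.
    exact: admissibleM.
  move=> y; rewrite -(pair_bigA _ (fun i l => pavg (partial l (G i))
    (fun z => S i z * a j z l 0) y))/=.
  suff H (s : seq I) : is_derive y (delta_mx j 0) (fun y => \sum_(i <- s) pavg (G i) (S i) y)
      (\sum_(i <- s) \sum_l pavg (partial l (G i)) (fun z => S i z * a j z l 0) y).
    exact: H.
  elim: s => [|i s IH].
    under eq_fun do rewrite big_nil; rewrite big_nil; exact: is_derive_cst.
  under eq_fun do rewrite big_cons; rewrite big_cons; apply: is_deriveD => //.
  by have [tG aS] := GS i; exact: is_derive_pavg.
have Qb F rho : Q F -> exists M, forall y, `|y| <= rho -> `|F y| <= M.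
  move=> [I [G [S [GS ->]]]].
  have /all_sig[M MP] : forall i, {M | forall y, `|y| <= rho -> `|pavg (G i) (S i) y| <= M}.
    move=> i; apply: cid; have [tG aS] := GS i; apply: pavg_locally_bounded => //.
      by apply: smooth_continuous; case: tG.
    exact: tempered_growth.
  exists (\sum_i M i) => y yr; rewrite (le_trans (ler_norm_sum _ _ _))//.
  by apply: ler_sum => i _; exact: MP.
apply: (@smooth_coind R N Q); last first.
  exists unit, (fun=> g), (fun=> P); split=> //.
  by apply/funext => y; rewrite big_const card_unit/= addr0.
move=> F QF; split; last by move=> j; exact: Qd.
apply: partially_derivable_continuous.
  by move=> j x; have [dF [_ /(_ x)[]]] := Qd F j QF.
move=> rho; have /all_sig[M MP] : forall j, {M | forall y, `|y| <= rho -> `|partial j F y| <= M}.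
  move=> j; apply: cid; have [dF [QdF dFE]] := Qd F j QF.
  have -> : partial j F = dF by apply/funext => y; case: (dFE y).
  exact: Qb.
have [M' _ MM'] := fin_upper_bound M.
by exists M' => k z zr; exact: le_trans (MP k z zr) (MM' k).
Qed.

End ParameterIntegrals.

(** * Averaged potentials *)

Section AveragedPotentials.
Context {R : realType} {d : nat}.
Local Notation D := (dimD d).

Definition avg_point (q : 'cV[R]_D) (z : 'cV[R]_(d + d)) : 'cV[R]_d :=
  q0_of q + X1_of q *m usubmx z + X2_of q *m dsubmx z.

Lemma unvec_entry (v : 'cV[R]_(d * d)) i j : unvec v i j = v (mxvec_index j i) 0.
Proof. by rewrite !mxE. Qed.

Lemma vec_entry (X : 'M[R]_d) i j : vec X (mxvec_index j i) 0 = X i j.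
Proof. by rewrite mxE mxvecE mxE. Qed.

Lemma avg_point_is_linear z : linear (avg_point ^~ z).
Proof.
move=> c u v; rewrite /avg_point.
have -> : q0_of (c *: u + v) = c *: q0_of u + q0_of v.
  by apply/matrixP => i j; rewrite !mxE.
have -> : X1_of (c *: u + v) = c *: X1_of u + X1_of v.
  by apply/matrixP => i j; rewrite !(mxE, unvec_entry).
have -> : X2_of (c *: u + v) = c *: X2_of u + X2_of v.
  by apply/matrixP => i j; rewrite !(mxE, unvec_entry).
rewrite !mulmxDl -!scalemxAl !scalerDr.
by rewrite [X in X + _ = _]addrACA [LHS]addrACA.
Qed.

Definition avg_dir (m : 'I_D) (z : 'cV[R]_(d + d)) : 'cV[R]_d :=
  avg_point (delta_mx m 0) z.

Lemma avg_point_aff q z : avg_point q z = aff avg_dir q z.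
Proof.
pose L := GRing.isLinear.Build _ _ _ _ (avg_point ^~ z) (avg_point_is_linear z).
pose F : {linear 'cV[R]_D -> 'cV[R]_d} := HB.pack (avg_point ^~ z) L.
rewrite -[LHS]/(F q) {1}[q]cv_split linear_sum.
by apply: eq_bigr => m _; rewrite linearZ.
Qed.

Lemma avg_dir_admissible m l : admissible (fun z => avg_dir m z l 0).
Proof.
have aM (M : 'M[R]_d) (f : 'I_d -> 'I_(d + d)) :
    admissible (fun z : 'cV[R]_(d + d) => \sum_k M l k * z (f k) 0).
  apply: admissible_sum => k; apply: admissibleM; first exact: admissible_cst.
  exact: admissible_coord.
rewrite (_ : (fun z => _) = fun z : 'cV[R]_(d + d) => q0_of (delta_mx m 0) l 0
  + \sum_k X1_of (delta_mx m 0) l k * z (lshift d k) 0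
  + \sum_k X2_of (delta_mx m 0) l k * z (rshift d k) 0).
  by apply: admissibleD => //; apply: admissibleD => //; exact: admissible_cst.
apply/funext => z; rewrite /avg_dir /avg_point.
rewrite [LHS]mxE [X in X + _ = _]mxE; congr (_ + _ + _); rewrite mxE.
  by apply: eq_bigr => k _; rewrite [usubmx _ _ _]mxE.
by apply: eq_bigr => k _; rewrite [dsubmx _ _ _]mxE.
Qed.

Lemma avg_dir_bound m z : `|avg_dir m z| <= (1 + 2 * d%:R) * (1 + `|z|).
Proof.
have n0 : `|q0_of (delta_mx m 0 : 'cV[R]_D)| <= 1.
  by apply: cvnorm_le => // l; rewrite mxE; exact: le_trans (mxnorm_entry _ _ _) (delta_norm m).
have n1 : `|X1_of (delta_mx m 0 : 'cV[R]_D)| <= 1.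
  apply: mxnorm_le => // i j; rewrite unvec_entry !mxE.
  by case: (_ && _); rewrite ?normr1 ?normr0.
have n2 : `|X2_of (delta_mx m 0 : 'cV[R]_D)| <= 1.
  apply: mxnorm_le => // i j; rewrite unvec_entry !mxE.
  by case: (_ && _); rewrite ?normr1 ?normr0.
have prod (M : 'M[R]_d) (v : 'cV[R]_d) : `|M| <= 1 -> `|v| <= `|z| ->
    `|M *m v| <= d%:R * `|z|.
  move=> M1 vz; rewrite (le_trans (mxnormM _ _))// ler_wpM2l//.
  by rewrite -[leRHS]mul1r ler_pM.
rewrite (le_trans (ler_normD _ _))//.
apply: (@le_trans _ _ (1 + d%:R * `|z| + d%:R * `|z|)).
  rewrite lerD ?prod ?dsubmx_norm// (le_trans (ler_normD _ _))//.
  by rewrite lerD ?prod ?usubmx_norm.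
have := normr_ge0 z; have : 0 <= d%:R :> R by [].
move: (`|z|) (d%:R : R) => x y; nra.
Qed.

Let Ca : R := 1 + 2 * d%:R.
Let Ca_ge0 : 0 <= Ca. Proof. by rewrite addr_ge0// mulr_ge0. Qed.

Lemma avg_pavg (f : 'cV[R]_d -> R) q :
  avg f q = (2 * pi) ^- d * pavg avg_dir f (fun=> 1) q.
Proof.
congr (_ * _); apply: eq_Rintegral => z _ /=.
rewrite mulr1 -avg_point_aff /gweight; congr (_ * expR (- (_ * _))).
rewrite /sqnorm /dot big_split_ord/=.
by congr (_ + _); apply: eq_bigr => i _; rewrite !mxE.
Qed.

Section vector_potential.
Variable A : 'cV[R]_d -> 'cV[R]_d.
Hypothesis smoothA : smooth_vec A.
Hypothesis bndA : forall i, bounded_partials 1 (fun x => A x i 0).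

Lemma component_tempered i : tempered (fun x => A x i 0).
Proof. exact: bounded_partials_tempered (smoothA i) (bndA i). Qed.

(** By Stein's identity the averages of [J_A X_1] and [J_A X_2] are averages
   of [A] against coordinates of the Gaussian variable; this removes the
   factors [X_1] and [X_2], which are not bounded. *)
Lemma avg_Jac_mul b (f : 'I_d -> 'I_(d + d)) (X : 'M[R]_d) (q : 'cV[R]_D) i :
  (forall z t, avg_point q (z + t *: delta_mx (f b) 0)
     = avg_point q z + t *: col b X) ->
  (avg_mx (Jac A) q *m X) i b =
  (2 * pi) ^- d * pavg avg_dir (fun x => A x i 0) (fun z => z (f b) 0) q.
Proof.
move=> line; have tA := component_tempered i; have [sA _] := tA.
have acomp g : smooth g -> pgrowth g ->
    admissible (fun z => g (aff avg_dir q z)).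
  move=> sg pg; apply: (comp_aff_admissible avg_dir_admissible Ca_ge0 avg_dir_bound) => //.
  exact: smooth_continuous.
pose F z := A (aff avg_dir q z) i 0.
have dF z : is_derive z (delta_mx (f b) 0) F
    (\sum_j X j b * partial j (fun x => A x i 0) (aff avg_dir q z)).
  rewrite -[z]addr0 -(scale0r (delta_mx (f b) 0)); apply/is_derive_lineP.
  rewrite scale0r addr0 /F.
  have E : (fun t : R => A (aff avg_dir q (z + t *: delta_mx (f b) 0)) i 0)
      = fun t => A (aff avg_dir q z + t *: col b X) i 0.
    by apply/funext => t; rewrite -!avg_point_aff line.
  rewrite E.
  have dl : is_derive (0 : R) 1 (fun t => aff avg_dir q z + t *: col b X) (col b X).
    by apply: (@is_derive_line R _ _ id (aff avg_dir q z) (col b X) 0); exact: is_derive_id.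
  have := is_derive_C1_comp dl (smooth_C1 sA); rewrite /= scale0r addr0.
  by under eq_bigr do rewrite mxE.
have pF : partial (f b) F = fun z => \sum_j X j b * partial j (fun x => A x i 0) (aff avg_dir q z).
  by apply/funext => z; case: (dF z).
have aj j : admissible (fun z => X j b * partial j (fun x => A x i 0) (aff avg_dir q z)).
  apply: admissibleM; first exact: admissible_cst.
  apply: acomp; first exact: smooth_partial.
  exact: tempered_growth (tempered_partial j tA).
have := @gexp_stein R _ (f b) F.
rewrite pF => stein.
transitivity ((2 * pi) ^- d * gexp (fun z => F z * z (f b) 0)); last by [].
rewrite -stein.
- rewrite gexp_sum// mulr_sumr mxE; apply: eq_bigr => j _.
  have JE : (fun x => Jac A x i j) = partial j (fun x => A x i 0).
    by apply/funext => x; rewrite mxE.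
  rewrite mxE JE avg_pavg mulrC mulrCA; congr (_ * _).
  rewrite -gexpZ; last first.
    apply: admissibleM; last exact: admissible_cst.
    apply: acomp; first exact: smooth_partial.
    exact: tempered_growth (tempered_partial j tA).
  by apply: eq_Rintegral => z _; rewrite mulr1.
- exact: acomp (tempered_growth tA).
- by move=> z; case: (dF z).
- exact: admissible_sum.
Qed.

(** The first [d] components are averages of [A] by definition, with [P = 1];
   for the others [avg_Jac_mul] makes [P] a coordinate of the Gaussian
   variable. *)
Lemma Abf_pavg (i : 'I_D) : exists (l : 'I_d) (P : 'cV[R]_(d + d) -> R),
  admissible P /\ forall q, Abf A q i 0 =
    (2 * pi) ^- d * pavg avg_dir (fun x => A x l 0) P q.
Proof.
have usubD (u v : 'cV[R]_(d + d)) (t : R) :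
    usubmx (u + t *: v) = usubmx u + t *: usubmx v.
  by rewrite linearD linearZ.
have dsubD (u v : 'cV[R]_(d + d)) (t : R) :
    dsubmx (u + t *: v) = dsubmx u + t *: dsubmx v.
  by rewrite linearD linearZ.
have line_u q z t b : avg_point q (z + t *: delta_mx (lshift d b) 0)
    = avg_point q z + t *: col b (X1_of q).
  rewrite /avg_point usubD dsubD.
  rewrite usubmx_lshift dsubmx_lshift.
  by rewrite scaler0 addr0 mulmxDr -scalemxAr -colE addrA [in RHS]addrAC.
have line_d q z t b : avg_point q (z + t *: delta_mx (rshift d b) 0)
    = avg_point q z + t *: col b (X2_of q).
  rewrite /avg_point usubD dsubD.
  rewrite usubmx_rshift dsubmx_rshift.
  by rewrite scaler0 addr0 mulmxDr -scalemxAr -colE addrA.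
case: (split_ordP i) => [i1|i2] ->.
  exists i1, (fun=> 1); split; first exact: admissible_cst.
  by move=> q; rewrite /Abf col_mxEu mxE avg_pavg.
case: (split_ordP i2) => [k|k] ->; case/mxvec_indexP: k => b l.
  exists l, (fun z => z (lshift d b) 0); split; first exact: admissible_coord.
  move=> q; rewrite /Abf col_mxEd col_mxEu vec_entry.
  by apply: avg_Jac_mul => z t; exact: line_u.
exists l, (fun z => z (rshift d b) 0); split; first exact: admissible_coord.
move=> q; rewrite /Abf col_mxEd col_mxEd vec_entry.
by apply: avg_Jac_mul => z t; exact: line_d.
Qed.

Lemma smooth_Abf : smooth_vec (Abf A).
Proof.
move=> i; have [l [P [aP AE]]] := Abf_pavg i.
rewrite (_ : (fun q => _) = fun q => (2 * pi) ^- d * pavg avg_dir (fun x => A x l 0) P q).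
  apply: smoothM; first exact: smooth_cst.
  apply: (smooth_pavg avg_dir_admissible Ca_ge0 avg_dir_bound) => //.
  exact: component_tempered.
by apply/funext => q; rewrite AE.
Qed.

Lemma Jac_Abf_bounded : exists2 C : R, 0 <= C & forall q, `|Jac (Abf A) q| <= C.
Proof.
suff /all_sig[C CP] : forall ij : 'I_D * 'I_D, {C | forall q, `|Jac (Abf A) q ij.1 ij.2| <= C}.
  have [M M0 MP] := fin_upper_bound C; exists M => // q.
  by apply: mxnorm_le => // i j; exact: le_trans (CP (i, j) q) (MP (i, j)).
move=> [i j]; apply: cid => /=; have [l [P [aP AE]]] := Abf_pavg i.
have tA := component_tempered l; have [sA _] := tA.
pose c : R := (2 * pi) ^- d.
have JE q : Jac (Abf A) q i j = c * \sum_k pavg avg_dir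
    (partial k (fun x => A x l 0)) (fun z => P z * avg_dir j z k 0) q.
  rewrite mxE; rewrite (_ : (fun q => _) = fun q => c * pavg avg_dir (fun x => A x l 0) P q); last first.
    by apply/funext => y; rewrite AE.
  have dp := is_derive_pavg avg_dir_admissible Ca_ge0 avg_dir_bound j q tA aP.
  by have [_] := is_deriveZ c dp.
have aPk k : admissible (fun z => P z * avg_dir j z k 0).
  by apply: admissibleM => //; exact: avg_dir_admissible.
have /all_sig[B BP] : forall k, {B | forall x, `|partial k (fun x => A x l 0) x| <= B}.
  by move=> k; apply: cid; have /(_ [:: k] isT)[C CP] := bndA l; exists C.
exists (`|c| * \sum_k B k * gexp (fun z => `|P z * avg_dir j z k 0|)) => q.
rewrite JE normrM ler_wpM2l// (le_trans (ler_norm_sum _ _ _))//.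
apply: ler_sum => k _.
apply: (pavg_bounded avg_dir_admissible Ca_ge0 avg_dir_bound) => //.
exact: smooth_continuous (smooth_partial k sA).
Qed.

Section scalar_potential.
Variable V : 'cV[R]_d -> R.
Hypothesis smoothV : smooth V.
Hypothesis bndV : bounded_partials 2 (fun x => V x + 2^-1 * sqnorm (A x)).

Let W x := V x + 2^-1 * sqnorm (A x).

Lemma smooth_sqnorm_comp n m (f : 'cV[R]_n -> 'cV[R]_m) : smooth_vec f ->
  smooth (fun x => sqnorm (f x)).
Proof. by move=> sf; apply: smooth_sum => i; exact: smoothM (sf i) (sf i). Qed.

Let smoothW : smooth W.
Proof.
apply: smoothD => //; apply: smoothM; first exact: smooth_cst.
exact: smooth_sqnorm_comp.
Qed.

Let temperedW : tempered W.
Proof. exact: bounded_partials_tempered bndV. Qed.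

(** Second derivatives are bounded for the sum [W] of both potentials; its two
   terms are integrable since [A] and [W], hence also [V], grow at most
   polynomially. *)
Lemma Vbf_pavg q : Vbf A V q = (2 * pi) ^- d * pavg avg_dir W (fun=> 1) q.
Proof.
have pA2 : pgrowth (fun x => sqnorm (A x)).
  apply: pgrowth_sum => i; apply: pgrowthM;
  exact: tempered_growth (component_tempered i).
have pV : pgrowth V.
  have -> : V = fun x => W x + (- 2^-1) * sqnorm (A x).
    by apply/funext => x; rewrite /W mulNr addrK.
  apply: pgrowthD; first exact: tempered_growth.
  by apply: pgrowthM => //; exact: pgrowth_cst.
have acomp g : smooth g -> pgrowth g ->
    admissible (fun z => g (aff avg_dir q z) * 1).
  move=> sg pg; apply: admissibleM; last exact: admissible_cst.
  apply: (comp_aff_admissible avg_dir_admissible Ca_ge0 avg_dir_bound) => //.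
  exact: smooth_continuous.
rewrite /Vbf !avg_pavg mulrCA -mulrDr addrC; congr (_ * _).
have a1 := acomp _ smoothV pV; have a2 := acomp _ (smooth_sqnorm_comp smoothA) pA2.
rewrite -gexpZ// -gexpD//; last first.
  by apply: admissibleM => //; exact: admissible_cst.
by apply: eq_Rintegral => z _; rewrite /W !mulr1.
Qed.

Lemma smooth_Vbf : smooth (Vbf A V).
Proof.
rewrite (_ : Vbf A V = fun q => (2 * pi) ^- d * pavg avg_dir W (fun=> 1) q).
  apply: smoothM; first exact: smooth_cst.
  apply: (smooth_pavg avg_dir_admissible Ca_ge0 avg_dir_bound) => //.
  exact: admissible_cst.
by apply/funext => q; exact: Vbf_pavg.
Qed.

Lemma Hessian_Vbf_bounded : exists C : R, forall i j q,
  `|partial j (partial i (Vbf A V)) q| <= C.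
Proof.
suff /all_sig[C CP] : forall ij : 'I_D * 'I_D,
    {C | forall q, `|partial ij.2 (partial ij.1 (Vbf A V)) q| <= C}.
  have [M M0 MP] := fin_upper_bound C; exists M => i j q.
  exact: le_trans (CP (i, j) q) (MP (i, j)).
move=> [i j]; apply: cid => /=.
pose c : R := (2 * pi) ^- d.
have VE : Vbf A V = fun q => c * pavg avg_dir W (fun=> 1) q.
  by apply/funext => q; exact: Vbf_pavg.
have p1 : partial i (Vbf A V) = fun q => c * \sum_k pavg avg_dir
    (partial k W) (fun z => 1 * avg_dir i z k 0) q.
  rewrite VE; apply/funext => q.
  have dp := is_derive_pavg avg_dir_admissible Ca_ge0 avg_dir_bound i q temperedW
    (admissible_cst _ 1).
  by have [_] := is_deriveZ c dp.
have aPk k : admissible (fun z => 1 * avg_dir i z k 0).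
  by apply: admissibleM; [exact: admissible_cst|exact: avg_dir_admissible].
have aPkl k l : admissible (fun z => 1 * avg_dir i z k 0 * avg_dir j z l 0).
  by apply: admissibleM => //; exact: avg_dir_admissible.
have p2 q : partial j (partial i (Vbf A V)) q = c * \sum_k \sum_l pavg avg_dir
    (partial l (partial k W)) (fun z => 1 * avg_dir i z k 0 * avg_dir j z l 0) q.
  rewrite p1.
  have dp (s : seq 'I_d) : is_derive q (delta_mx j 0)
      (fun q => \sum_(k <- s) pavg avg_dir (partial k W) (fun z => 1 * avg_dir i z k 0) q)
      (\sum_(k <- s) \sum_l pavg avg_dir (partial l (partial k W))
         (fun z => 1 * avg_dir i z k 0 * avg_dir j z l 0) q).
    elim: s => [|k s IH].
      by under eq_fun do rewrite big_nil; rewrite big_nil; exact: is_derive_cst.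
    under eq_fun do rewrite big_cons; rewrite big_cons; apply: is_deriveD => //.
    apply: (is_derive_pavg avg_dir_admissible Ca_ge0 avg_dir_bound).
      exact: tempered_partial.
    exact: aPk.
  by have [_] := is_deriveZ c (dp (index_enum _)).
have /all_sig[B BP] : forall kl : 'I_d * 'I_d,
    {B | forall x, `|partial kl.2 (partial kl.1 W) x| <= B}.
  by move=> [k l]; apply: cid; have /(_ [:: l; k] isT)[C CP] := bndV; exists C.
exists (`|c| * \sum_k \sum_l B (k, l) *
  gexp (fun z => `|1 * avg_dir i z k 0 * avg_dir j z l 0|)) => q.
rewrite p2 normrM ler_wpM2l// (le_trans (ler_norm_sum _ _ _))//.
apply: ler_sum => k _; rewrite (le_trans (ler_norm_sum _ _ _))//.
apply: ler_sum => l _.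
apply: (pavg_bounded avg_dir_admissible Ca_ge0 avg_dir_bound) => //.
  exact: smooth_continuous (smooth_partial l (smooth_partial k smoothW)).
exact: BP (k, l).
Qed.

End scalar_potential.
End vector_potential.
End AveragedPotentials.

(** * Runge-Kutta stages and their tangent maps *)

Section TriangularFixpoint.
Context (T : Type) (s : nat) (op : ('I_s -> T) -> 'I_s -> T) (r : 'I_s -> nat).
Hypothesis r_lt : forall i, (r i < s)%N.
Hypothesis op_local : forall k k' i,
  (forall j, (r j < r i)%N -> k j = k' j) -> op k i = op k' i.

Lemma iter_local m k k' i : (r i < m)%N -> iter m op k i = iter m op k' i.
Proof.
elim: m i => // m IH i im; rewrite !iterS; apply: op_local => j ji.
by apply: IH; exact: leq_trans ji im.
Qed.

(** After [m] iterations the components of rank below [m] no longer depend on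
   the starting point. *)
Lemma iter_fixpoint k0 : op (iter s op k0) = iter s op k0.
Proof.
by apply/funext => i; rewrite -iterS iterSr; exact: iter_local (r_lt i).
Qed.

Lemma fixpoint_unique k0 k : op k = k -> k = iter s op k0.
Proof.
move=> kE; have iterE m : iter m op k = k by elim: m => //= m ->.
rewrite -[LHS](iterE s).
by apply/funext => i; exact: iter_local (r_lt i).
Qed.

End TriangularFixpoint.

Section NearIdentity.
Context {R : realType} {n : nat}.
Implicit Types E : 'M[R]_n.

Lemma near_id_expand E (v : 'cV[R]_n) : n%:R * `|E| <= 2^-1 ->
  `|v| <= 2 * `|(1%:M + E) *m v|.
Proof.
move=> E2; have vE : v = (1%:M + E) *m v - E *m v by rewrite mulmxDl mul1mx addrK.
have H1 : `|v| <= `|(1%:M + E) *m v| + `|E *m v| by rewrite {1}vE ler_normB.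
have H2 : `|E *m v| <= 2^-1 * `|v|.
  by rewrite (le_trans (mxnormM _ _))// mulrA ler_wpM2r.
lra.
Qed.

Lemma near_id_unit E : n%:R * `|E| <= 2^-1 -> 1%:M + E \in unitmx.
Proof.
move=> E2; rewrite -unitmx_tr -row_free_unit -kermx_eq0; apply/eqP/row_matrixP => i.
rewrite row0; set u := row i _.
have u0 : u *m (1%:M + E)^T = 0 by apply/sub_kermxP; exact: row_sub.
have v0 : (1%:M + E) *m u^T = 0 by rewrite -[_ *m _]trmxK trmx_mul trmxK u0 trmx0.
have := near_id_expand u^T E2; rewrite v0 normr0 mulr0 normr_le0 => /eqP ut.
by rewrite -[u]trmxK ut trmx0.
Qed.

End NearIdentity.

Section JacobianRules.
Context {R : realType}.

Lemma JacD n m (f g : 'cV[R]_n -> 'cV[R]_m) x : smooth_vec f -> smooth_vec g ->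
  Jac (fun y => f y + g y) x = Jac f x + Jac g x.
Proof.
move=> sf sg; apply/matrixP => i j; rewrite !mxE.
rewrite [fun y => (f y + g y) i 0](_ : _ = fun y => f y i 0 + g y i 0); last first.
  by apply/funext => y; rewrite mxE.
by have [_] := is_deriveD (is_derive_smooth j x (sf i)) (is_derive_smooth j x (sg i)).
Qed.

Lemma JacZ n m c (f : 'cV[R]_n -> 'cV[R]_m) x : smooth_vec f ->
  Jac (fun y => c *: f y) x = c *: Jac f x.
Proof.
move=> sf; apply/matrixP => i j; rewrite !mxE.
rewrite [fun y => (c *: f y) i 0](_ : _ = fun y => c * f y i 0); last first.
  by apply/funext => y; rewrite mxE.
by have [_] := is_deriveZ c (is_derive_smooth j x (sf i)).
Qed.

Lemma JacN n m (f : 'cV[R]_n -> 'cV[R]_m) x : smooth_vec f ->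
  Jac (fun y => - f y) x = - Jac f x.
Proof.
move=> sf; rewrite -scaleN1r -JacZ//; congr (Jac _ x).
by apply/funext => y; rewrite scaleN1r.
Qed.

Lemma Jac_cst n m (c : 'cV[R]_m) (x : 'cV[R]_n) : Jac (fun _ : 'cV[R]_n => c) x = 0.
Proof.
apply/matrixP => i j; rewrite !mxE.
by have [_] := is_derive_cst (c i 0) x (delta_mx j 0).
Qed.

Lemma Jac_sum n m (I : Type) (s : seq I) (P : pred I) (F : I -> 'cV[R]_n -> 'cV[R]_m) x :
  (forall i, smooth_vec (F i)) ->
  Jac (fun y => \sum_(i <- s | P i) F i y) x = \sum_(i <- s | P i) Jac (F i) x.
Proof.
move=> sF; elim: s => [|i s IH].
  by under eq_fun do rewrite big_nil; rewrite big_nil Jac_cst.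
rewrite big_cons -IH; case: ifP => Pi.
  rewrite -JacD//; last exact: smooth_vec_sum.
  by congr (Jac _ x); apply/funext => y; rewrite big_cons Pi.
by congr (Jac _ x); apply/funext => y; rewrite big_cons Pi.
Qed.

Lemma partial_coord n (i j : 'I_n) (x : 'cV[R]_n) :
  partial j (fun y => y i 0) x = (i == j)%:R.
Proof.
have [_] := is_derive_coord i (is_derive_id x (delta_mx j 0)).
by rewrite mxE eqxx andbT.
Qed.

Lemma Jac_id n (x : 'cV[R]_n) : Jac (fun y => y) x = 1%:M.
Proof. by apply/matrixP => i j; rewrite !mxE partial_coord. Qed.

End JacobianRules.

Section RungeKuttaStages.
Context {R : realType} {s : nat} (L : 'M[R]_s) (b : 'cV[R]_s).

Section stages.
Context {n : nat} (f : 'cV[R]_n -> 'cV[R]_n).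

Definition stage_op (tau : R) (y : 'cV[R]_n) (k : 'I_s -> 'cV[R]_n) (i : 'I_s) :=
  f (rk_node L tau y k i).

Definition stages (tau : R) (y : 'cV[R]_n) : 'I_s -> 'cV[R]_n :=
  iter s (stage_op tau y) (fun=> 0).

Let stage_local tau y k k' (i : 'I_s) :
  (forall j : 'I_s, (j < i)%N -> k j = k' j) -> stage_op tau y k i = stage_op tau y k' i.
Proof.
move=> kk'; rewrite /stage_op /rk_node; congr (f (_ + _ *: _)).
by apply: eq_bigr => j ji; rewrite kk'.
Qed.

Lemma stagesP tau y : rk_stages L f tau y (stages tau y).
Proof.
move=> i; rewrite -[RHS]/(stage_op tau y (stages tau y) i) /stages.
by rewrite (iter_fixpoint (r := @nat_of_ord s) (@ltn_ord s) (stage_local tau y)).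
Qed.

Lemma stages_unique tau y k : rk_stages L f tau y k -> k = stages tau y.
Proof.
move=> kE; apply: (fixpoint_unique (r := @nat_of_ord s) (@ltn_ord s) (stage_local tau y)).
by apply/funext => i; rewrite [RHS]kE.
Qed.

Definition rk_map (tau : R) (y : 'cV[R]_n) : 'cV[R]_n :=
  rk_update b tau y (stages tau y).

(** The stage equations differentiated with respect to the initial value. *)
Definition stage_jac_op (tau : R) (y : 'cV[R]_n) (K : 'I_s -> 'M[R]_n) (i : 'I_s) :=
  Jac f (rk_node L tau y (stages tau y) i) *m
    (1%:M + tau *: \sum_(j < s | (j < i)%N) L i j *: K j).

Definition stage_jac (tau : R) (y : 'cV[R]_n) : 'I_s -> 'M[R]_n :=
  iter s (stage_jac_op tau y) (fun=> 0).

Let stage_jac_local tau y k k' (i : 'I_s) :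
  (forall j : 'I_s, (j < i)%N -> k j = k' j) ->
  stage_jac_op tau y k i = stage_jac_op tau y k' i.
Proof.
move=> kk'; rewrite /stage_jac_op; congr (_ *m (_ + _ *: _)).
by apply: eq_bigr => j ji; rewrite kk'.
Qed.

Lemma stage_jacE tau y i :
  stage_jac tau y i = stage_jac_op tau y (stage_jac tau y) i.
Proof.
rewrite /stage_jac.
by rewrite (iter_fixpoint (r := @nat_of_ord s) (@ltn_ord s) (stage_jac_local tau y)).
Qed.

Definition rk_jac (tau : R) (y : 'cV[R]_n) : 'M[R]_n :=
  1%:M + tau *: \sum_i b i 0 *: stage_jac tau y i.

Hypothesis smoothf : smooth_vec f.

Lemma smooth_node tau (k : 'cV[R]_n -> 'I_s -> 'cV[R]_n) i :
  (forall j, smooth_vec (fun y => k y j)) ->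
  smooth_vec (fun y => rk_node L tau y (k y) i).
Proof.
move=> sk; apply: smooth_vecD; first exact: smooth_vec_id.
by apply: smooth_vecZ; apply: smooth_vec_sum => j; exact: smooth_vecZ.
Qed.

Lemma smooth_stages tau i : smooth_vec (fun y => stages tau y i).
Proof.
suff H m : forall i, smooth_vec (fun y => iter m (stage_op tau y) (fun=> 0) i).
  exact: H.
elim: m => [|m IH] {}i /=.
  by move=> j; under eq_fun do rewrite mxE; exact: smooth_cst.
apply: smooth_vec_comp => //.
exact: (@smooth_node tau (fun y => iter m (stage_op tau y) (fun=> 0))).
Qed.

Lemma smooth_rk_map tau : smooth_vec (rk_map tau).
Proof.
apply: smooth_vecD; first exact: smooth_vec_id.
apply: smooth_vecZ; apply: smooth_vec_sum => i; apply: smooth_vecZ.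
exact: smooth_stages.
Qed.

Lemma Jac_stages tau y i : Jac (fun y => stages tau y i) y = stage_jac tau y i.
Proof.
pose J i := Jac (fun y => stages tau y i) y.
suff -> : stage_jac tau y = J by [].
apply/esym; apply: (fixpoint_unique (r := @nat_of_ord s) (@ltn_ord s) (stage_jac_local tau y)).
apply/funext => {}i; rewrite /stage_jac_op /J.
have E : (fun y => stages tau y i) = fun y => f (rk_node L tau y (stages tau y) i).
  by apply/funext => z; exact: stagesP.
rewrite [in RHS]E.
rewrite [RHS](@Jac_comp R n n n f (fun y => rk_node L tau y (stages tau y) i) y smoothf);
  last by apply: (@smooth_node tau (stages tau)) => j; exact: smooth_stages.
congr (_ *m _).
have sL j : smooth_vec (fun y => L i j *: stages tau y j).
  by apply: smooth_vecZ; exact: smooth_stages.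
rewrite /rk_node JacD; [|exact: smooth_vec_id|by apply: smooth_vecZ; exact: smooth_vec_sum].
rewrite Jac_id JacZ ?Jac_sum//; last exact: smooth_vec_sum.
congr (_ + _ *: _); apply: eq_bigr => j _; rewrite JacZ//.
exact: smooth_stages.
Qed.

Lemma Jac_rk_map tau y : Jac (rk_map tau) y = rk_jac tau y.
Proof.
have sb j : smooth_vec (fun y => b j 0 *: stages tau y j).
  by apply: smooth_vecZ; exact: smooth_stages.
rewrite /rk_map /rk_update JacD; [|exact: smooth_vec_id|by apply: smooth_vecZ; exact: smooth_vec_sum].
rewrite Jac_id JacZ ?Jac_sum//; last exact: smooth_vec_sum.
congr (_ + _ *: _); apply: eq_bigr => j _; rewrite JacZ ?Jac_stages//.
exact: smooth_stages.
Qed.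

(** The derivatives of the stages are polynomials in the step size, the entries
   of [L] and values of [Jac f], hence bounded uniformly in the initial
   value. *)
Lemma rk_jac_near_id C : (forall y, `|Jac f y| <= C) ->
  exists tau0 : R, 0 < tau0 /\ forall tau y, `|tau| <= tau0 ->
    n%:R * `|rk_jac tau y - 1%:M| <= 2^-1.
Proof.
move=> fC.
have [B [B0 KB]] : exists B, 0 <= B /\ forall tau y i, `|tau| <= 1 -> `|stage_jac tau y i| <= B.
  suff H m : exists B, 0 <= B /\ forall tau y i, `|tau| <= 1 ->
      `|iter m (stage_jac_op tau y) (fun=> 0) i| <= B by exact: H.
  elim: m => [|m [B [B0 IH]]]; first by exists 0; split=> // tau y i _ /=; rewrite normr0.
  have C0 : 0 <= C by exact: le_trans (fC 0).
  have B'0 : 0 <= n%:R * (C * (1 + s%:R * (`|L| * B))) by rewrite !mulr_ge0// addr_ge0// !mulr_ge0.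
  exists (n%:R * (C * (1 + s%:R * (`|L| * B)))); split=> // tau y i tau1.
  rewrite iterS {1}/stage_jac_op (le_trans (mxnormM _ _))// ler_wpM2l// ler_pM//.
  rewrite (le_trans (ler_normD _ _))// lerD ?mxnorm1// normrZ.
  rewrite -[leRHS]mul1r ler_pM// (le_trans (ler_norm_sum _ _ _))//.
  apply: (@le_trans _ _ (\sum_(j < s) `|L| * B)); last by rewrite sumr_const card_ord mulr_natl.
  rewrite big_mkcond/=; apply: ler_sum => j _; case: ifP => _; last by rewrite mulr_ge0.
  by rewrite normrZ ler_pM ?mxnorm_entry ?IH.
pose c := n%:R * (s%:R * (`|b| * B)) + 1.
have c0 : 0 < c by rewrite ltr_wpDl// !mulr_ge0.
exists (Num.min 1 (2^-1 / c)); split; first by rewrite lt_min ltr01 divr_gt0.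
move=> tau y; rewrite le_min => /andP[tau1 tauc].
rewrite /rk_jac addrAC subrr add0r normrZ.
apply: (@le_trans _ _ (`|tau| * c)); last by rewrite -ler_pdivlMr.
rewrite mulrCA ler_wpM2l// /c -[leLHS]addr0 lerD// ler_wpM2l//.
rewrite (le_trans (ler_norm_sum _ _ _))//.
apply: (@le_trans _ _ (\sum_(j < s) `|b| * B)); last by rewrite sumr_const card_ord mulr_natl.
by apply: ler_sum => i _; rewrite normrZ ler_pM ?mxnorm_entry ?KB.
Qed.

End stages.

Section opposite.
Context {n : nat} (f : 'cV[R]_n -> 'cV[R]_n).

Lemma rk_node_opp tau y (k : 'I_s -> 'cV[R]_n) i :
  rk_node L (- tau) y (fun j => - k j) i = rk_node L tau y k i.
Proof.
rewrite /rk_node; congr (_ + _); rewrite scaleNr -scalerN -sumrN.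
by congr (_ *: _); apply: eq_bigr => j _; rewrite scalerN opprK.
Qed.

Lemma rk_stages_opp tau y k : rk_stages L f tau y k ->
  rk_stages L (fun x => - f x) (- tau) y (fun j => - k j).
Proof. by move=> kE i; rewrite rk_node_opp {1}kE. Qed.

Lemma rk_update_opp tau y (k : 'I_s -> 'cV[R]_n) :
  rk_update b (- tau) y (fun j => - k j) = rk_update b tau y k.
Proof.
rewrite /rk_update; congr (_ + _); rewrite scaleNr -scalerN -sumrN.
by congr (_ *: _); apply: eq_bigr => j _; rewrite scalerN opprK.
Qed.

End opposite.

Hypothesis L_explicit : explicit_tableau L.
Hypothesis b_neq0 : forall i, b i 0 != 0.

Lemma LhatE i j : Lhat L b i j = b j 0 - (b i 0)^-1 * (L j i * b j 0).
Proof.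
have inv_diag : invmx (diag_mx b^T) = diag_mx (\row_k (b k 0)^-1).
  have mulD : diag_mx b^T *m diag_mx (\row_k (b k 0)^-1) = 1%:M.
    rewrite mul_diag_mx; apply/matrixP => k l; rewrite !mxE.
    have [->|_] := eqVneq k l; last by rewrite !mulr0n mulr0.
    by rewrite !mulr1n mulfV.
  have [uD _] := mulmx1_unit mulD.
  by rewrite -[RHS]mul1mx -(mulVmx uD) -mulmxA mulD mulmx1.
have E1 : ((const_mx 1 : 'cV[R]_s) *m b^T) i j = b j 0.
  by rewrite mxE big_ord1 !mxE mul1r.
have E2 : (diag_mx (\row_k (b k 0)^-1) *m L^T *m diag_mx b^T) i j =
    (b i 0)^-1 * (L j i * b j 0).
  by rewrite mul_mx_diag mxE mul_diag_mx !mxE mulrA.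
by rewrite /Lhat inv_diag mxE E1 mxE E2.
Qed.

Lemma sum_explicit_mx n m (x : 'I_s -> 'M[R]_(n, m)) (i : 'I_s) :
  \sum_(j < s | (j < i)%N) L i j *: x j = \sum_j L i j *: x j.
Proof.
rewrite big_mkcond/=; apply: eq_bigr => j _; case: ifPn => //.
by rewrite -leqNgt => ij; rewrite (L_explicit ij) scale0r.
Qed.

Section momentum.
Context {n : nat} (M : 'I_s -> 'M[R]_n) (tau : R).

(** With the new momentum [P] in place of the old one, the momentum stages can
   be computed backwards: the tableau [Lhat] turns into a strictly upper
   triangular one. *)
Definition back_op (P : 'cV[R]_n) (l : 'I_s -> 'cV[R]_n) (i : 'I_s) : 'cV[R]_n :=
  M i *m (P - (tau / b i 0) *: \sum_(j < s) (b j 0 * L j i) *: l j).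

Definition back_stages (P : 'cV[R]_n) : 'I_s -> 'cV[R]_n :=
  iter s (back_op P) (fun=> 0).

Let rank (i : 'I_s) : nat := (s.-1 - i)%N.

Let rank_lt i : (rank i < s)%N.
Proof. by rewrite /rank; case: s i => [[]//|m] i; rewrite ltnS leq_subr. Qed.

Let back_local P k k' i :
  (forall j, (rank j < rank i)%N -> k j = k' j) -> back_op P k i = back_op P k' i.
Proof.
move=> kk'; rewrite /back_op; congr (_ *m (_ - _ *: _)).
apply: eq_bigr => j _; have [ij|ji] := ltnP i j.
  rewrite kk'// /rank ltn_sub2l//.
  by rewrite (leq_trans ij)// -ltnS (ltn_predK (ltn_ord i)).
by rewrite (L_explicit ji) mulr0 !scale0r.
Qed.

Lemma back_stagesP P : back_op P (back_stages P) = back_stages P.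
Proof. exact: (iter_fixpoint rank_lt (back_local P)). Qed.

Lemma back_stages_unique P l : back_op P l = l -> l = back_stages P.
Proof. exact: (fixpoint_unique rank_lt (back_local P)). Qed.

Lemma momentum_stagesP p l : momentum_stages L b M tau p l <->
  back_op (rk_update b tau p l) l = l.
Proof.
have E i : p + tau *: \sum_j Lhat L b i j *: l j =
    rk_update b tau p l - (tau / b i 0) *: \sum_(j < s) (b j 0 * L j i) *: l j.
  rewrite /rk_update -addrA; congr (_ + _).
  rewrite -scalerA -scalerBr; congr (_ *: _).
  rewrite scaler_sumr -sumrB; apply: eq_bigr => j _.
  by rewrite LhatE scalerBl scalerA [L j i * _]mulrC.
split=> [lE|lE i].
  by apply/funext => i; rewrite /back_op -E -lE.
by rewrite -{1}lE /back_op E.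
Qed.

(** Discrete conservation of the pairing of momenta with tangent vectors: the
   momentum update is the inverse transpose of the derivative of the position
   update. *)
Lemma back_stages_adjoint (K : 'I_s -> 'M[R]_n) P l :
  (forall i, K i = - (M i)^T *m
     (1%:M + tau *: \sum_(j < s | (j < i)%N) L i j *: K j)) ->
  back_op P l = l ->
  (1%:M + tau *: \sum_i b i 0 *: K i)^T *m P = P - tau *: \sum_i b i 0 *: l i.
Proof.
move=> KE lE.
have KtP i : b i 0 *: ((K i)^T *m P) + b i 0 *: l i =
    tau *: \sum_j (b j 0 * L j i) *: ((K i)^T *m l j)
    - tau *: \sum_j (b i 0 * L i j) *: ((K j)^T *m l i).
  pose Pi := P - (tau / b i 0) *: \sum_(j < s) (b j 0 * L j i) *: l j.
  have PE : P = Pi + (tau / b i 0) *: \sum_(j < s) (b j 0 * L j i) *: l j.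
    by rewrite subrK.
  have KPi : (K i)^T *m Pi = - l i - tau *: \sum_j L i j *: ((K j)^T *m l i).
    rewrite {1}KE trmx_mul linearN/= trmxK mulmxN mulNmx -mulmxA.
    have -> : M i *m Pi = l i by rewrite -[in RHS]lE.
    rewrite sum_explicit_mx linearD/= trmx1 mulmxDl mul1mx opprD; congr (_ - _).
    rewrite linearZ/= -scalemxAl linear_sum/= mulmx_suml; congr (_ *: _).
    by apply: eq_bigr => j _; rewrite linearZ/= -scalemxAl.
  rewrite {1}PE mulmxDr KPi -scalemxAr mulmx_sumr.
  rewrite -scalerDr addrAC [- l i - _ + _]addrAC addNr add0r addrC scalerBr.
  congr (_ + _).
    rewrite scalerA mulrCA mulfV// mulr1; congr (_ *: _).
    by apply: eq_bigr => j _; rewrite scalemxAr.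
  congr (- _); rewrite scalerA [b i 0 * tau]mulrC -scalerA; congr (_ *: _).
  rewrite scaler_sumr.
  by apply: eq_bigr => j _; rewrite scalerA.
rewrite linearD/= trmx1 mulmxDl mul1mx; congr (_ + _).
apply/eqP; rewrite -subr_eq0 opprK linearZ/= -scalemxAl linear_sum/= mulmx_suml.
rewrite -scalerDr -big_split/=.
rewrite (eq_bigr (fun i => b i 0 *: ((K i)^T *m P) + b i 0 *: l i)); last first.
  by move=> i _; rewrite linearZ/= -scalemxAl.
under eq_bigr do rewrite KtP.
rewrite sumrB -!scaler_sumr exchange_big/= subrr scaler0.
by [].
Qed.

End momentum.
End RungeKuttaStages.

(** * Symplectic maps *)

Section BlockJacobians.
Context {R : realType}.

Lemma is_derive_usubmx m p (z e : 'cV[R]_(m + p)) :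
  is_derive z e (fun z : 'cV[R]_(m + p) => usubmx z) (usubmx e).
Proof.
apply: is_derive_cv => i; rewrite mxE; under eq_fun do rewrite mxE.
exact: is_derive_coord (is_derive_id z e).
Qed.

Lemma is_derive_dsubmx m p (z e : 'cV[R]_(m + p)) :
  is_derive z e (fun z : 'cV[R]_(m + p) => dsubmx z) (dsubmx e).
Proof.
apply: is_derive_cv => i; rewrite mxE; under eq_fun do rewrite mxE.
exact: is_derive_coord (is_derive_id z e).
Qed.

Lemma sum_delta n (j : 'I_n) (F : 'I_n -> R) :
  \sum_k (delta_mx j 0 : 'cV[R]_n) k 0 * F k = F j.
Proof.
rewrite (bigD1 j)//= mxE !eqxx mul1r big1 ?addr0// => k /negbTE kj.
by rewrite mxE kj mul0r.
Qed.

Lemma dot_delta n (x : 'cV[R]_n) (j : 'I_n) : dot x (delta_mx j 0) = x j 0.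
Proof. by rewrite /dot; under eq_bigr do rewrite mulrC; rewrite sum_delta. Qed.

Lemma dot0r n (x : 'cV[R]_n) : dot x 0 = 0.
Proof. by rewrite /dot big1// => i _; rewrite mxE mulr0. Qed.

Lemma Jac_col_mx n m p (F : 'cV[R]_n -> 'cV[R]_m) (G : 'cV[R]_n -> 'cV[R]_p) z :
  Jac (fun z => col_mx (F z) (G z)) z = col_mx (Jac F z) (Jac G z).
Proof.
apply/matrixP => i j; rewrite [LHS]mxE; case: (split_ordP i) => k ->.
  rewrite col_mxEu mxE; congr (partial j _ z).
  by apply/funext => y; rewrite col_mxEu.
rewrite col_mxEd mxE; congr (partial j _ z).
by apply/funext => y; rewrite col_mxEd.
Qed.

Lemma Jac_usubmx m p (z : 'cV[R]_(m + p)) :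
  Jac (fun z : 'cV[R]_(m + p) => usubmx z) z = row_mx 1%:M 0.
Proof.
apply/matrixP => i j; rewrite [LHS]mxE.
rewrite /partial; have [_ ->] := is_derive_coord i (is_derive_usubmx z (delta_mx j 0)).
case: (split_ordP j) => k ->.
  by rewrite row_mxEl usubmx_lshift !mxE eqxx andbT.
by rewrite row_mxEr usubmx_rshift !mxE.
Qed.

Lemma Jac_dsubmx m p (z : 'cV[R]_(m + p)) :
  Jac (fun z : 'cV[R]_(m + p) => dsubmx z) z = row_mx 0 1%:M.
Proof.
apply/matrixP => i j; rewrite [LHS]mxE.
rewrite /partial; have [_ ->] := is_derive_coord i (is_derive_dsubmx z (delta_mx j 0)).
case: (split_ordP j) => k ->.
  by rewrite row_mxEl dsubmx_lshift !mxE.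
by rewrite row_mxEr dsubmx_rshift !mxE eqxx andbT.
Qed.

Lemma smooth_vec_usubmx m p : smooth_vec (fun z : 'cV[R]_(m + p) => usubmx z).
Proof. by apply: smooth_usubmx; exact: smooth_vec_id. Qed.

Lemma smooth_vec_dsubmx m p : smooth_vec (fun z : 'cV[R]_(m + p) => dsubmx z).
Proof. by apply: smooth_dsubmx; exact: smooth_vec_id. Qed.

End BlockJacobians.

Section Symplectic.
Context {R : realType} {m : nat}.
Implicit Types Phi Psi : 'cV[R]_(m + m) -> 'cV[R]_(m + m).

Lemma Omega_mul (g : 'cV[R]_(m + m)) :
  Omega *m g = col_mx (dsubmx g) (- usubmx g).
Proof.
by rewrite -{1}[g]vsubmxK mul_block_col !mul0mx mul1mx mulNmx mul1mx add0r addr0.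
Qed.

Lemma symplectic_block (A B C D : 'M[R]_m) :
  A^T *m C = C^T *m A -> B^T *m D = D^T *m B -> A^T *m D - C^T *m B = 1%:M ->
  (block_mx A B C D)^T *m Omega *m block_mx A B C D = Omega.
Proof.
move=> H1 H2 H3.
have H3' : B^T *m C - D^T *m A = - 1%:M.
  have := congr1 trmx H3; rewrite linearB/= !trmx_mul !trmxK trmx1 => <-.
  by rewrite opprB.
rewrite tr_block_mx /Omega !mulmx_block !mulmx0 !mulmx1 !mulmxN !mulmx1 !add0r !addr0.
rewrite !mulNmx H1 H2 addNr [- (C^T *m B) + _]addrC H3 [- (D^T *m A) + _]addrC H3'.
by rewrite addNr.
Qed.

Lemma symplectic_comp Phi Psi z : smooth_vec Phi -> smooth_vec Psi ->
  symplectic_at Psi z -> symplectic_at Phi (Psi z) ->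
  symplectic_at (fun z => Phi (Psi z)) z.
Proof.
move=> sPhi sPsi [_ H1] [_ H2]; split.
  by apply: smooth_vec_differentiable; exact: smooth_vec_comp.
rewrite Jac_comp// trmx_mul !mulmxA -[_ *m _ *m Omega]mulmxA -[_ *m _ *m Jac Phi _]mulmxA.
by rewrite H2 H1.
Qed.

Lemma symplectic_id z : symplectic_at (fun z : 'cV[R]_(m + m) => z) z.
Proof.
split; first by apply: smooth_vec_differentiable; exact: smooth_vec_id.
by rewrite Jac_id trmx1 mul1mx mulmx1.
Qed.

(** The momentum component [G] satisfies [J(q)^T G(q, p) = p] with [J] the
   Jacobian matrix of [psi]. Differentiating with respect to [q] shows that
   [J^T] times the derivative of [G] is minus the contraction of the second
   derivatives of [psi] with [G]; it is symmetric by equality of mixed partial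
   derivatives, and this is the one nontrivial block of the symplecticity
   condition. *)
Lemma symplectic_cotangent_lift (psi : 'cV[R]_m -> 'cV[R]_m) z :
  smooth_vec psi -> (forall q, Jac psi q \in unitmx) ->
  symplectic_at (fun z : 'cV[R]_(m + m) => col_mx (psi (usubmx z))
    ((invmx (Jac psi (usubmx z)))^T *m dsubmx z)) z.
Proof.
move=> spsi upsi.
pose G z : 'cV[R]_m := (invmx (Jac psi (usubmx z)))^T *m dsubmx (z : 'cV[R]_(m + m)).
have sq := @smooth_vec_usubmx R m m; have sp := @smooth_vec_dsubmx R m m.
have sJ : smooth_mx (fun z : 'cV[R]_(m + m) => Jac psi (usubmx z)).
  exact: smooth_mx_comp (smooth_Jac spsi) sq.
have sG : smooth_vec G.
  apply: smooth_mx_vec; apply: smooth_mulmx; last exact: smooth_vec_mx.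
  by apply: smooth_trmx; exact: smooth_invmx.
split.
  apply: smooth_vec_differentiable; apply: smooth_col_mx sG.
  exact: smooth_vec_comp spsi sq.
rewrite (Jac_col_mx (fun z => psi (usubmx z)) G) (Jac_comp _ spsi sq) Jac_usubmx.
have JG : Jac G z = row_mx (lsubmx (Jac G z)) (invmx (Jac psi (usubmx z)))^T.
  rewrite -[LHS]hsubmxK; congr row_mx; apply/matrixP => i j.
  rewrite mxE [LHS]mxE.
  have E : (fun t : R => G (z + t *: delta_mx (rshift m j) 0) i 0) =
      (fun t => G z i 0 + t * (invmx (Jac psi (usubmx z)))^T i j).
    apply/funext => t; rewrite /G linearD/= [usubmx (_ *: _)]linearZ/= usubmx_rshift.
    rewrite scaler0 addr0 [dsubmx (_ + _)]linearD/= [dsubmx (_ *: _)]linearZ/= dsubmx_rshift.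
    by rewrite mulmxDr -scalemxAr -colE mxE; congr (_ + _); rewrite !mxE.
  have d1 := is_derive_line (t := 0) (v := delta_mx (rshift m j) 0) (x := z)
    (is_derive_smooth (rshift m j) (z + 0 *: delta_mx (rshift m j) 0) (sG i)).
  have [_] := d1; rewrite E scale0r addr0 => <-.
  have dl : is_derive (0 : R) 1 (fun t : R => G z i 0 + t * (invmx (Jac psi (usubmx z)))^T i j)
    ((invmx (Jac psi (usubmx z)))^T i j).
    exact: (@is_derive_line R R R id (G z i 0) ((invmx (Jac psi (usubmx z)))^T i j) 0).
  by have [_] := dl.
rewrite JG mul_mx_row mulmx1 mulmx0 -block_mxEv.
set J := Jac psi (usubmx z); set S := lsubmx (Jac G z).
have uJ : J \in unitmx by exact: upsi.
apply: symplectic_block; last 2 first.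
- by rewrite trmx0 mul0mx mulmx0.
- by rewrite mulmx0 subr0 -trmx_mul mulVmx// trmx1.
suff JS i j : (J^T *m S) i j = - \sum_k partial j (partial i (fun q => psi q k 0)) (usubmx z) * G z k 0.
  have -> : S^T *m J = (J^T *m S)^T by rewrite trmx_mul trmxK.
  move: (J^T *m S) JS => W WE; apply/matrixP => i j; rewrite [RHS]mxE (WE i j) (WE j i).
  apply: (congr1 -%R); apply: eq_bigr => k _; apply: (congr1 (fun x => x * G z k 0)).
  exact: partial_comm (spsi k).
have JGp : (fun z : 'cV[R]_(m + m) => \sum_k partial i (fun q => psi q k 0) (usubmx z) * G z k 0)
    = fun z => z (rshift m i) 0.
  apply/funext => y; transitivity (((Jac psi (usubmx y))^T *m G y) i 0).
    by rewrite mxE; apply: eq_bigr => k _; rewrite !mxE.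
  by rewrite /G mulmxA -trmx_mul mulVmx// trmx1 mul1mx mxE.
have d0 : is_derive z (delta_mx (lshift m j) 0) (fun z : 'cV[R]_(m + m) => z (rshift m i) 0) 0.
  have := is_derive_coord (rshift m i) (is_derive_id z (delta_mx (lshift m j) 0)).
  by rewrite mxE eq_rlshift.
have dk k : is_derive z (delta_mx (lshift m j) 0)
    (fun z : 'cV[R]_(m + m) => partial i (fun q => psi q k 0) (usubmx z) * G z k 0)
    (partial j (partial i (fun q => psi q k 0)) (usubmx z) * G z k 0 + J k i * S k j).
  have dG : is_derive z (delta_mx (lshift m j) 0) (fun z => G z k 0) (S k j).
    by rewrite /S mxE mxE; exact: is_derive_smooth (sG k).
  have dpsi : is_derive z (delta_mx (lshift m j) 0)
      (fun z : 'cV[R]_(m + m) => partial i (fun q => psi q k 0) (usubmx z))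
      (partial j (partial i (fun q => psi q k 0)) (usubmx z)).
    have := is_derive_C1_comp (is_derive_usubmx z (delta_mx (lshift m j) 0))
       (smooth_C1 (smooth_partial i (spsi k))).
    by rewrite usubmx_lshift sum_delta.
  have := @is_deriveM _ _ (fun z : 'cV[R]_(m + m) => partial i (fun q => psi q k 0) (usubmx z))
    (fun z => G z k 0) z (delta_mx (lshift m j) 0) _ _ dpsi dG.
  rewrite [X in is_derive _ _ _ X](_ : _ = partial j (partial i (fun q => psi q k 0)) (usubmx z) * G z k 0 + J k i * S k j)//.
  have -> : J k i = partial i (fun q => psi q k 0) (usubmx z) by rewrite /J mxE.
  by rewrite addrC; apply: (congr2 +%R) => //; exact: mulrC.
have dsum : is_derive z (delta_mx (lshift m j) 0)
    (fun z : 'cV[R]_(m + m) => \sum_k partial i (fun q => psi q k 0) (usubmx z) * G z k 0)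
    (\sum_k (partial j (partial i (fun q => psi q k 0)) (usubmx z) * G z k 0 + J k i * S k j)).
  rewrite (_ : (fun z => _) = \sum_k (fun z : 'cV[R]_(m + m) =>
     partial i (fun q => psi q k 0) (usubmx z) * G z k 0)); last first.
    by apply/funext => y; rewrite fct_sumE.
  by apply: is_derive_sum => k; exact: dk.
have [_] := dsum; rewrite JGp; have [_ ->] := d0.
rewrite big_split/= => /esym/eqP; rewrite addr_eq0 => /eqP ->.
by rewrite opprK mxE; apply: eq_bigr => k _; rewrite mxE.
Qed.

End Symplectic.

(** * Flows of Hamiltonian fields *)

Section Flows.
Context {R : realType}.

(** Uniqueness of solutions determines the value chosen by [flow]. *)
Lemma flow_solution n (X : 'cV[R]_n -> 'cV[R]_n) u t :
  smooth_vec X -> linear_growth X -> is_solution X setT u ->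
  flow X t (u 0) = u t.
Proof.
move=> sX gX su; rewrite /flow; set P := [set z | _].
have Pu : P (u t) by exists u.
have [v [sv v0 vt]] : P (xget (u 0) P) by exact: xgetI Pu.
have [K K0 KP] := solutions_lipschitz (`|u 0|) (`|t|) sX gX.
apply/eqP; rewrite -subr_eq0 -normr_le0 -{1}vt.
have := KP v u sv su; rewrite v0 subrr normr0 mulr0; exact.
Qed.

Definition complete n (X : 'cV[R]_n -> 'cV[R]_n) : Prop :=
  forall z, exists2 u, is_solution X setT u & u 0 = z.

Lemma line_solution n (X : 'cV[R]_n -> 'cV[R]_n) z :
  (forall t, X (z + t *: X z) = X z) -> is_solution X setT (fun t => z + t *: X z).
Proof.
move=> Xc r _; rewrite Xc.
exact: (@is_derive_line R _ _ id z (X z) r (X z) (is_derive_id _ _)).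
Qed.

Lemma flow_line n (X : 'cV[R]_n -> 'cV[R]_n) z t :
  smooth_vec X -> linear_growth X -> (forall t, X (z + t *: X z) = X z) ->
  flow X t z = z + t *: X z.
Proof.
move=> sX gX /line_solution su.
by have := flow_solution t sX gX su; rewrite scale0r addr0.
Qed.

(** The value of [flow] is either that of a global solution, or the starting
   point itself. *)
Lemma flow_bounded n (X : 'cV[R]_n -> 'cV[R]_n) (rho T : R) : linear_growth X ->
  exists2 B, 0 <= B & forall t z, `|t| <= T -> `|z| <= rho -> `|flow X t z| <= B.
Proof.
move=> gX; have [B BP] := solutions_bounded rho T gX.
exists (Num.max 0 (Num.max rho B)); first by rewrite le_max lexx.
move=> t z tT zr; rewrite /flow; set P := [set y | _].
have [[y Py]|nP] := pselect (exists y, P y).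
  have [u [su u0 <-]] : P (xget z P) by exact: xgetI Py.
  by rewrite !le_max BP ?orbT// u0.
by rewrite xgetPN ?le_max ?zr ?orbT// => y Py; apply: nP; exists y.
Qed.

Lemma flow_lipschitz n (X : 'cV[R]_n -> 'cV[R]_n) (rho T : R) :
  smooth_vec X -> linear_growth X -> complete X ->
  exists2 K, 0 <= K & forall t x y, `|t| <= T -> `|x| <= rho -> `|y| <= rho ->
    `|flow X t x - flow X t y| <= K * `|x - y|.
Proof.
move=> sX gX cX; have [K K0 KP] := solutions_lipschitz rho T sX gX.
exists K => // t x y tT; have [u su <-] := cX x; have [v sv <-] := cX y => ur vr.
by rewrite !(flow_solution _ sX gX)//; exact: KP.
Qed.

Lemma bounded_Jac_lipschitz n m (f : 'cV[R]_n -> 'cV[R]_m) C : smooth_vec f ->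
  0 <= C -> (forall x, `|Jac f x| <= C) ->
  forall x y, `|f y - f x| <= n%:R * C * `|y - x|.
Proof.
move=> sf C0 fC x y; apply: cvnorm_le => [|i]; first by rewrite !mulr_ge0.
rewrite !mxE; apply: (@lipschitz_box R n (fun x => f x i 0) (Num.max `|x| `|y|)).
- exact: smooth_partially_derivable (sf i).
- move=> k z _; apply: le_trans (fC z).
  by have := mxnorm_entry (Jac f z) i k; rewrite mxE.
- by rewrite le_max lexx.
- by rewrite le_max lexx orbT.
Qed.

Lemma linear_growth_bounded_Jac n m (f : 'cV[R]_n -> 'cV[R]_m) C : smooth_vec f ->
  0 <= C -> (forall x, `|Jac f x| <= C) -> linear_growth f.
Proof.
move=> sf C0 fC; exists (`|f 0| + n%:R * C) => x.
have H := bounded_Jac_lipschitz sf C0 fC 0 x; rewrite subr0 in H.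
rewrite -[f x](subrK (f 0)) (le_trans (ler_normD _ _))//.
have := normr_ge0 (f 0); have := normr_ge0 x.
have : 0 <= n%:R * C by exact: mulr_ge0.
move: H; move: `|x| `|f 0| `|_ - _| (n%:R * C) => a c e k; nra.
Qed.

Lemma linear_growth_col_mx n m p (f : 'cV[R]_n -> 'cV[R]_m) (g : 'cV[R]_n -> 'cV[R]_p) :
  linear_growth f -> linear_growth g -> linear_growth (fun x => col_mx (f x) (g x)).
Proof.
move=> [a fa] [c gc]; exists (Num.max a c) => x.
rewrite (le_trans (col_mx_norm _ _))// ge_max.
have x0 : 0 <= 1 + `|x| by rewrite addr_ge0.
by apply/andP; split; [apply: le_trans (fa x) _|apply: le_trans (gc x) _];
  rewrite ler_wpM2r// le_max lexx ?orbT.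
Qed.

Lemma linear_growthD n m (f g : 'cV[R]_n -> 'cV[R]_m) :
  linear_growth f -> linear_growth g -> linear_growth (fun x => f x + g x).
Proof.
move=> [a fa] [c gc]; exists (a + c) => x.
by rewrite (le_trans (ler_normD _ _))// mulrDl lerD.
Qed.

Lemma linear_growthN n m (f : 'cV[R]_n -> 'cV[R]_m) :
  linear_growth f -> linear_growth (fun x => - f x).
Proof. by move=> [a fa]; exists a => x; rewrite normrN. Qed.

Lemma linear_growth_le n m k (f : 'cV[R]_n -> 'cV[R]_m) (g : 'cV[R]_n -> 'cV[R]_k) c :
  0 <= c -> linear_growth g -> (forall x, `|f x| <= c * `|g x|) -> linear_growth f.
Proof.
move=> c0 [a ga] fg; exists (c * a) => x.
by rewrite (le_trans (fg x))// -mulrA ler_wpM2l.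
Qed.

Lemma linear_growth_id n : linear_growth (fun x : 'cV[R]_n => x).
Proof. by exists 1 => x; rewrite mul1r lerDr. Qed.

Lemma linear_growth_comp n m p (f : 'cV[R]_m -> 'cV[R]_p) (g : 'cV[R]_n -> 'cV[R]_m) :
  linear_growth f -> (forall x, `|g x| <= `|x|) -> linear_growth (fun x => f (g x)).
Proof.
move=> [a fa] gx; exists (Num.max 0 a) => x; rewrite (le_trans (fa _))//.
apply: (@le_trans _ _ (Num.max 0 a * (1 + `|g x|))).
  by rewrite ler_wpM2r ?addr_ge0// le_max lexx orbT.
by rewrite ler_wpM2l ?lerD2l// le_max lexx.
Qed.

End Flows.

Section HamiltonianFields.
Context {R : realType} {n : nat}.
Variables (a : 'cV[R]_n -> 'cV[R]_n) (w : 'cV[R]_n -> R).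
Hypothesis smootha : smooth_vec a.
Hypothesis smoothw : smooth w.
Implicit Types z e : 'cV[R]_(n + n).

(** Gradients are obtained from directional derivatives; [x] and [y] are the
   gradients in the position and in the momentum. *)
Lemma ham_fieldE (h : 'cV[R]_(n + n) -> R) z (x y : 'cV[R]_n) :
  (forall e, is_derive z e h (dot x (usubmx e) + dot y (dsubmx e))) ->
  ham_field h z = col_mx y (- x).
Proof.
move=> hd; rewrite /ham_field Omega_mul.
congr (col_mx _ (- _)); apply/matrixP => i j; rewrite ord1 !mxE /partial.
  have [_ ->] := hd (delta_mx (rshift n i) 0).
  by rewrite usubmx_rshift dsubmx_rshift dot0r dot_delta add0r.
have [_ ->] := hd (delta_mx (lshift n i) 0).
by rewrite usubmx_lshift dsubmx_lshift dot0r dot_delta addr0.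
Qed.

Definition kin z : R := 2^-1 * sqnorm (dsubmx z).
Definition pot z : R := w (usubmx z).
Definition mag z : R := - dot (a (usubmx z)) (dsubmx z).

Definition kin_field z : 'cV[R]_(n + n) := col_mx (dsubmx z) 0.
Definition pot_field z : 'cV[R]_(n + n) := col_mx 0 (- grad w (usubmx z)).
Definition mag_vfield z : 'cV[R]_(n + n) :=
  col_mx (- a (usubmx z)) ((Jac a (usubmx z))^T *m dsubmx z).

Lemma is_derive_kin z e : is_derive z e kin (dot 0 (usubmx e) + dot (dsubmx z) (dsubmx e)).
Proof.
have := @is_deriveZ _ _ _ (fun z => sqnorm (dsubmx z)) 2^-1 z e _
  (is_derive_sqnorm (is_derive_dsubmx z e)).
rewrite [_ *: _](_ : _ = dot 0 (usubmx e) + dot (dsubmx z) (dsubmx e))//.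
rewrite -[LHS]/(_ * _) mulrA mulVf// mul1r.
by rewrite /dot [X in _ = X + _]big1 ?add0r// => i _; rewrite mxE mul0r.
Qed.

Lemma is_derive_pot z e :
  is_derive z e pot (dot (grad w (usubmx z)) (usubmx e) + dot 0 (dsubmx e)).
Proof.
have := is_derive_C1_comp (is_derive_usubmx z e) (smooth_C1 smoothw).
rewrite [X in is_derive _ _ _ X](_ : _ = dot (grad w (usubmx z)) (usubmx e) + dot 0 (dsubmx e))//.
rewrite /dot [X in _ = _ + X]big1 ?addr0; last by move=> i _; rewrite mxE mul0r.
by apply: eq_bigr => i _; rewrite mulrC [in RHS]mxE.
Qed.

Lemma is_derive_mag z e : is_derive z e mag
  (dot (- ((Jac a (usubmx z))^T *m dsubmx z)) (usubmx e) + dot (- a (usubmx z)) (dsubmx e)).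
Proof.
have di i : is_derive z e (fun z => a (usubmx z) i 0 * (dsubmx z) i 0)
    ((\sum_k usubmx e k 0 * partial k (fun q => a q i 0) (usubmx z)) * dsubmx z i 0
      + a (usubmx z) i 0 * dsubmx e i 0).
  have d1 := is_derive_C1_comp (is_derive_usubmx z e) (smooth_C1 (smootha i)).
  have d2 := is_derive_coord i (is_derive_dsubmx z e).
  have := @is_deriveM _ _ (fun z : 'cV[R]_(n + n) => a (usubmx z) i 0)
    (fun z : 'cV[R]_(n + n) => dsubmx z i 0) z e _ _ d1 d2.
  rewrite [X in is_derive _ _ _ X](_ : _ = (\sum_k usubmx e k 0 * partial k (fun q => a q i 0) (usubmx z)) * dsubmx z i 0
      + a (usubmx z) i 0 * dsubmx e i 0)//.
  by rewrite addrC; apply: (congr2 +%R) => //; exact: mulrC.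
have E : mag = - \sum_i (fun z => a (usubmx z) i 0 * (dsubmx z) i 0).
  by apply/funext => y; rewrite /mag /dot fctE fct_sumE.
rewrite E.
have := is_deriveN (is_derive_sum di).
rewrite [X in is_derive _ _ _ X](_ : _ = dot (- ((Jac a (usubmx z))^T *m dsubmx z)) (usubmx e)
  + dot (- a (usubmx z)) (dsubmx e))//.
rewrite big_split/= opprD; congr (_ + _); last first.
  by rewrite /dot -sumrN; apply: eq_bigr => i _; rewrite [in RHS]mxE mulNr.
rewrite /dot -sumrN.
under [RHS]eq_bigr do rewrite mxE mxE mulNr.
rewrite !sumrN; apply: (congr1 -%R).
under [RHS]eq_bigr do rewrite mulr_suml.
transitivity (\sum_i \sum_k usubmx e k 0 * partial k (fun q => a q i 0) (usubmx z)
    * dsubmx z i 0).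
  by apply: eq_bigr => i _; exact: mulr_suml.
rewrite exchange_big/=; apply: eq_bigr => i _; apply: eq_bigr => k _.
by rewrite !mxE; ring.
Qed.

Lemma ham_kin : ham_field kin = kin_field.
Proof.
apply/funext => z; rewrite (ham_fieldE (is_derive_kin z)) /kin_field.
by rewrite oppr0.
Qed.

Lemma ham_pot : ham_field pot = pot_field.
Proof. by apply/funext => z; rewrite (ham_fieldE (is_derive_pot z)). Qed.

Lemma ham_mag : ham_field mag = mag_vfield.
Proof. by apply/funext => z; rewrite (ham_fieldE (is_derive_mag z)) opprK. Qed.

Lemma ham_tot : ham_field (fun z => kin z + pot z + mag z) =
  fun z => kin_field z + pot_field z + mag_vfield z.
Proof.
apply/funext => z.
have dt e := is_deriveD (is_deriveD (is_derive_kin z e) (is_derive_pot z e)) (is_derive_mag z e).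
rewrite -ham_kin -ham_pot -ham_mag.
rewrite (ham_fieldE (is_derive_kin z)) (ham_fieldE (is_derive_pot z)) (ham_fieldE (is_derive_mag z)).
rewrite !add_col_mx -!opprD; apply: ham_fieldE => e.
have dotDl (x y v : 'cV[R]_n) : dot (x + y) v = dot x v + dot y v.
  by rewrite /dot -big_split; apply: eq_bigr => i _; rewrite mxE mulrDl.
rewrite !dotDl addrACA; rewrite [X in is_derive _ _ _ (X + _)]addrACA; exact: dt.
Qed.

Lemma smooth_vec_cst m k (c : 'cV[R]_k) : smooth_vec (fun _ : 'cV[R]_m => c).
Proof. by move=> i; exact: smooth_cst. Qed.

Lemma smooth_grad : smooth_vec (grad w).
Proof. by move=> i; under eq_fun do rewrite mxE; exact: smooth_partial. Qed.

Lemma smooth_kin_field : smooth_vec kin_field.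
Proof. exact: smooth_col_mx (@smooth_vec_dsubmx R n n) (smooth_vec_cst 0). Qed.

Lemma smooth_pot_field : smooth_vec pot_field.
Proof.
apply: smooth_col_mx (smooth_vec_cst 0) _.
exact: smooth_vec_comp (smooth_vecN smooth_grad) (@smooth_vec_usubmx R n n).
Qed.

Lemma smooth_mag_vfield : smooth_vec mag_vfield.
Proof.
apply: smooth_col_mx.
  exact: smooth_vec_comp (smooth_vecN smootha) (@smooth_vec_usubmx R n n).
apply: smooth_mx_vec; apply: smooth_mulmx; last exact: smooth_vec_mx (@smooth_vec_dsubmx R n n).
apply: smooth_trmx; exact: smooth_mx_comp (smooth_Jac smootha) (@smooth_vec_usubmx R n n).
Qed.

Variable C : R.
Hypothesis C_ge0 : 0 <= C.
Hypothesis Jac_a : forall q, `|Jac a q| <= C.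
Hypothesis Hess_w : forall i j q, `|partial j (partial i w) q| <= C.

Lemma linear_growth_kin_field : linear_growth kin_field.
Proof.
apply: linear_growth_col_mx; last by exists 0 => x; rewrite normr0 mul0r.
exact: linear_growth_comp (@linear_growth_id R n) (@dsubmx_norm R n n).
Qed.

Lemma linear_growth_pot_field : linear_growth pot_field.
Proof.
apply: linear_growth_col_mx; first by exists 0 => x; rewrite normr0 mul0r.
apply: linear_growthN; apply: (@linear_growth_comp _ _ _ _ (grad w)); last exact: usubmx_norm.
apply: (linear_growth_bounded_Jac smooth_grad C_ge0) => q.
apply: mxnorm_le => // i j; rewrite mxE.
by under [fun y => _]eq_fun do rewrite mxE; exact: Hess_w.
Qed.

(** The bound on [Jac a] makes the position component globally Lipschitz and the
   momentum component at most linear in the momentum. *)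
Lemma linear_growth_mag_vfield : linear_growth mag_vfield.
Proof.
apply: linear_growth_col_mx.
  apply: linear_growthN; apply: (@linear_growth_comp _ _ _ _ a); last exact: usubmx_norm.
  exact: linear_growth_bounded_Jac smootha C_ge0 Jac_a.
apply: (@linear_growth_le _ _ _ _ _ (fun z => z) (n%:R * C)) => [||z].
- exact: mulr_ge0.
- exact: linear_growth_id.
- rewrite (le_trans (mxnormM _ _))// -mulrA ler_wpM2l// ler_pM ?mxnorm_tr//.
  exact: dsubmx_norm.
Qed.

Lemma kin_field_line z t : kin_field (z + t *: kin_field z) = kin_field z.
Proof.
by rewrite /kin_field linearD/= [dsubmx (_ *: _)]linearZ/= col_mxKd scaler0 addr0.
Qed.

Lemma pot_field_line z t : pot_field (z + t *: pot_field z) = pot_field z.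
Proof.
by rewrite /pot_field linearD/= [usubmx (_ *: _)]linearZ/= col_mxKu scaler0 addr0.
Qed.

Lemma flow_kin t z : flow kin_field t z = z + t *: kin_field z.
Proof.
exact: flow_line smooth_kin_field linear_growth_kin_field (kin_field_line z).
Qed.

Lemma flow_pot t z : flow pot_field t z = z + t *: pot_field z.
Proof.
exact: flow_line smooth_pot_field linear_growth_pot_field (pot_field_line z).
Qed.

End HamiltonianFields.

(** * Linear systems and time reversal *)

Section LinearSystems.
Context {R : realType} {n : nat}.

Lemma linear_solution (N : R -> 'M[R]_n) C (y : 'cV[R]_n) :
  (forall i j, continuous (fun t => N t i j)) -> (forall t, `|N t| <= C) ->
  exists u, u 0 = y /\ forall t : R, is_derive t 1 u (N t *m u t).
Proof.
move=> cN NC; have C0 : 0 <= C by exact: le_trans (NC 0).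
have C1 : 0 < n%:R * C + 1 by rewrite ltr_wpDl// mulr_ge0.
apply: (@picard_lindelof R n (fun t x => N t *m x) (n%:R * C + 1) (n%:R * (C * `|y|))).
- exact: C1.
- move=> t x x'; rewrite -mulmxBr (le_trans (mxnormM _ _))//.
  by rewrite mulrA ler_wpM2r// ler_wpDr// ler_wpM2l.
- by move=> t; rewrite (le_trans (mxnormM _ _))// ler_wpM2l// ler_wpM2r.
- move=> u cu; apply: continuous_cv => i.
  rewrite (_ : (fun t => _) = fun t => \sum_k N t i k * u t k 0); last first.
    by apply/funext => t; rewrite mxE.
  apply: continuous_sum => k; apply: continuous_mul; first exact: cN.
  exact: continuous_coord.
Qed.

Lemma autonomous_solution (f : 'cV[R]_n -> 'cV[R]_n) C y : smooth_vec f ->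
  0 <= C -> (forall x, `|Jac f x| <= C) ->
  exists u, u 0 = y /\ is_solution f setT u.
Proof.
move=> sf C0 fC.
have C1 : 0 < n%:R * C + 1 by rewrite ltr_wpDl// mulr_ge0.
have [||||u [u0 ud]] := @picard_lindelof R n (fun _ => f) (n%:R * C + 1) `|f y| y.
- exact: C1.
- move=> _ x x'; rewrite (le_trans (bounded_Jac_lipschitz sf C0 fC x' x))//.
  by rewrite ler_wpM2r// lerDl.
- by [].
- move=> u cu; apply: continuous_cv => i t.
  apply: (@continuous_comp _ _ _ u (fun x => f x i 0)); first exact: cu.
  exact: smooth_continuous (sf i) _.
by exists u; split=> // t _; exact: ud.
Qed.

End LinearSystems.

Section TwoSidedOrder.
Context {R : realType} {s : nat} (L : 'M[R]_s) (b : 'cV[R]_s) (nu : nat).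

(** Reversing time turns a step with a negative step size into one with a
   positive step size for the opposite field. *)
Lemma rk_order_two_sided n (f : 'cV[R]_n -> 'cV[R]_n) (rho : R) :
  rk_order L b nu -> smooth_vec f ->
  exists C tau1 : R, [/\ 0 <= C, 0 < tau1 & forall tau u,
    `|tau| <= tau1 -> is_solution f setT u -> `|u 0| <= rho ->
    `|rk_map L b f tau (u 0) - u tau| <= C * `|tau| ^+ nu.+1].
Proof.
move=> ord sf; have cK := @compact_cv_ball R n rho.
have [C1 [t1 [t10 H1]]] := ord n f sf _ cK.
have [C2 [t2 [t20 H2]]] := ord n (fun x => - f x) (smooth_vecN sf) _ cK.
exists (Num.max 0 (Num.max C1 C2)), (Num.min t1 t2).
rewrite le_max lexx lt_min t10 t20; split=> // tau u; rewrite le_min => /andP[tt1 tt2] su u0.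
have [tau0|tau0|->] := ltgtP tau 0; last first.
- by rewrite normr0 expr0n/= mulr0 /rk_map /rk_update scale0r addr0 subrr normr0.
- rewrite gtr0_norm// in tt1 tt2 *.
  apply: le_trans (H1 tau u (stages L f tau (u 0)) _ _ _ (stagesP _ _ _ _)) _ => //.
  + by rewrite tau0.
  + by move=> t _; exact: su.
  + by rewrite ler_wpM2r ?exprn_ge0 ?(ltW tau0)// !le_max lexx orbT.
- rewrite ltr0_norm// in tt1 tt2 *.
  have E : rk_map L b f tau (u 0) =
      rk_update b (- tau) (u 0) (fun j => - stages L f tau (u 0) j).
    by rewrite rk_update_opp.
  have sv : is_solution (fun x => - f x) `[0, - tau] (fun t => u (- t)).
    by move=> t _; apply: is_derive_opp_arg; exact: su.
  have := H2 (- tau) (fun t => u (- t)) (fun j => - stages L f tau (u 0) j).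
  rewrite oppr0 opprK E => H; apply: le_trans (H _ sv u0 _) _.
  + by rewrite oppr_gt0 tau0.
  + by apply: rk_stages_opp; exact: stagesP.
  + by rewrite ler_wpM2r ?exprn_ge0 ?oppr_ge0 ?(ltW tau0)// !le_max lexx !orbT.
Qed.

End TwoSidedOrder.

(** * The partitioned magnetic step *)

Section MagneticStep.
Context {R : realType} {s n : nat} (L : 'M[R]_s) (b : 'cV[R]_s).
Variable a : 'cV[R]_n -> 'cV[R]_n.
Hypothesis L_explicit : explicit_tableau L.
Hypothesis b_neq0 : forall i, b i 0 != 0.
Hypothesis smootha : smooth_vec a.
Variable C : R.
Hypothesis C_ge0 : 0 <= C.
Hypothesis Jac_a : forall q, `|Jac a q| <= C.

Let f (q : 'cV[R]_n) : 'cV[R]_n := - a q.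

Let smoothf : smooth_vec f.
Proof. exact: smooth_vecN. Qed.

Let JacfE q : Jac f q = - Jac a q.
Proof. exact: JacN. Qed.

Let Jac_f q : `|Jac f q| <= C.
Proof. by rewrite JacfE normrN. Qed.

(** The cotangent lift of the Runge-Kutta map of the positions. *)
Definition mag_num (t : R) (z : 'cV[R]_(n + n)) : 'cV[R]_(n + n) :=
  col_mx (rk_map L b f t (usubmx z))
         ((invmx (rk_jac L b f t (usubmx z)))^T *m dsubmx z).

Definition stage_matrix (t : R) (q : 'cV[R]_n) (i : 'I_s) : 'M[R]_n :=
  (Jac a (rk_node L t q (stages L f t q) i))^T.

Lemma momentum_adjoint t q P l : back_op L b (stage_matrix t q) t P l = l ->
  (rk_jac L b f t q)^T *m P = P - t *: \sum_i b i 0 *: l i.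
Proof.
apply: (back_stages_adjoint L_explicit b_neq0) => i.
by rewrite stage_jacE /stage_jac_op JacfE /stage_matrix trmxK.
Qed.

(** The system for the momentum stages is solved in two steps: first the new
   momentum from [momentum_adjoint], then the stages by back substitution. *)
Lemma momentum_update t q p l : rk_jac L b f t q \in unitmx ->
  momentum_stages L b (stage_matrix t q) t p l <->
  l = back_stages L b (stage_matrix t q) t ((invmx (rk_jac L b f t q))^T *m p).
Proof.
move=> uJ; set J := rk_jac L b f t q in uJ *.
have JK v : (invmx J)^T *m (J^T *m v) = v.
  by rewrite mulmxA -trmx_mul mulmxV// trmx1 mul1mx.
have JVK v : J^T *m ((invmx J)^T *m v) = v.
  by rewrite mulmxA -trmx_mul mulVmx// trmx1 mul1mx.
rewrite (momentum_stagesP L b_neq0); split=> [lE|->].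
  apply: (back_stages_unique L_explicit); move: lE (momentum_adjoint lE).
  set P := rk_update b t p l => lE; rewrite -/J.
  by rewrite {2}/P /rk_update addrK => <-; rewrite JK.
set P := _ *m p; have lE := back_stagesP b L_explicit (stage_matrix t q) t P.
have := momentum_adjoint lE; rewrite -/J JVK => /eqP; rewrite eq_sym subr_eq => /eqP.
by move=> PE; rewrite /rk_update -PE.
Qed.

Lemma rk_update_momentum t q p l : rk_jac L b f t q \in unitmx ->
  momentum_stages L b (stage_matrix t q) t p l ->
  rk_update b t p l = (invmx (rk_jac L b f t q))^T *m p.
Proof.
move=> uJ /(momentum_stagesP L b_neq0)/momentum_adjoint.
rewrite {2}/rk_update addrK => pE; rewrite -[in RHS]pE.
by rewrite mulmxA -trmx_mul mulmxV// trmx1 mul1mx.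
Qed.

Variable tau0 : R.
Hypothesis near_id : forall t y, `|t| <= tau0 ->
  n%:R * `|rk_jac L b f t y - 1%:M| <= 2^-1.

Lemma rk_jac_unit t y : `|t| <= tau0 -> rk_jac L b f t y \in unitmx.
Proof. by move=> tt; have := near_id_unit (near_id y tt); rewrite addrC subrK. Qed.

Lemma momentum_expand t y (v : 'cV[R]_n) : `|t| <= tau0 ->
  `|v| <= 2 * `|(rk_jac L b f t y)^T *m v|.
Proof.
move=> tt; have := @near_id_expand R n (rk_jac L b f t y - 1%:M)^T v.
rewrite mxnorm_tr => /(_ (near_id y tt)).
by rewrite -{1}(@trmx1 R n) -linearD/= addrC subrK.
Qed.

Lemma momentum_le t y (p : 'cV[R]_n) : `|t| <= tau0 ->
  `|(invmx (rk_jac L b f t y))^T *m p| <= 2 * `|p|.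
Proof.
move=> tt; rewrite (le_trans (momentum_expand y _ tt))// mulmxA -trmx_mul.
by rewrite mulVmx ?rk_jac_unit// trmx1 mul1mx.
Qed.

Lemma mag_num_bounded rho T : T <= tau0 -> exists B, forall t z, `|t| <= T ->
  `|z| <= rho -> `|mag_num t z| <= B.
Proof.
move=> Ttau.
have H m : exists B, 0 <= B /\ forall t y i, `|t| <= T -> `|y| <= rho ->
    `|iter m (stage_op L f t y) (fun=> 0) i| <= B.
  elim: m => [|m [B [B0 IH]]]; first by exists 0; split=> // t y i _ _ /=; rewrite normr0.
  have [M M0 MP] := smooth_vec_bounded (rho + T * (s%:R * (`|L| * B))) smoothf.
  exists M; split=> // t y i tT yr; rewrite iterS /stage_op MP//.
  rewrite /rk_node (le_trans (ler_normD _ _))// lerD// normrZ ler_pM//.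
  rewrite (le_trans (ler_norm_sum _ _ _))//.
  apply: (@le_trans _ _ (\sum_(j < s) `|L| * B)); last by rewrite sumr_const card_ord mulr_natl.
  rewrite big_mkcond/=; apply: ler_sum => j _; case: ifP => _; last by rewrite mulr_ge0.
  by rewrite normrZ ler_pM ?mxnorm_entry ?IH.
have [B [B0 BP]] := H s.
exists (Num.max (rho + T * (s%:R * (`|b| * B))) (2 * rho)) => t z tT zr.
have qr : `|usubmx z| <= rho by exact: le_trans (usubmx_norm z) zr.
rewrite (le_trans (col_mx_norm _ _))// ge_max !le_max; apply/andP; split; apply/orP.
  left; rewrite /rk_map /rk_update (le_trans (ler_normD _ _))// lerD// normrZ ler_pM//.
  rewrite (le_trans (ler_norm_sum _ _ _))//.
  apply: (@le_trans _ _ (\sum_(j < s) `|b| * B)); last by rewrite sumr_const card_ord mulr_natl.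
  by apply: ler_sum => j _; rewrite normrZ ler_pM ?mxnorm_entry ?BP.
right; rewrite (le_trans (momentum_le _ _ _)) ?(le_trans tT)// ler_wpM2l//.
exact: le_trans (dsubmx_norm z) zr.
Qed.

Lemma smooth_mag_num t : `|t| <= tau0 -> smooth_vec (mag_num t).
Proof.
move=> tt; apply: smooth_col_mx.
  exact: smooth_vec_comp (smooth_rk_map L b smoothf t) (@smooth_vec_usubmx R n n).
apply: smooth_mx_vec; apply: smooth_mulmx; last exact: smooth_vec_mx (@smooth_vec_dsubmx R n n).
apply: smooth_trmx; apply: smooth_invmx => [|z]; last exact: rk_jac_unit.
apply: (@smooth_mx_comp R _ _ _ _ (rk_jac L b f t)); last exact: smooth_vec_usubmx.
have -> : rk_jac L b f t = Jac (rk_map L b f t).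
  by apply/funext => y; rewrite Jac_rk_map.
exact: smooth_Jac (smooth_rk_map L b smoothf t).
Qed.

Lemma symplectic_mag_num t z : `|t| <= tau0 -> symplectic_at (mag_num t) z.
Proof.
move=> tt; have -> : mag_num t = fun z => col_mx (rk_map L b f t (usubmx z))
    ((invmx (Jac (rk_map L b f t) (usubmx z)))^T *m dsubmx z).
  by apply/funext => y; rewrite /mag_num Jac_rk_map.
apply: symplectic_cotangent_lift; first exact: smooth_rk_map.
by move=> q; rewrite Jac_rk_map//; exact: rk_jac_unit.
Qed.

(** The exact magnetic flow: the momentum is transported by the inverse
   transpose of the linearized position flow, as expressed by the conservation
   of its pairing with the tangent vectors [w]. *)
Lemma mag_solution (z : 'cV[R]_(n + n)) (e : 'cV[R]_n) :
  exists q p w : R -> 'cV[R]_n,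
  [/\ is_solution (mag_vfield a) setT (fun t => col_mx (q t) (p t)),
      is_solution (fun y : 'cV[R]_(n + n) =>
          col_mx (- a (usubmx y)) (- (Jac a (usubmx y) *m dsubmx y)))
        setT (fun t => col_mx (q t) (w t)),
      col_mx (q 0) (p 0) = z, w 0 = e & forall t, dot (w t) (p t) = dot e (dsubmx z)].
Proof.
have [q [q0 qd]] := autonomous_solution (usubmx z) smoothf C_ge0 Jac_f.
have cq : continuous q by move=> t; exact: is_derive1_continuous (qd t I).
have cJ i j : continuous (fun t => Jac a (q t) i j).
  move=> t; apply: (@continuous_comp _ _ _ q (fun x => Jac a x i j)); first exact: cq.
  exact: smooth_continuous (smooth_Jac smootha i j) _.
have [||p [p0 pd]] := @linear_solution R n (fun t => (Jac a (q t))^T) C (dsubmx z).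
- by move=> i j; under eq_fun do rewrite mxE; exact: cJ.
- by move=> t; rewrite mxnorm_tr.
have [||w [w0 wd]] := @linear_solution R n (fun t => - Jac a (q t)) C e.
- move=> i j; under eq_fun do rewrite mxE; move=> t; apply: cvgN; exact: cJ.
- by move=> t; rewrite normrN.
have is_derive_col (x y : R -> 'cV[R]_n) (t : R) dx dy : is_derive t 1 x dx -> is_derive t 1 y dy ->
    is_derive t 1 (fun t => col_mx (x t) (y t)) (col_mx dx dy).
  move=> xd yd; apply: is_derive_cv => i; case: (split_ordP i) => k ->.
    rewrite col_mxEu; under eq_fun do rewrite col_mxEu; exact: is_derive_coord xd.
  rewrite col_mxEd; under eq_fun do rewrite col_mxEd; exact: is_derive_coord yd.
exists q, p, w; split=> //.
- move=> t _; rewrite /mag_vfield col_mxKu col_mxKd; apply: is_derive_col (pd t).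
  exact: qd.
- move=> t _; rewrite col_mxKu col_mxKd -mulNmx; apply: is_derive_col (wd t).
  exact: qd.
- by rewrite q0 p0 vsubmxK.
have dd (t : R) : is_derive t 1 (fun t => dot (w t) (p t)) 0.
  have di i : is_derive t 1 (fun t => w t i 0 * p t i 0)
     (w t i 0 *: ((Jac a (q t))^T *m p t) i 0 + p t i 0 *: (- Jac a (q t) *m w t) i 0).
    by apply: (@is_deriveM _ _ (fun t => w t i 0) (fun t => p t i 0)); exact: is_derive_coord.
  have := is_derive_sum di.
  rewrite [X in is_derive _ _ _ X](_ : _ = 0).
    by rewrite (_ : (fun t => dot _ _) = \sum_i (fun t => w t i 0 * p t i 0)) //;
      apply/funext => r; rewrite fct_sumE.
  have adj (M : 'M[R]_n) (x y : 'cV[R]_n) : dot x (M^T *m y) = dot (M *m x) y.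
    by rewrite !dotE mulmxA -trmx_mul.
  rewrite big_split/= -[X in X + _]/(dot (w t) ((Jac a (q t))^T *m p t)).
  rewrite -[X in _ + X]/(dot (p t) (- Jac a (q t) *m w t)) adj mulNmx.
  rewrite /dot -big_split big1// => i _.
  have -> : (- (Jac a (q t) *m w t)) i 0 = - (Jac a (q t) *m w t) i 0 by rewrite [LHS]mxE.
  by rewrite /= mulrN [X in X + _]mulrC subrr.
move=> t; rewrite -w0 -p0.
have dd' (r : R) : `|r| < `|t| + 1 -> is_derive r 1 (fun t => dot (w t) (p t)) 0 by [].
apply: (@derive_eq_on R (fun t => dot (w t) (p t)) (fun=> dot (w 0) (p 0)) (fun=> 0) (`|t| + 1)) => //.
by rewrite ltrDl.
Qed.

(** The method of order [nu] is applied to the extended system of [mag_solution],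
   once for each unit vector as initial tangent vector. *)
Lemma mag_local_error (nu : nat) (rho : R) : 0 < tau0 -> rk_order L b nu ->
  exists K tau1 : R, [/\ 0 <= K, 0 < tau1 & forall t z, `|t| <= tau1 -> `|z| <= rho ->
    `|mag_num t z - flow (mag_vfield a) t z| <= K * `|t| ^+ nu.+1].
Proof.
move=> tau0_gt0 ord.
have sX := smooth_mag_vfield smootha.
have gX := linear_growth_mag_vfield smootha C_ge0 Jac_a.
pose g (y : 'cV[R]_(n + n)) := col_mx (f (usubmx y)) (Jac f (usubmx y) *m dsubmx y).
have sg : smooth_vec g.
  apply: smooth_col_mx.
    exact: smooth_vec_comp smoothf (@smooth_vec_usubmx R n n).
  apply: smooth_mx_vec; apply: smooth_mulmx; last exact: smooth_vec_mx (@smooth_vec_dsubmx R n n).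
  exact: smooth_mx_comp (smooth_Jac smoothf) (@smooth_vec_usubmx R n n).
(* On the first variation the method reproduces the derivative of its map. *)
have gstages t q e : rk_map L b g t (col_mx q e) =
    col_mx (rk_map L b f t q) (rk_jac L b f t q *m e).
  have split_sum (P : pred 'I_s) (c : 'I_s -> R) (x y : 'I_s -> 'cV[R]_n) :
      col_mx q e + t *: \sum_(j < s | P j) c j *: col_mx (x j) (y j) =
      col_mx (q + t *: \sum_(j < s | P j) c j *: x j) (e + t *: \sum_(j < s | P j) c j *: y j).
    rewrite (_ : \sum_(j < s | P j) c j *: col_mx (x j) (y j) =
       col_mx (\sum_(j < s | P j) c j *: x j) (\sum_(j < s | P j) c j *: y j)).
      by rewrite scale_col_mx add_col_mx.
    elim/big_rec3: _ => [|j u v x' _ ->]; first by rewrite col_mx0.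
    by rewrite scale_col_mx add_col_mx.
  have mul_sum (P : pred 'I_s) (c : 'I_s -> R) (N : 'I_s -> 'M[R]_n) :
      e + t *: \sum_(j < s | P j) c j *: (N j *m e) =
      (1%:M + t *: \sum_(j < s | P j) c j *: N j) *m e.
    rewrite mulmxDl mul1mx -scalemxAl mulmx_suml; congr (_ + _ *: _).
    by apply: eq_bigr => j _; rewrite scalemxAl.
  rewrite /rk_map; have <- : (fun i => col_mx (stages L f t q i) (stage_jac L f t q i *m e)) =
      stages L g t (col_mx q e).
    apply: stages_unique => i; rewrite {1}(stagesP L f t q i) {1}stage_jacE /stage_jac_op.
    rewrite [rk_node _ _ _ _ _ in RHS]split_sum /g col_mxKu col_mxKd mul_sum.
    by rewrite mulmxA.
  by rewrite /rk_update split_sum mul_sum.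
have [B BP] := solutions_bounded rho tau0 gX.
have [K [tau1 [K0 tau10 err]]] := rk_order_two_sided (Num.max rho 1) ord sg.
exists (Num.max K (2 * (n%:R * (K * Num.max 0 B)))), (Num.min tau0 tau1).
split; [by rewrite le_max K0|by rewrite lt_min tau0_gt0|].
move=> t z; rewrite le_min => /andP[tt0 tt1] zr.
have tn : 0 <= `|t| ^+ nu.+1 by exact: exprn_ge0.
have [q [p [_ [su _ zE _ _]]]] := mag_solution z 0.
have flowE : flow (mag_vfield a) t z = col_mx (q t) (p t).
  by rewrite -zE; exact: (flow_solution t sX gX su).
have pB : `|p t| <= Num.max 0 B.
  rewrite le_max; apply/orP; right.
  apply: le_trans (BP _ su _ t tt0); last by rewrite zE.
  by have := dsubmx_norm (col_mx (q t) (p t)); rewrite col_mxKd.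
have errw e : `|e| <= 1 -> exists w : 'cV[R]_n,
    [/\ `|rk_map L b f t (usubmx z) - q t| <= K * `|t| ^+ nu.+1,
        `|rk_jac L b f t (usubmx z) *m e - w| <= K * `|t| ^+ nu.+1 &
        dot w (p t) = dot e (dsubmx z)].
  move=> e1; have [q' [p' [w [su' sw zE' we wp]]]] := mag_solution z e.
  have qpE : col_mx (q' t) (p' t) = col_mx (q t) (p t).
    by rewrite -flowE -zE'; apply/esym; exact: (flow_solution t sX gX su').
  have [q'E p'E] := eq_col_mx qpE.
  have q'0 : q' 0 = usubmx z by rewrite -zE' col_mxKu.
  have sw' : is_solution g setT (fun t => col_mx (q' t) (w t)).
    by move=> r I'; have := sw r I'; rewrite /g !col_mxKu !col_mxKd JacfE mulNmx.
  have := err t _ tt1 sw'; rewrite q'0 we gstages opp_col_mx add_col_mx => H.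
  have {}H : `|col_mx (rk_map L b f t (usubmx z) - q' t)
      (rk_jac L b f t (usubmx z) *m e - w t)| <= K * `|t| ^+ nu.+1.
    apply: H; rewrite (le_trans (col_mx_norm _ _))// ge_max !le_max.
    by rewrite (le_trans (usubmx_norm _) zr) e1 orbT.
  exists (w t); rewrite -q'E -p'E; split; last exact: wp.
    by apply: le_trans H; have := usubmx_norm (col_mx (rk_map L b f t (usubmx z) - q' t)
      (rk_jac L b f t (usubmx z) *m e - w t)); rewrite col_mxKu.
  by apply: le_trans H; have := dsubmx_norm (col_mx (rk_map L b f t (usubmx z) - q' t)
    (rk_jac L b f t (usubmx z) *m e - w t)); rewrite col_mxKd.
rewrite flowE /mag_num opp_col_mx add_col_mx (le_trans (col_mx_norm _ _))//.
rewrite ge_max; apply/andP; split.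
  have [|_ [H _ _]] := errw 0; first by rewrite normr0.
  by apply: le_trans H _; rewrite ler_wpM2r// le_max lexx.
set P := _ *m dsubmx z.
apply: (@le_trans _ _ (2 * (n%:R * (K * Num.max 0 B)) * `|t| ^+ nu.+1)); last first.
  by rewrite ler_wpM2r// le_max lexx orbT.
rewrite (le_trans (momentum_expand (usubmx z) _ tt0))// -mulrA ler_wpM2l//.
apply: cvnorm_le => [|j]; first by rewrite !mulr_ge0// le_max lexx.
have [w [_ Hw wp]] := errw _ (delta_norm j).
have coordE (x : 'cV[R]_n) : x j 0 = dot (delta_mx j 0) x.
  by rewrite /dot sum_delta.
have JP : (rk_jac L b f t (usubmx z))^T *m P = dsubmx z.
  by rewrite /P mulmxA -trmx_mul mulVmx ?rk_jac_unit// trmx1 mul1mx.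
(* The transposed derivative of the position map sends the error of the momentum
   to the pairings of the exact momentum with the errors of the first
   variations. *)
rewrite mulmxBr JP mxE [X in _ + X]mxE (coordE (dsubmx z)) -wp.
rewrite (coordE (_ *m p t)) !dotE mulmxA -trmx_mul.
set v := rk_jac L b f t (usubmx z) *m _ in Hw *.
have -> : (w^T *m p t) 0 0 - (v^T *m p t) 0 0 = dot (w - v) (p t).
  by rewrite dotE linearB/= mulmxBl [in RHS]mxE [X in _ = _ + X]mxE.
rewrite (le_trans (dot_le _ _))// -mulrA ler_wpM2l// mulrAC ler_pM//.
by rewrite distrC.
Qed.

End MagneticStep.

(** * The splitting integrator *)

Section SplittingIntegrator.
Context {R : realType} {d s : nat}.
Variables (A : 'cV[R]_d -> 'cV[R]_d) (V : 'cV[R]_d -> R).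
Variables (L : 'M[R]_s) (b : 'cV[R]_s).
Local Notation D := (dimD d).
Local Notation phase := 'cV[R]_(D + D).
Hypothesis L_explicit : explicit_tableau L.
Hypothesis b_neq0 : forall i, b i 0 != 0.
Hypothesis smooth_a : smooth_vec (Abf A).
Hypothesis smooth_w : smooth (Vbf A V).
Variable C : R.
Hypothesis C_ge0 : 0 <= C.
Hypothesis Jac_a : forall q, `|Jac (Abf A) q| <= C.
Hypothesis Hess_w : forall i j q, `|partial j (partial i (Vbf A V)) q| <= C.
Variable tau0 : R.
Hypothesis tau0_gt0 : 0 < tau0.
Hypothesis near_id : forall t y, `|t| <= tau0 ->
  D%:R * `|rk_jac L b (fun q => - Abf A q) t y - 1%:M| <= 2^-1.

Implicit Types (P : part) (sch : seq (part * R)) (z : phase).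

Definition num_flow P (t : R) z : phase :=
  match P with
  | Mag => mag_num L b (Abf A) t z
  | _ => flow (ham_field (h_part A V P)) t z
  end.

Definition run sch (tau : R) z : phase :=
  foldl (fun y c => num_flow c.1 (c.2 * tau) y) z sch.

Lemma ham_kinE : ham_field (h_part A V Kin) = @kin_field R D.
Proof. exact: ham_kin. Qed.

Lemma ham_potE : ham_field (h_part A V Pot) = pot_field (Vbf A V).
Proof. exact: ham_pot. Qed.

Lemma ham_magE : ham_field (h_part A V Mag) = mag_vfield (Abf A).
Proof. exact: ham_mag. Qed.

Lemma num_kin t z : num_flow Kin t z = z + t *: kin_field z.
Proof. by rewrite /num_flow ham_kinE flow_kin. Qed.

Lemma num_pot t z : num_flow Pot t z = z + t *: pot_field (Vbf A V) z.
Proof. by rewrite /num_flow ham_potE (flow_pot smooth_w C_ge0 Hess_w). Qed.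

Let jac_unit t y : `|t| <= tau0 -> rk_jac L b (fun q => - Abf A q) t y \in unitmx.
Proof. exact: rk_jac_unit near_id t y. Qed.

Let mag_matrixE t q : mag_matrix A L t q (stages L (fun q => - Abf A q) t q) =
  stage_matrix L (Abf A) t q.
Proof. by []. Qed.

Lemma mag_stepE t z z' : `|t| <= tau0 -> mag_step A L b t z z' <-> z' = num_flow Mag t z.
Proof.
move=> tt; have uJ := jac_unit (usubmx z) tt; split.
  move=> [k [l [/stages_unique-> lE ->]]]; rewrite mag_matrixE in lE.
  rewrite /num_flow /mag_num /rk_map; congr (col_mx _ _).
  exact (rk_update_momentum L_explicit b_neq0 smooth_a uJ lE).
move=> ->; exists (stages L (fun q => - Abf A q) t (usubmx z)).
have /(momentum_update L_explicit b_neq0 smooth_a _ _ uJ) lE :=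
  erefl (back_stages L b (stage_matrix L (Abf A) t (usubmx z)) t
    ((invmx (rk_jac L b (fun q => - Abf A q) t (usubmx z)))^T *m dsubmx z)).
eexists; split; [exact: stagesP|rewrite mag_matrixE; exact: lE|].
rewrite /num_flow /mag_num; congr (col_mx _ _); apply/esym.
exact (rk_update_momentum L_explicit b_neq0 smooth_a uJ lE).
Qed.

Lemma mag_well_definedT t z : `|t| <= tau0 -> mag_well_defined A L b t z.
Proof.
move=> tt; have uJ := jac_unit (usubmx z) tt; split.
  exists (stages L (fun q => - Abf A q) t (usubmx z)); split; first exact: stagesP.
  by move=> k kE; apply/esym; exact: stages_unique.
move=> k /stages_unique ->; rewrite mag_matrixE.
eexists; split.
  by apply/(momentum_update L_explicit b_neq0 smooth_a _ _ uJ); reflexivity.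
by move=> l /(momentum_update L_explicit b_neq0 smooth_a _ _ uJ) ->.
Qed.

Lemma substepE P t z z' : (is_mag P -> `|t| <= tau0) ->
  substep A V L b P t z z' <-> z' = num_flow P t z.
Proof. by case: P => // /(_ isT); exact: mag_stepE. Qed.

Definition small_steps sch (tau : R) : Prop :=
  {in mag_coefs sch, forall c, `|c * tau| <= tau0}.

Lemma small_steps_cons c sch tau : small_steps (c :: sch) tau ->
  (is_mag c.1 -> `|c.2 * tau| <= tau0) /\ small_steps sch tau.
Proof.
rewrite /small_steps /mag_coefs /=; case: (is_mag c.1) => /= H; last by split.
by split=> [_|x xs]; apply: H; rewrite inE ?eqxx// xs orbT.
Qed.

Lemma stepE sch tau z z' : small_steps sch tau ->
  step A V L b sch tau z z' <-> z' = run sch tau z.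
Proof.
elim: sch z => [|c sch IH] z //= /small_steps_cons[cs ss]; split.
  by move=> [y [/(substepE _ _ cs)-> /(IH _ ss)]].
move=> E; exists (num_flow c.1 (c.2 * tau) z); split; first exact/(substepE _ _ cs).
exact/(IH _ ss).
Qed.

Lemma well_definedT sch tau z : small_steps sch tau -> well_defined A V L b sch tau z.
Proof.
elim: sch z => [|c sch IH] z //= /small_steps_cons[cs ss]; split=> [cm|y _]; last exact: IH.
exact: mag_well_definedT (cs cm).
Qed.

Lemma integratorE sch tau z : small_steps sch tau ->
  integrator A V L b sch tau z = run sch tau z.
Proof.
move=> ss; apply/(stepE _ _ ss).
by apply: (@xgetI _ z [set z' | step A V L b sch tau z z'] (run sch tau z)); apply/(stepE _ _ ss).
Qed.

Lemma smooth_num P t : (is_mag P -> `|t| <= tau0) -> smooth_vec (num_flow P t).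
Proof.
case: P => [_|_|/(_ isT) tt].
- rewrite (_ : num_flow _ _ = fun z => z + t *: kin_field z).
    apply: smooth_vecD; first exact: smooth_vec_id.
    by apply: smooth_vecZ; exact: smooth_kin_field.
  by apply/funext => z; exact: num_kin.
- rewrite (_ : num_flow _ _ = fun z => z + t *: pot_field (Vbf A V) z).
    apply: smooth_vecD; first exact: smooth_vec_id.
    by apply: smooth_vecZ; exact: smooth_pot_field.
  by apply/funext => z; exact: num_pot.
- exact: (smooth_mag_num smooth_a near_id tt).
Qed.

Lemma symplectic_num P t z : (is_mag P -> `|t| <= tau0) -> symplectic_at (num_flow P t) z.
Proof.
move=> Pt; split; first by apply: smooth_vec_differentiable; exact: smooth_num.
case: P Pt => [_|_|/(_ isT) tt].
- rewrite (_ : num_flow _ _ = fun z => col_mx (usubmx z + t *: dsubmx z) (dsubmx z)); last first.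
    apply/funext => y; rewrite num_kin -{1}[y]vsubmxK /kin_field scale_col_mx add_col_mx.
    by rewrite scaler0 addr0.
  rewrite Jac_col_mx JacD; [|exact: smooth_vec_usubmx|by apply: smooth_vecZ; exact: smooth_vec_dsubmx].
  rewrite JacZ; last exact: smooth_vec_dsubmx.
  rewrite Jac_usubmx Jac_dsubmx scale_row_mx add_row_mx -block_mxEv scaler0 addr0 add0r.
  apply: symplectic_block.
  + by rewrite mulmx0 trmx0 mul0mx.
  + by rewrite trmx1 mul1mx mulmx1 linearZ/= trmx1.
  + by rewrite trmx1 mul1mx trmx0 mul0mx subr0.
- rewrite (_ : num_flow _ _ = fun z => col_mx (usubmx z)
      (dsubmx z - t *: grad (Vbf A V) (usubmx z))); last first.
    apply/funext => y; rewrite num_pot -{1}[y]vsubmxK /pot_field scale_col_mx add_col_mx.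
    by rewrite scaler0 addr0 scalerN.
  have sg : smooth_vec (fun z : phase => grad (Vbf A V) (usubmx z)).
    exact: smooth_vec_comp (smooth_grad smooth_w) (@smooth_vec_usubmx R D D).
  rewrite Jac_col_mx JacD; [|exact: smooth_vec_dsubmx|by apply: smooth_vecN; exact: smooth_vecZ].
  rewrite JacN ?JacZ; [|exact: sg|exact: smooth_vecZ].
  rewrite (Jac_comp _ (smooth_grad smooth_w) (@smooth_vec_usubmx R D D)).
  rewrite Jac_usubmx Jac_dsubmx mul_mx_row mulmx0 mulmx1.
  rewrite scale_row_mx opp_row_mx add_row_mx -block_mxEv scaler0 oppr0 addr0 add0r.
  set H := Jac _ _.
  have HT : H^T = H.
    apply/matrixP => i j; rewrite !mxE.
    under [fun y => grad _ y i 0]eq_fun do rewrite mxE.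
    under [fun y => grad _ y j 0]eq_fun do rewrite mxE.
    exact: partial_comm.
  apply: symplectic_block.
  + by rewrite trmx1 mul1mx mulmx1 -scaleNr [RHS]linearZ/= HT.
  + by rewrite trmx0 mul0mx mulmx0.
  + by rewrite trmx1 mulmx1 mulmx0 subr0.
- exact: (symplectic_mag_num smooth_a near_id z tt).2.
Qed.

Lemma symplectic_run sch tau z : small_steps sch tau ->
  smooth_vec (run sch tau) /\ symplectic_at (run sch tau) z.
Proof.
elim: sch z => [|c sch IH] z; first by split; [exact: smooth_vec_id|exact: symplectic_id].
move=> /small_steps_cons[cs ss]; have [sr yr] := IH (num_flow c.1 (c.2 * tau) z) ss.
have sn := smooth_num cs.
split; first exact: smooth_vec_comp sr sn.
exact: symplectic_comp sr sn (symplectic_num z cs) yr.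
Qed.

(** * Explicitness *)

Section explicitness.
Variable S : set (R * phase).
Local Notation evec := (explicit_vec A V S).
Local Notation emat := (explicit_mat A V S).

Lemma explicit_vec_eq f g : evec f -> (forall tau z, g tau z = f tau z) -> evec g.
Proof. by move=> ef gf; rewrite (_ : g = f)//; apply/funext => tau; apply/funext. Qed.

Lemma explicit_mat_eq F G : emat F -> (forall tau z, G tau z = F tau z) -> emat G.
Proof. by move=> eF GF; rewrite (_ : G = F)//; apply/funext => tau; apply/funext. Qed.

Lemma explicit_vec0 : evec (fun _ _ => 0).
Proof.
by apply: explicit_vec_eq (ev_scale 0 (ev_q A V S)) _ => tau z; rewrite scale0r.
Qed.

Lemma explicit_mat0 : emat (fun _ _ => 0).
Proof.
by apply: explicit_mat_eq (em_scale 0 (em_one A V S)) _ => tau z; rewrite scale0r.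
Qed.

Lemma explicit_vec_sum (I : Type) (r : seq I) (Q : pred I) F :
  (forall i, evec (F i)) -> evec (fun tau z => \sum_(i <- r | Q i) F i tau z).
Proof.
move=> eF; elim: r => [|i r IH].
  by apply: explicit_vec_eq explicit_vec0 _ => tau z; rewrite big_nil.
case Qi : (Q i); last first.
  by apply: explicit_vec_eq IH _ => tau z; rewrite big_cons Qi.
by apply: explicit_vec_eq (ev_add (eF i) IH) _ => tau z; rewrite big_cons Qi.
Qed.

Lemma explicit_mat_sum (I : Type) (r : seq I) (Q : pred I) F :
  (forall i, emat (F i)) -> emat (fun tau z => \sum_(i <- r | Q i) F i tau z).
Proof.
move=> eF; elim: r => [|i r IH].
  by apply: explicit_mat_eq explicit_mat0 _ => tau z; rewrite big_nil.
case Qi : (Q i); last first.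
  by apply: explicit_mat_eq IH _ => tau z; rewrite big_cons Qi.
by apply: explicit_mat_eq (em_add (eF i) IH) _ => tau z; rewrite big_cons Qi.
Qed.

Lemma explicit_vec_step c f : evec f -> evec (fun tau z => (c * tau) *: f tau z).
Proof.
move=> ef; apply: explicit_vec_eq (ev_scale c (ev_tau ef)) _ => tau z.
by rewrite scalerA.
Qed.

Lemma explicit_mat_step c F : emat F -> emat (fun tau z => (c * tau) *: F tau z).
Proof.
move=> eF; apply: explicit_mat_eq (em_scale c (em_tau eF)) _ => tau z.
by rewrite scalerA.
Qed.

Lemma explicit_vecN f : evec f -> evec (fun tau z => - f tau z).
Proof. by move=> ef; apply: explicit_vec_eq (ev_scale (-1) ef) _ => tau z; rewrite scaleN1r. Qed.

Section magnetic_step.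
Variables (c : R) (f : R -> phase -> 'cV[R]_D).
Hypothesis ef : evec f.
Local Notation fA := (fun q => - Abf A q).

Lemma explicit_node k i : (forall j, evec (k j)) ->
  evec (fun tau z => rk_node L (c * tau) (f tau z) (fun j => k j tau z) i).
Proof.
move=> ek; apply: ev_add ef _; apply: explicit_vec_step.
by apply: explicit_vec_sum => j; exact: ev_scale.
Qed.

(** Successive substitution reaches the stages after finitely many evaluations
   of the averaged vector potential. *)
Lemma explicit_stages i : evec (fun tau z => stages L fA (c * tau) (f tau z) i).
Proof.
suff H m : forall i, evec (fun tau z =>
    iter m (stage_op L fA (c * tau) (f tau z)) (fun=> 0) i) by exact: H.
elim: m => [|m IH] {}i; first exact: explicit_vec0.
apply: explicit_vecN; apply: ev_A.
exact: (@explicit_node (fun j tau z =>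
  iter m (stage_op L fA (c * tau) (f tau z)) (fun=> 0) j)).
Qed.

Lemma explicit_stage_jac i : emat (fun tau z => stage_jac L fA (c * tau) (f tau z) i).
Proof.
suff H m : forall i, emat (fun tau z =>
    iter m (stage_jac_op L fA (c * tau) (f tau z)) (fun=> 0) i) by exact: H.
elim: m => [|m IH] {}i; first exact: explicit_mat0.
apply: em_mul.
  apply: explicit_mat_eq (em_scale (-1) (em_JA (@explicit_node (fun j tau z =>
    stages L fA (c * tau) (f tau z) j) i explicit_stages))) _ => tau z.
  by rewrite scaleN1r -JacN.
apply: em_add; first exact: em_one.
apply: explicit_mat_step; apply: (@explicit_mat_sum _ _ _ (fun j tau z =>
  L i j *: iter m (stage_jac_op L fA (c * tau) (f tau z)) (fun=> 0) j)) => j.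
exact: em_scale.
Qed.

Lemma explicit_rk_map : evec (fun tau z => rk_map L b fA (c * tau) (f tau z)).
Proof.
apply: ev_add ef _; apply: explicit_vec_step; apply: explicit_vec_sum => j.
by apply: ev_scale; exact: explicit_stages.
Qed.

Lemma explicit_rk_jac : emat (fun tau z => rk_jac L b fA (c * tau) (f tau z)).
Proof.
apply: em_add; first exact: em_one.
apply: explicit_mat_step; apply: explicit_mat_sum => j.
by apply: em_scale; exact: explicit_stage_jac.
Qed.

End magnetic_step.

Lemma explicit_num c f g : (forall tau z, S (tau, z) -> is_mag c.1 -> `|c.2 * tau| <= tau0) ->
  evec f -> evec g -> exists f' g', [/\ evec f', evec g' & forall tau z,
    num_flow c.1 (c.2 * tau) (col_mx (f tau z) (g tau z)) = col_mx (f' tau z) (g' tau z)].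
Proof.
case: c => -[] c Sc ef eg.
- exists (fun tau z => f tau z + (c * tau) *: g tau z), g; split=> //.
    by apply: ev_add => //; exact: explicit_vec_step.
  move=> tau z; rewrite num_kin /kin_field scale_col_mx add_col_mx col_mxKd.
  by rewrite scaler0 addr0.
- exists f, (fun tau z => g tau z + (c * tau) *: - grad (Vbf A V) (f tau z)); split=> //.
    apply: ev_add => //; apply: explicit_vec_step; apply: explicit_vecN.
    exact: ev_gradV.
  move=> tau z; rewrite num_pot /pot_field scale_col_mx add_col_mx col_mxKu.
  by rewrite scaler0 addr0.
- exists (fun tau z => rk_map L b (fun q => - Abf A q) (c * tau) (f tau z)),
    (fun tau z => (invmx (rk_jac L b (fun q => - Abf A q) (c * tau) (f tau z)))^T *m g tau z).
  split; first exact: explicit_rk_map.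
    apply: ev_mul => //; apply: em_tr; apply: em_inv; first exact: explicit_rk_jac.
    by move=> tau z Sz; apply: jac_unit; exact: (Sc _ _ Sz).
  by move=> tau z; rewrite /num_flow /mag_num col_mxKu col_mxKd.
Qed.

Lemma explicit_run sch f g : (forall tau z, S (tau, z) -> small_steps sch tau) ->
  evec f -> evec g -> exists f' g', [/\ evec f', evec g' & forall tau z,
    run sch tau (col_mx (f tau z) (g tau z)) = col_mx (f' tau z) (g' tau z)].
Proof.
elim: sch f g => [|c sch IH] f g Ssch ef eg; first by exists f, g.
have [|f' [g' [ef' eg' fgE]]] := @explicit_num c f g _ ef eg.
  by move=> tau z Sz; have [] := small_steps_cons (Ssch _ _ Sz).
have [|f'' [g'' [ef'' eg'' runE]]] := IH f' g' _ ef' eg'.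
  by move=> tau z Sz; have [] := small_steps_cons (Ssch _ _ Sz).
by exists f'', g''; split=> // tau z; rewrite -runE -fgE.
Qed.

Lemma explicit_on_run sch : (forall tau z, S (tau, z) -> small_steps sch tau) ->
  explicit_on A V S (integrator A V L b sch).
Proof.
move=> Ssch.
have [f [g [ef eg runE]]] := explicit_run Ssch (ev_q A V S) (ev_p A V S).
exists f, g; split=> // tau z Sz.
by rewrite (integratorE _ (Ssch _ _ Sz)) -{1}[z]vsubmxK runE.
Qed.

End explicitness.

(** * Order *)

Lemma smooth_part P : smooth_vec (ham_field (h_part A V P)).
Proof.
case: P.
- rewrite ham_kinE; exact: smooth_kin_field.
- rewrite ham_potE; exact: smooth_pot_field.
- rewrite ham_magE; exact: smooth_mag_vfield.
Qed.

Lemma linear_growth_part P : linear_growth (ham_field (h_part A V P)).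
Proof.
case: P.
- rewrite ham_kinE; exact: linear_growth_kin_field.
- rewrite ham_potE; exact (linear_growth_pot_field smooth_w C_ge0 Hess_w).
- rewrite ham_magE; exact (linear_growth_mag_vfield smooth_a C_ge0 Jac_a).
Qed.

Lemma complete_part P : complete (ham_field (h_part A V P)).
Proof.
case: P => z.
- exists (fun t => z + t *: kin_field z); last by rewrite scale0r addr0.
  by rewrite ham_kinE; apply: line_solution; exact: kin_field_line.
- exists (fun t => z + t *: pot_field (Vbf A V) z); last by rewrite scale0r addr0.
  by rewrite ham_potE; apply: line_solution; exact: pot_field_line.
- have [q [p [_ [su _ zE _ _]]]] := mag_solution smooth_a C_ge0 Jac_a z 0.
  by exists (fun t => col_mx (q t) (p t)); rewrite ?ham_magE.
Qed.

Lemma linear_growth_tot : linear_growth (ham_field (h_tot A V)).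
Proof.
have -> : ham_field (h_tot A V) = fun z => ham_field (h_part A V Kin) z
    + ham_field (h_part A V Pot) z + ham_field (h_part A V Mag) z.
  by rewrite ham_kinE ham_potE ham_magE; exact: ham_tot.
by apply: linear_growthD; [apply: linear_growthD|]; exact: linear_growth_part.
Qed.

Lemma local_error P (nu : nat) (rho : R) : rk_order L b nu ->
  exists K tau1 : R, [/\ 0 <= K, 0 < tau1 & forall t z, `|t| <= tau1 -> `|z| <= rho ->
    `|num_flow P t z - flow (ham_field (h_part A V P)) t z| <= K * `|t| ^+ nu.+1].
Proof.
move=> ord; case: P; last first.
  rewrite ham_magE.
  exact: (mag_local_error smooth_a C_ge0 Jac_a near_id rho tau0_gt0 ord).
all: by exists 0, 1; split=> // t z _ _; rewrite subrr normr0 mul0r.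
Qed.

Lemma num_bounded P (rho T : R) : exists B, forall t z, (is_mag P -> `|t| <= tau0) ->
  `|t| <= T -> `|z| <= rho -> `|num_flow P t z| <= B.
Proof.
have [B _ BP] := flow_bounded rho T (linear_growth_part P).
case: P BP => BP; [by exists B => t z _; exact: BP|by exists B => t z _; exact: BP|].
have [B' BP'] := mag_num_bounded smooth_a near_id rho (lexx tau0).
by exists B' => t z tt _ zr; apply: BP' zr; exact: tt.
Qed.

Lemma run_bounded sch (rho : R) : exists B, forall tau z, 0 < tau <= tau0 ->
  small_steps sch tau -> `|z| <= rho -> `|run sch tau z| <= B.
Proof.
elim: sch rho => [|c sch IH] rho; first by exists rho.
have [B BP] := num_bounded c.1 rho (`|c.2| * tau0).
have [B' BP'] := IH B; exists B' => tau z tt /small_steps_cons[cs ss] zr.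
apply: BP' => //; apply: BP => //.
by have /andP[t0 t1] := tt; rewrite normrM ler_wpM2l// gtr0_norm.
Qed.

(** One sub-step adds its local error to the difference of the two trajectories,
   which the exact sub-flow magnifies at most by a constant; the constants are
   uniform because all intermediate points stay in a ball. *)
Lemma run_error sch (nu : nat) (rho : R) : rk_order L b nu ->
  exists K tau1 : R, [/\ 0 <= K, 0 < tau1 & forall tau x y, 0 < tau <= tau1 ->
    `|x| <= rho -> `|y| <= rho ->
    `|run sch tau x - exact_splitting A V sch tau y| <= K * (`|x - y| + tau ^+ nu.+1)].
Proof.
move=> ord; elim: sch rho => [|c sch IH] rho.
  exists 1, 1; split=> // tau x y /andP[tau_gt0 _] _ _.
  by rewrite mul1r lerDl exprn_ge0// ltW.
have [B B0 BP] := flow_bounded rho (`|c.2|) (linear_growth_part c.1).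
have [Kl Kl0 KlP] := flow_lipschitz rho (`|c.2|) (smooth_part c.1)
  (linear_growth_part c.1) (complete_part c.1).
have [Ke [t1 [Ke0 t10 KeP]]] := local_error c.1 rho ord.
pose ke := Ke * `|c.2| ^+ nu.+1.
have ke0 : 0 <= ke by rewrite mulr_ge0// exprn_ge0.
have [K [t2 [K0 t20 KP]]] := IH (B + ke).
have c1 : 0 < `|c.2| + 1 by rewrite ltr_wpDl.
exists (K * (Kl + ke + 1)), (Num.min 1 (Num.min t2 (t1 / (`|c.2| + 1)))).
split; [by rewrite mulr_ge0// !addr_ge0|by rewrite !lt_min ltr01 t20 divr_gt0|].
move=> tau x y /andP[tau_gt0]; rewrite !le_min => /and3P[tau_1 tau_2 tau_3] xr yr.
have tau_ge0 := ltW tau_gt0.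
set t := c.2 * tau.
have tE : `|t| = `|c.2| * tau by rewrite normrM (gtr0_norm tau_gt0).
have tc : `|t| <= `|c.2| by rewrite tE ler_piMr.
have tt1 : `|t| <= t1.
  rewrite tE; move: tau_3; rewrite ler_pdivlMr// mulrC; apply: le_trans.
  by rewrite ler_wpM2r// lerDl.
have tn : 0 <= tau ^+ nu.+1 by rewrite exprn_ge0.
have err z : `|z| <= rho -> `|num_flow c.1 t z - flow (ham_field (h_part A V c.1)) t z|
    <= ke * tau ^+ nu.+1.
  by move=> zr; rewrite (le_trans (KeP _ _ tt1 zr))// /ke tE exprMn mulrA.
have numB : `|num_flow c.1 t x| <= B + ke.
  rewrite -[num_flow _ _ _](subrK (flow (ham_field (h_part A V c.1)) t x)) addrC.
  rewrite (le_trans (ler_normD _ _))// lerD ?BP// (le_trans (err _ xr))//.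
  by rewrite ler_piMr// exprn_ile1.
have exB : `|flow (ham_field (h_part A V c.1)) t y| <= B + ke.
  by rewrite (le_trans (BP _ _ tc yr))// lerDl.
apply: le_trans (KP tau _ _ _ numB exB) _; first by rewrite tau_gt0.
rewrite -mulrA ler_wpM2l//.
have H : `|num_flow c.1 t x - flow (ham_field (h_part A V c.1)) t y| <=
    ke * tau ^+ nu.+1 + Kl * `|x - y|.
  rewrite -(subrKA (flow (ham_field (h_part A V c.1)) t x)) (le_trans (ler_normD _ _))//.
  by rewrite lerD ?err ?KlP.
apply: le_trans (lerD H (lexx _)) _.
have xy := normr_ge0 (x - y).
move: (tau ^+ nu.+1) (`|x - y|) tn xy => u v u0 v0; nra.
Qed.

(** For small steps the errors of the splitting and of the sub-steps add up. For
   steps above the threshold [t3] both maps are bounded, and the bound is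
   absorbed into the constant since [tau ^+ nu.+1 >= t3 ^+ nu.+1]. *)
Lemma order_run sch (nu : nat) (K : set phase) : compact K ->
  splitting_order A V nu sch -> rk_order L b nu ->
  exists M, forall tau z, 0 < tau <= tau0 -> small_steps sch tau -> K z ->
    `|integrator A V L b sch tau z - flow (ham_field (h_tot A V)) tau z|
      <= M * tau ^+ nu.+1.
Proof.
move=> cK split_ord ord.
have [C1 [t1 [t10 split_err]]] := split_ord K cK.
have [M0 [_ KM]] := compact_bounded cK.
pose rho := M0 + 1.
have Kr z : K z -> `|z| <= rho by apply: KM; rewrite ltrDl.
have [C2 [t2 [C20 t20 run_err]]] := run_error sch rho ord.
have [B1 run_bnd] := run_bounded sch rho.
have [B2 B20 flow_bnd] := flow_bounded rho tau0 linear_growth_tot.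
pose t3 := Num.min t1 t2.
have t30 : 0 < t3 by rewrite lt_min t10.
exists (Num.max (C2 + C1) (Num.max 0 (B1 + B2) / t3 ^+ nu.+1)) => tau z tt ss Kz.
rewrite integratorE//; have /andP[tau_gt0 tau_le] := tt.
have tn : 0 <= tau ^+ nu.+1 by rewrite exprn_ge0// ltW.
have [tau3|tau3] := leP tau t3.
  move: tau3; rewrite le_min => /andP[tau1 tau2].
  apply: (@le_trans _ _ ((C2 + C1) * tau ^+ nu.+1)); last by rewrite ler_wpM2r// le_max lexx.
  rewrite -(subrKA (exact_splitting A V sch tau z)) (le_trans (ler_normD _ _))// mulrDl lerD//.
    have := run_err tau z z; rewrite subrr normr0 add0r; apply; rewrite ?tau_gt0 ?Kr//.
  by apply: split_err; rewrite ?tau_gt0.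
apply: (@le_trans _ _ (Num.max 0 (B1 + B2) / t3 ^+ nu.+1 * tau ^+ nu.+1)); last first.
  by rewrite ler_wpM2r// le_max lexx orbT.
apply: (@le_trans _ _ (Num.max 0 (B1 + B2))).
  rewrite le_max; apply/orP; right; rewrite (le_trans (ler_normB _ _))// lerD ?run_bnd ?Kr//.
  by rewrite flow_bnd ?Kr// gtr0_norm.
rewrite mulrAC ler_pdivlMr ?exprn_gt0// ler_wpM2l ?le_max ?lexx//.
by rewrite lerXn2r ?nnegrE ?(ltW t30) ?(ltW tau_gt0)// ltW.
Qed.

End SplittingIntegrator.

Theorem corollary4p6 (R : realType) (d : nat)
    (A : 'cV[R]_d -> 'cV[R]_d) (V : 'cV[R]_d -> R)
    (smoothA : smooth_vec A) (smoothV : smooth V)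
    (bndV : bounded_partials 2 (fun x => V x + 2^-1 * sqnorm (A x)))
    (bndA : forall i, bounded_partials 1 (fun x => A x i 0))
    (s : nat) (L : 'M[R]_s) (b : 'cV[R]_s)
    (L_explicit : explicit_tableau L) (b_neq0 : forall i, b i 0 != 0)
    (K : set 'cV[R]_(dimD d + dimD d)) (compactK : compact K) :
  exists tau0 : R, 0 < tau0 /\
  forall (nu : nat) (sch : scheme),
    splitting_order A V nu sch -> rk_order L b nu ->
    let T := [set tau : R | 0 < tau <= tau0 /\
                {in mag_coefs sch, forall c, `|c * tau| <= tau0}] in
    let S := visited A V L b sch T K in
    let Phi := integrator A V L b sch in
    [/\ forall tau z, S (tau, z) -> well_defined A V L b sch tau z,
        explicit_on A V S Phi,
        forall tau z, S (tau, z) -> symplectic_at (Phi tau) z &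
        order_on A V S nu Phi].
Proof.
have sa := smooth_Abf smoothA bndA.
have sw := smooth_Vbf smoothA bndA smoothV bndV.
have [C1 C10 Ja] := Jac_Abf_bounded smoothA bndA.
have [C2 Hw] := Hessian_Vbf_bounded smoothA bndA smoothV bndV.
pose C := Num.max C1 C2.
have C0 : 0 <= C by rewrite le_max C10.
have {}Ja q : `|Jac (Abf A) q| <= C by rewrite le_max Ja.
have {}Hw i j q : `|partial j (partial i (Vbf A V)) q| <= C by rewrite le_max Hw orbT.
have Jf q : `|Jac (fun q => - Abf A q) q| <= C by rewrite JacN// normrN.
have [tau0 [tau0_gt0 near_id]] := rk_jac_near_id L b Jf.
exists tau0; split=> // nu sch split_ord ord T S Phi.
have ST tau z : S (tau, z) -> T tau by case.
have SK tau z : S (tau, z) -> K z by move=> [_ [N [y [_ yK [n nN /= <-]]]]]; exact: yK.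
split.
- by move=> tau z /ST[_ ss]; exact: (well_definedT V L_explicit b_neq0 sa near_id z ss).
- apply: (explicit_on_run L_explicit b_neq0 sa sw C0 Hw near_id) => tau z.
  by move=> /ST[].
- move=> tau z /ST[_ ss].
  rewrite (_ : Phi tau = run A V L b sch tau).
    exact: (symplectic_run sa sw C0 Hw near_id z ss).2.
  by apply/funext => y; exact: (integratorE V L_explicit b_neq0 sa near_id y ss).
have [M MP] := order_run L_explicit b_neq0 sa sw C0 Ja Hw tau0_gt0 near_id compactK split_ord ord.
by exists M => tau z Sz; have [tt ss] := ST _ _ Sz; exact: MP (SK _ _ Sz).
Qed.
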